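(* Let $\Omega$ be a hyperbolic domain in $\hat{\mathbb C}$ with an isolated boundary point $p$ and let $\lambda(z)\,|dz|$ be a conformal pseudometric on $\Omega$ with curvature $\kappa_\lambda\le-4$. Suppose that $\{z_n\}$ is a sequence in $\Omega$ tending to $p\in\partial\Omega$. If $$\frac{\lambda(z_n)}{\lambda_\Omega(z_n)}=1+o\left(e^{-2\,\mathrm d_\Omega(z_n,q)}\right)\qquad(n\to\infty)$$ for one (and hence for any) $q\in\Omega$, then $\lambda=\lambda_\Omega$ on $\Omega$.
   Context: $\hat{\mathbb C}=\mathbb C\cup\{\infty\}$ is the Riemann sphere. A hyperbolic domain $\Omega$ in $\hat{\mathbb C}$ is a non-empty, open, connected subset such that $\hat{\mathbb C}\setminus\Omega$ contains at least three distinct points. An isolated boundary point is an isolated point of $\partial\Omega$ (boundary in $\hat{\mathbb C}$). A conformal pseudometric $\lambda(z)\,|dz|$ on a domain $G\subseteq\mathbb C$ is a continuous function $\lambda:G\to[0,\infty)$; it is assumed throughout to be of class $C^2$ on the open set $G_\lambda=\{z\in G:\lambda(z)>0\}$. Its Gauss curvature is $\kappa_\lambda(z)=-\Delta(\log\lambda)(z)/\lambda(z)^2$ for $z\in G_\lambda$, and ''$\kappa_\lambda\le-4$'' means $\kappa_\lambda(z)\le-4$ for all $z\in G_\lambda$. On subdomains of $\hat{\mathbb C}$ these notions are defined via local coordinates, with the transformation rule $(f^*\lambda)(z)\,|dz|=\lambda(f(z))\,|f'(z)|\,|dz|$ (curvature is conformally invariant, and the ratio of two pseudometrics with non-zero denominator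 is a well-defined function). The hyperbolic metric of the unit disk $\mathbb D$ is $\lambda_{\mathbb D}(z)\,|dz|=|dz|/(1-|z|^2)$ (curvature $-4$). The hyperbolic metric $\lambda_\Omega(z)\,|dz|$ of $\Omega$ is defined by $\lambda_\Omega(\pi(z))|\pi'(z)|=\lambda_{\mathbb D}(z)$ for a holomorphic universal covering $\pi:\mathbb D\to\Omega$. The hyperbolic distance is $\mathrm d_\Omega(z,w)=\inf_\gamma\int_\gamma\lambda_\Omega(\zeta)\,|d\zeta|$, the infimum being over all piecewise smooth curves $\gamma$ in $\Omega$ joining $z$ and $w$. *)

(* Defs.v *)
From HB Require Import structures.
From mathcomp Require Import all_boot all_order all_algebra.
From mathcomp Require Import complex.
From mathcomp Require Import all_classical all_reals all_analysis.

Set Implicit Arguments.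
Unset Strict Implicit.
Unset Printing Implicit Defensive.

Import Order.TTheory GRing.Theory Num.Theory.
Import numFieldNormedType.Exports.

Local Open Scope classical_set_scope.
Local Open Scope ring_scope.

(* Naming the structure, and not only the carrier [R[i]], is what lets the
   generic norm and topology of a number field be inferred for it. *)
Definition CC (R : realType) : numFieldType := R[i].

Definition sphere (R : realType) : topologicalType :=
  one_point_compactification (CC R).

Section Defs.
Variable R : realType.

Local Notation C := (CC R).
Local Notation S2 := (sphere R).

Definition infty : S2 := None.
Definition pt (z : C) : S2 := Some z.

Definition cmod (z : C) : R := ComplexField.Normc.normc z.

Definition sinv (p : S2) : S2 :=
  if p is Some z then (if z == 0 then infty else pt z^-1) else pt 0.

(* The local coordinate used at p: z if p is finite, 1/z if p is infinity.
   Only its values near p matter; it is set to 0 at its pole. *)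
Definition chart (p q : S2) : C :=
  odflt 0 (if p is Some _ then q else sinv q).

(* Domains *)

Definition boundary (A : set S2) : set S2 := closure A `\` A°.

Definition hyperbolic_domain (W : set S2) : Prop :=
  [/\ W !=set0, open W, connected W &
    exists a b c : S2, [/\ ~ W a, ~ W b & ~ W c] /\ [/\ a <> b, b <> c & a <> c]].

Definition isolated_boundary_point (W : set S2) (p : S2) : Prop :=
  isolated (boundary W) p.

(* Conformal pseudometrics on plane open sets *)

Definition mkC (x y : R) : C := Complex x y.
Definition re (z : C) : R := complex.Re z.
Definition im (z : C) : R := complex.Im z.

Definition dx (u : C -> R) (z : C) : R := derive1 (fun x : R => u (mkC x (im z))) (re z).
Definition dy (u : C -> R) (z : C) : R := derive1 (fun y : R => u (mkC (re z) y)) (im z).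

Definition C1_on (G : set C) (u : C -> R) : Prop :=
  forall z, G z ->
    [/\ derivable (fun x : R => u (mkC x (im z))) (re z) 1,
        derivable (fun y : R => u (mkC (re z) y)) (im z) 1,
        {for z, continuous (dx u)} & {for z, continuous (dy u)}].

Definition C2_on (G : set C) (u : C -> R) : Prop :=
  [/\ C1_on G u, C1_on G (dx u) & C1_on G (dy u)].

Definition laplacian (u : C -> R) (z : C) : R := dx (dx u) z + dy (dy u) z.

Definition plane_pseudometric (G : set C) (mu : C -> R) : Prop :=
  [/\ forall z, G z -> 0 <= mu z,
      forall z, G z -> {for z, continuous mu} &
      C2_on (G `&` [set z | 0 < mu z]) mu].

Definition plane_curvature (mu : C -> R) (z : C) : R :=
  - laplacian (fun w => ln (mu w)) z / mu z ^+ 2.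

(* A pseudometric on the sphere is encoded by one function lam, where lam p is
   the density at p with respect to [chart p], that is, with respect to z at
   finite points and to 1/z at infinity. The ratio of two pseudometrics is then
   the pointwise quotient. *)

Definition density_z (lam : S2 -> R) (z : C) : R := lam (pt z).

(* The density with respect to w = 1/z; the factor is |dz/dw|. *)
Definition density_w (lam : S2 -> R) (w : C) : R :=
  if w == 0 then lam infty else lam (pt w^-1) / cmod w ^+ 2.

Definition conformal_pseudometric (W : set S2) (lam : S2 -> R) : Prop :=
  plane_pseudometric [set z | W (pt z)] (density_z lam) /\
  plane_pseudometric [set w | W (sinv (pt w))] (density_w lam).

Definition curvature (lam : S2 -> R) (p : S2) : R :=
  if p is Some z then plane_curvature (density_z lam) z
  else plane_curvature (density_w lam) 0.

Definition curvature_le (W : set S2) (lam : S2 -> R) (k : R) : Prop :=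
  forall p, W p -> 0 < lam p -> curvature lam p <= k.

(* The hyperbolic metric *)

Definition disk : set C := [set z | cmod z < 1].

Definition lambda_disk (z : C) : R := 1 / (1 - cmod z ^+ 2).

Definition holomorphic_at (f : C -> S2) (z : C) : Prop :=
  {for z, continuous f} /\ derivable (chart (f z) \o f) z 1.

(* |f'(z)| with respect to [chart (f z)]. *)
Definition cderiv_mod (f : C -> S2) (z : C) : R :=
  cmod (derive1 (chart (f z) \o f) z).

Definition homeo_between (V : set C) (U : set S2) (f : C -> S2) : Prop :=
  exists g : S2 -> C,
    [/\ f @` V = U, forall z, V z -> g (f z) = z,
        {within V, continuous f} & {within U, continuous g}].

Definition evenly_covered (f : C -> S2) (U : set S2) : Prop :=
  exists sheets : set (set C),
    [/\ trivIset sheets id,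
        disk `&` f @^-1` U = \bigcup_(V in sheets) V &
        forall V, sheets V -> open V /\ homeo_between V U f].

(* Since the disk is simply connected, any covering by it is universal. *)
Definition holomorphic_universal_covering (W : set S2) (f : C -> S2) : Prop :=
  [/\ forall z, disk z -> holomorphic_at f z,
      f @` disk = W &
      forall p, W p -> exists U : set S2,
        [/\ open U, U p, U `<=` W & evenly_covered f U]].

Definition hyperbolic_metric (W : set S2) (lam : S2 -> R) : Prop :=
  exists f : C -> S2, holomorphic_universal_covering W f /\
    forall z, disk z -> lam (f z) * cderiv_mod f z = lambda_disk z.

(* The distance of a conformal metric *)

Definition re_at (c : R -> S2) (t s : R) : R := re (chart (c t) (c s)).
Definition im_at (c : R -> S2) (t s : R) : R := im (chart (c t) (c s)).

Definition C1_curve_at (c : R -> S2) (t : R) : Prop :=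
  [/\ {for t, continuous c},
      \forall s \near t, derivable (re_at c t) s 1 /\ derivable (im_at c t) s 1,
      {for t, continuous (derive1 (re_at c t))} &
      {for t, continuous (derive1 (im_at c t))}].

(* C^1 on the closed interval [a, b], stated through an extension that is C^1
   on a neighbourhood of [a, b] in order to avoid one-sided derivatives. *)
Definition smooth_on (c : R -> S2) (a b : R) : Prop :=
  exists g : R -> S2, forall t, a <= t <= b -> c t = g t /\ C1_curve_at g t.

Definition piecewise_smooth (c : R -> S2) : Prop :=
  exists s : seq R, itv_partition 0 1 s /\
    forall i, (i < size s)%N -> smooth_on c (nth 0 (0 :: s) i) (nth 0 s i).

Definition curve_joining (W : set S2) (z w : S2) (c : R -> S2) : Prop :=
  [/\ piecewise_smooth c, forall t, 0 <= t <= 1 -> W (c t), c 0 = z & c 1 = w].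

Definition speed (c : R -> S2) (t : R) : R :=
  cmod (mkC (derive1 (re_at c t) t) (derive1 (im_at c t) t)).

(* The corners of a piecewise smooth curve, where [speed] is not meaningful,
   form a null set. *)
Definition metric_length (lam : S2 -> R) (c : R -> S2) : \bar R :=
  (\int[@lebesgue_measure R]_(t in `[0%R, 1%R]) (lam (c t) * speed c t)%:E)%E.

Definition metric_dist (W : set S2) (lam : S2 -> R) (z w : S2) : R :=
  fine (ereal_inf [set metric_length lam c | c in curve_joining W z w]).

End Defs.

Arguments infty {R}.

(* Main.v *)
Require Import Defs.
From HB Require Import structures.
From mathcomp Require Import all_boot all_order all_algebra.
From mathcomp Require Import complex.
From mathcomp Require Import all_classical all_reals all_analysis measurable_realfun.
From mathcomp Require Import ring lra.
Import Order.TTheory GRing.Theory Num.Theory.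
Import numFieldNormedType.Exports.
Local Open Scope classical_set_scope.
Local Open Scope ring_scope.
Set Implicit Arguments.
Unset Strict Implicit.
Unset Printing Implicit Defensive.

(** Ahlfors' lemma gives lambda <= lambda_Omega ([ahlfors]), and a strong maximum
    principle for the quotient shows that either the two metrics agree or the
    inequality is strict at every point ([strong_max]). In the second case the
    quotient stays so far below 1 near the puncture that the assumed rate is
    impossible; this is a version of Hopf's boundary point lemma.

    To make it quantitative let l(z) = - ln |z - p|, or l(z) = ln |z| if p is
    infinity. This function is harmonic and tends to +oo at p, and since p is an
    isolated boundary point the punctured neighbourhood l >= K0 of p lies in Omega
    ([isolated_cusp]). Comparison with metrics of annuli and of punctured discs yields

      1 / (2 |z - p| (l + c)) <= lambda_Omega <= 1 / (2 |z - p| (l - K0))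

    in that neighbourhood, with z in place of z - p at infinity ([lamW_lower],
    [lamW_upper]). The upper bound makes 1 / (l - K0) a barrier for the curvature
    inequality, from which 1 - lambda / lambda_Omega >= C1 / l follows for some C1 > 0
    ([hopf_cusp]). The lower bound gives d(z, q) >= (1/2) ln l - C2, because every
    curve from z to q has to leave the neighbourhood ([length_lower],
    [dist_lower]); hence exp(-2 d(z, q)) <= C3 / l. So the deficit of the quotient is at
    least a positive multiple of exp(-2 d), and cannot be o(exp(-2 d)). Once the metrics
    agree the quotient is 1, and the asymptotic relation holds for every q.

    All comparisons rest on one test: where a quotient of two densities has a local
    maximum, the Laplacians of their logarithms are ordered ([max_ln_test]). It is
    applied to pseudometrics pulled back to the disc by the universal covering and to
    functions built from ln |z - p|, and needs information at a single point only.
    Therefore all functions are handled by their second order Taylor expansions at a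
    point ([jet]). The chain rule for these expansions needs that the derivative of a
    holomorphic function is again differentiable ([holomorphic_deriv]); this is
    deduced from Goursat's theorem, which provides primitives, and from Cauchy's
    estimates, which in turn follow from the maximum principle for expansions. *)

(** * Complex numbers through real and imaginary parts *)

Section Basics.
Variable R : realType.
Local Notation C := (CC R).
Implicit Types (z w h : C) (x y e d : R).

Lemma reD z w : re (z + w) = re z + re w. Proof. by case: z w => ? ? []. Qed.
Lemma imD z w : im (z + w) = im z + im w. Proof. by case: z w => ? ? []. Qed.
Lemma reN z : re (- z) = - re z. Proof. by case: z. Qed.
Lemma imN z : im (- z) = - im z. Proof. by case: z. Qed.
Lemma reM z w : re (z * w) = re z * re w - im z * im w.
Proof. by case: z w => ? ? []. Qed.
Lemma imM z w : im (z * w) = re z * im w + im z * re w.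
Proof. by case: z w => ? ? []. Qed.
Lemma re1 : re (1 : C) = 1. Proof. by []. Qed.
Lemma im1 : im (1 : C) = 0. Proof. by []. Qed.
Lemma re0 : re (0 : C) = 0. Proof. by []. Qed.
Lemma im0 : im (0 : C) = 0. Proof. by []. Qed.
Lemma re_mk x y : re (mkC x y) = x. Proof. by []. Qed.
Lemma im_mk x y : im (mkC x y) = y. Proof. by []. Qed.
Lemma CP z w : re z = re w -> im z = im w -> z = w.
Proof. by case: z w => a b [c d] /= -> ->. Qed.
Lemma mkCE z : mkC (re z) (im z) = z. Proof. by case: z. Qed.

Definition reimE := (reD, imD, reN, imN, reM, imM, re1, im1, re0, im0, re_mk, im_mk).

Definition cconj z : C := mkC (re z) (- im z).
Definition rc x : C := mkC x 0.
Lemma re_rc x : re (rc x) = x. Proof. by []. Qed.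
Lemma im_rc x : im (rc x) = 0. Proof. by []. Qed.
Lemma re_conj z : re (cconj z) = re z. Proof. by []. Qed.
Lemma im_conj z : im (cconj z) = - im z. Proof. by []. Qed.
Definition reimE' := (reimE, re_rc, im_rc, re_conj, im_conj).

Lemma cmod_ge0 z : 0 <= cmod z.
Proof. by case: z => a b; exact: sqrtr_ge0. Qed.
Lemma cmod_sq z : cmod z ^+ 2 = re z ^+ 2 + im z ^+ 2.
Proof. by case: z => a b; rewrite /cmod /= sqr_sqrtr // addr_ge0 ?sqr_ge0. Qed.
Lemma cmod0 : cmod (0 : C) = 0. Proof. exact: ComplexField.Normc.normc0. Qed.
Lemma cmod1 : cmod (1 : C) = 1. Proof. exact: ComplexField.Normc.normc1. Qed.
Lemma cmodM z w : cmod (z * w) = cmod z * cmod w.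
Proof. exact: ComplexField.Normc.normcM. Qed.
Lemma cmodV z : cmod z^-1 = (cmod z)^-1.
Proof. exact: ComplexField.Normc.normcV. Qed.
Lemma cmodX z n : cmod (z ^+ n) = cmod z ^+ n.
Proof. by elim: n => [|n IH]; rewrite ?expr0 ?cmod1 // !exprS cmodM IH. Qed.
Lemma cmodN z : cmod (- z) = cmod z.
Proof. exact: normcN. Qed.
Lemma cmodB z w : cmod (z - w) = cmod (w - z).
Proof. by rewrite -cmodN opprB. Qed.
Lemma cmodD z w : cmod (z + w) <= cmod z + cmod w.
Proof. exact: le_normcD. Qed.
Lemma cmod_eq0 z : (cmod z == 0) = (z == 0).
Proof.
apply/eqP/eqP => [|->]; last exact: cmod0.
exact: ComplexField.Normc.eq0_normc.
Qed.
Lemma cmod_gt0 z : (0 < cmod z) = (z != 0).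
Proof. by rewrite lt_def cmod_ge0 andbT cmod_eq0. Qed.
Lemma cmod_rc x : cmod (rc x) = `|x|.
Proof. by rewrite /cmod /= expr0n /= addr0 sqrtr_sqr. Qed.
Lemma cmod_conj z : cmod (cconj z) = cmod z.
Proof. by case: z => a b; rewrite /cmod /= sqrrN. Qed.
Lemma re_le_cmod z : `|re z| <= cmod z.
Proof.
rewrite -(ler_pXn2r (n := 2)) ?nnegrE ?cmod_ge0 // cmod_sq real_normK ?num_real //.
by rewrite lerDl sqr_ge0.
Qed.
Lemma im_le_cmod z : `|im z| <= cmod z.
Proof.
rewrite -(ler_pXn2r (n := 2)) ?nnegrE ?cmod_ge0 // cmod_sq real_normK ?num_real //.
by rewrite lerDr sqr_ge0.
Qed.
Lemma cmod_le_reim z : cmod z <= `|re z| + `|im z|.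
Proof.
rewrite -(ler_pXn2r (n := 2)) ?nnegrE ?cmod_ge0 ?addr_ge0 // cmod_sq sqrrD.
by rewrite !real_normK ?num_real // addrAC lerDl mulrn_wge0 // mulr_ge0.
Qed.
Lemma cmod_distB z w : `|cmod z - cmod w| <= cmod (z - w).
Proof.
rewrite ler_norml lerBrDl lerBlDr; apply/andP; split.
- by have := cmodD (w - z) z; rewrite subrK cmodB addrC.
- by have := cmodD (z - w) w; rewrite subrK; lra.
Qed.

(* The norm of the field [C] takes its values in [C]; [nbhs_cP] is the bridge to
   the real modulus, through which all neighbourhoods are handled. *)
Lemma lt_rc (c : C) x : rc x < c -> x < re c.
Proof. by case: c => a b; rewrite ltcE /= => /andP[_]. Qed.
Lemma nbhs_cP z (P : set C) :
  (\forall w \near z, P w) <-> exists2 d : R, 0 < d & forall w, cmod (w - z) < d -> P w.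
Proof.
split.
- move=> /nbhs_ballP[e /= e0 He].
  have e0' : 0 < re e by exact: (@lt_rc e 0).
  exists (re e) => // w wz; apply: He; rewrite -ball_normE /ball_ /=.
  have -> : e = rc (re e).
    case: e e0 {e0' wz} => a b; rewrite ltcE /= => /andP[/eqP /= b0 _].
    by rewrite /rc /= -b0.
  by rewrite ltcE /= eqxx /= -/(cmod (z - w)) cmodB.
- move=> [d d0 Hd]; apply/nbhs_ballP; exists (rc d) => /=; first by rewrite ltcE /= eqxx.
  move=> w; rewrite -ball_normE /ball_ /= ltcE /= eqxx /= => zw.
  by apply: Hd; rewrite cmodB.
Qed.

Lemma nearC z (P : set C) : (forall w, P w) -> \forall w \near z, P w.
Proof. by move=> H; apply/nbhs_cP; exists 1. Qed.
Lemma near_cball z d : 0 < d -> \forall w \near z, cmod (w - z) < d.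
Proof. by move=> d0; apply/nbhs_cP; exists d. Qed.
Lemma near_cball0 d : 0 < d -> \forall w \near (0 : C), cmod w < d.
Proof. by move=> d0; apply/nbhs_cP; exists d => // w; rewrite subr0. Qed.

Lemma near_shift z (P : set C) :
  (\forall w \near z, P w) <-> (\forall h \near (0 : C), P (z + h)).
Proof.
split => /nbhs_cP[d d0 Hd]; apply/nbhs_cP; exists d => // w wd.
- by apply: Hd; rewrite addrAC subrr add0r -[w]subr0.
- by have := Hd (w - z); rewrite subr0 [z + _]addrC subrK; exact.
Qed.

Lemma cont_RP (T : topologicalType) (u : T -> R) (z : T) :
  {for z, continuous u} <-> forall e, 0 < e -> \forall w \near z, `|u w - u z| < e.
Proof.
split.
- move=> /cvgrPdist_lt H e e0; have := H e e0.
  by apply: filterS => w; rewrite distrC.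
- move=> H; apply/cvgrPdist_lt => e e0; have := H e e0.
  by apply: filterS => w; rewrite distrC.
Qed.
Lemma cont_CP (T : topologicalType) (u : T -> C) (z : T) :
  {for z, continuous u} <-> forall e, 0 < e -> \forall w \near z, cmod (u w - u z) < e.
Proof.
split.
- by move=> H e e0; apply: (H [set v | cmod (v - u z) < e]); exact: near_cball.
- move=> H A /nbhs_cP[e e0 He]; rewrite nbhs_simpl /=.
  by have := H e e0; apply: filterS => w; exact: He.
Qed.
End Basics.

(** * Second order expansions at a point *)

Section LittleO.
Variable R : realType.
Local Notation C := (CC R).
Implicit Types (z w h : C) (x y e d : R) (r s : C -> R).

(** [oh k r] and [Oh k r] read r(h) = o(|h|^k) and r(h) = O(|h|^k) as h -> 0. *)
Definition oh (k : nat) (r : C -> R) :=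
  forall e, 0 < e -> \forall h \near (0 : C), `|r h| <= e * cmod h ^+ k.
Definition Oh (k : nat) (r : C -> R) :=
  exists2 M : R, 0 < M & \forall h \near (0 : C), `|r h| <= M * cmod h ^+ k.

Lemma oh_Oh k r : oh k r -> Oh k r.
Proof. by move=> H; exists 1 => //; exact: H. Qed.

Lemma Oh_oh k r : Oh k.+1 r -> oh k r.
Proof.
move=> [M M0 H] e e0.
have eM : 0 < e / M by rewrite divr_gt0.
near=> h.
have rh : `|r h| <= M * cmod h ^+ k.+1 by near: h.
have hd : cmod h < e / M by near: h; exact: near_cball0.
apply: le_trans rh _; rewrite exprS mulrA ler_wpM2r ?exprn_ge0 ?cmod_ge0 //.
by rewrite mulrC -ler_pdivlMr // ltW.
Unshelve. all: by end_near. Qed.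

Lemma oh_le k r s : (\forall h \near (0 : C), `|r h| <= `|s h|) -> oh k s -> oh k r.
Proof.
move=> rs H e e0; have := H e e0; apply: filterS2 rs => h; exact: le_trans.
Qed.
Lemma Oh_le k r s : (\forall h \near (0 : C), `|r h| <= `|s h|) -> Oh k s -> Oh k r.
Proof.
by move=> rs [M M0 H]; exists M => //; apply: filterS2 rs H => h; exact: le_trans.
Qed.
Lemma oh_ext k r s : (\forall h \near (0 : C), r h = s h) -> oh k s -> oh k r.
Proof. by move=> rs; apply: oh_le; apply: filterS rs => h ->. Qed.
Lemma oh_eq k r s : (forall h, r h = s h) -> oh k s -> oh k r.
Proof. by move=> rs; apply: oh_ext; exact: nearC. Qed.
Lemma Oh_eq k r s : (forall h, r h = s h) -> Oh k s -> Oh k r.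
Proof. by move=> rs; apply: Oh_le; apply: nearC => h; rewrite rs. Qed.

Lemma ohD k r s : oh k r -> oh k s -> oh k (fun h => r h + s h).
Proof.
move=> Hr Hs e e0; have e2 : 0 < e / 2 by lra.
near=> h.
have rh : `|r h| <= (e / 2) * cmod h ^+ k by near: h; exact: Hr.
have sh : `|s h| <= (e / 2) * cmod h ^+ k by near: h; exact: Hs.
apply: le_trans (ler_normD _ _) _; lra.
Unshelve. all: by end_near. Qed.
Lemma OhD k r s : Oh k r -> Oh k s -> Oh k (fun h => r h + s h).
Proof.
move=> [M M0 Hr] [N N0 Hs]; exists (M + N); first by lra.
near=> h.
have rh : `|r h| <= M * cmod h ^+ k by near: h; exact: Hr.
have sh : `|s h| <= N * cmod h ^+ k by near: h; exact: Hs.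
apply: le_trans (ler_normD _ _) _; lra.
Unshelve. all: by end_near. Qed.
Lemma OhM k l r s : Oh k r -> Oh l s -> Oh (k + l) (fun h => r h * s h).
Proof.
move=> [M M0 Hr] [N N0 Hs]; exists (M * N); first by rewrite mulr_gt0.
near=> h.
have rh : `|r h| <= M * cmod h ^+ k by near: h; exact: Hr.
have sh : `|s h| <= N * cmod h ^+ l by near: h; exact: Hs.
by rewrite normrM exprD mulrACA ler_pM.
Unshelve. all: by end_near. Qed.
Lemma ohM k l r s : oh k r -> Oh l s -> oh (k + l) (fun h => r h * s h).
Proof.
move=> Hr [N N0 Hs] e e0; have eN : 0 < e / N by rewrite divr_gt0.
near=> h.
have rh : `|r h| <= e / N * cmod h ^+ k by near: h; exact: Hr.
have sh : `|s h| <= N * cmod h ^+ l by near: h; exact: Hs.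
rewrite normrM exprD (_ : e = e / N * N); last by rewrite divfK ?gt_eqF.
by rewrite mulrACA ler_pM.
Unshelve. all: by end_near. Qed.
Lemma Oh_cst (c : R) : Oh 0 (fun=> c).
Proof.
exists (`|c| + 1); first by rewrite ltr_wpDl.
by apply: nearC => h; rewrite expr0 mulr1 lerDl.
Qed.
Lemma ohZ k r (c : R) : oh k r -> oh k (fun h => c * r h).
Proof.
move=> H; rewrite -[k]addn0; apply: (@oh_eq _ _ (fun h => r h * c)) => [h|].
  by rewrite mulrC.
exact: ohM (Oh_cst c).
Qed.
Lemma Oh_X k : Oh k (fun h => cmod h ^+ k).
Proof.
by exists 1 => //; apply: nearC => h; rewrite mul1r ger0_norm // exprn_ge0 ?cmod_ge0.
Qed.
Lemma Oh_re (a : C) : Oh 1 (fun h => re (a * h)).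
Proof.
exists (cmod a + 1); first by rewrite ltr_wpDl ?cmod_ge0.
apply: nearC => h; apply: le_trans (re_le_cmod _) _.
by rewrite cmodM ler_wpM2r ?exprn_ge0 ?cmod_ge0 // lerDl.
Qed.
Lemma Oh_re2 (b : C) : Oh 2 (fun h => re (b * h ^+ 2)).
Proof.
exists (cmod b + 1); first by rewrite ltr_wpDl ?cmod_ge0.
apply: nearC => h; apply: le_trans (re_le_cmod _) _.
by rewrite cmodM cmodX ler_wpM2r ?exprn_ge0 ?cmod_ge0 // lerDl.
Qed.
Lemma OhS k r : Oh k.+1 r -> Oh k r.
Proof. by move=> /Oh_oh /oh_Oh. Qed.
Lemma Oh_cmodM (a : C) k : Oh k (fun h => cmod (a * h ^+ k)).
Proof.
exists (cmod a + 1); first by rewrite ltr_wpDl ?cmod_ge0.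
apply: nearC => h; rewrite ger0_norm ?cmod_ge0 // cmodM cmodX.
by rewrite ler_wpM2r ?exprn_ge0 ?cmod_ge0 // lerDl.
Qed.
Lemma oh0 k : oh k (fun=> 0).
Proof. by move=> e e0; apply: nearC => h; rewrite normr0 mulr_ge0 ?exprn_ge0 ?cmod_ge0 // ltW. Qed.
End LittleO.

Section Jets.
Variable R : realType.
Local Notation C := (CC R).
Implicit Types (z w h al be a b : C) (x y e d ga : R) (u v : C -> R) (g : C -> C).

(** The second order Taylor expansion of a real function at [z], in complex
    notation. The quadratic part is [re (be h^2) + ga |h|^2], so that [4 * ga]
    is the Laplacian; no derivative away from [z] is involved. *)
Definition jet u z al be ga :=
  oh 2 (fun h => u (z + h) - u z - re (al * h) - re (be * h ^+ 2) - ga * cmod h ^+ 2).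

(** The expansions of complex functions without conjugate terms, to second and to
    first order. Both are statements at the single point [z], so that they can be
    used before the derivative of a holomorphic function is known to be continuous. *)
Definition hjet g z a b := oh 2 (fun h => cmod (g (z + h) - g z - a * h - b * h ^+ 2)).
Definition cdiff g z a := oh 1 (fun h => cmod (g (z + h) - g z - a * h)).

Lemma jet_near u v z al be ga :
  (\forall w \near z, u w = v w) -> jet u z al be ga -> jet v z al be ga.
Proof.
move=> uv; apply: oh_ext; have uvz := nbhs_singleton uv.
by move/near_shift: uv; apply: filterS => h /= ->; rewrite uvz.
Qed.
Lemma jetD u v z al be ga al' be' ga' :
  jet u z al be ga -> jet v z al' be' ga' ->
  jet (fun w => u w + v w) z (al + al') (be + be') (ga + ga').
Proof.
move=> Hu Hv; have := ohD Hu Hv; apply: oh_eq => h.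
by rewrite !mulrDl !reD; ring.
Qed.
Lemma jetZ (c : R) u z al be ga : jet u z al be ga ->
  jet (fun w => c * u w) z (rc c * al) (rc c * be) (c * ga).
Proof.
move=> /(ohZ c); apply: oh_eq => h.
by rewrite -!mulrA ![re (rc c * _)]reM re_rc im_rc !mul0r !subr0; ring.
Qed.
Lemma jet_cst (c : R) z : jet (fun=> c) z 0 0 0.
Proof. by apply: oh_eq (@oh0 _ 2) => h; rewrite !mul0r re0; ring. Qed.

(** At a local maximum the average of the expansion over h, ih, -h, -ih, in which
    only [ga] survives, is non-positive. *)
Lemma jet_max u z al be ga :
  (\forall w \near z, u w <= u z) -> jet u z al be ga -> ga <= 0.
Proof.
move=> /near_shift/nbhs_cP[d d0 Hd] H; rewrite leNgt; apply/negP => ga0.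
have ga2 : 0 < ga / 2 by lra.
have /nbhs_cP[d' d'0 Hd'] := H (ga / 2) ga2.
pose m := Num.min d d'.
have m0 : 0 < m by rewrite lt_min d0.
have [md md'] : m <= d /\ m <= d' by rewrite !ge_min !lexx orbT.
pose t := m / 2; have t0 : 0 < t by rewrite /t; lra.
have key h : cmod h = t -> re (al * h) + re (be * h ^+ 2) <= - (ga / 2) * t ^+ 2.
  move=> ht.
  have hd : cmod (h - 0) < d by rewrite subr0 ht /t; lra.
  have hd' : cmod (h - 0) < d' by rewrite subr0 ht /t; lra.
  have := Hd h hd; have := Hd' h hd'; rewrite ht ler_norml => /andP[+ _]; lra.
have c1 : cmod (rc t) = t by rewrite cmod_rc gtr0_norm.
have c2 : cmod (mkC 0 t) = t by rewrite /cmod /= expr0n /= add0r sqrtr_sqr gtr0_norm.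
have := key (rc t) c1; have := key (- rc t); rewrite cmodN => /(_ c1).
have := key (mkC 0 t) c2; have := key (- mkC 0 t); rewrite cmodN => /(_ c2).
rewrite !expr2 !reimE'.
have : 0 < ga / 2 * (t * t) by rewrite !mulr_gt0.
move: (re al) (im al) (re be) (im be) => p q r s; lra.
Qed.

Lemma cdiff_Oh g z a : cdiff g z a -> Oh 1 (fun h => cmod (g (z + h) - g z)).
Proof.
move=> /oh_Oh H; have := OhD H (Oh_cmodM a 1); apply: Oh_le.
apply: nearC => h; rewrite [X in _ <= X]ger0_norm ?addr_ge0 ?cmod_ge0 //.
rewrite ger0_norm ?cmod_ge0 // expr1.
by have := cmodD (g (z + h) - g z - a * h) (a * h); rewrite subrK.
Qed.
Lemma hjet_cdiff g z a b : hjet g z a b -> cdiff g z a.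
Proof.
move=> H; apply: Oh_oh; have := OhD (oh_Oh H) (Oh_cmodM b 2); apply: Oh_le.
apply: nearC => h; rewrite [X in _ <= X]ger0_norm ?addr_ge0 ?cmod_ge0 //.
rewrite ger0_norm ?cmod_ge0 //.
by have := cmodD (g (z + h) - g z - a * h - b * h ^+ 2) (b * h ^+ 2); rewrite subrK.
Qed.
Lemma cdiff_cont g z a : cdiff g z a -> {for z, continuous g}.
Proof.
move=> /cdiff_Oh[M M0 H]; apply/cont_CP => e e0; apply/near_shift.
near=> h.
have h1 : `|cmod (g (z + h) - g z)| <= M * cmod h ^+ 1 by near: h.
have h2 : cmod h < e / M by near: h; apply: near_cball0; rewrite divr_gt0.
rewrite -[cmod _]ger0_norm ?cmod_ge0 //; apply: le_lt_trans h1 _.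
by rewrite expr1 mulrC -ltr_pdivlMr.
Unshelve. all: by end_near. Qed.

Lemma oh_subst k (r : C -> R) (eta : C -> C) :
  Oh 1 (fun h => cmod (eta h)) -> oh k r -> oh k (fun h => r (eta h)).
Proof.
move=> [M M0 H] Hr e e0.
have eM : 0 < e / M ^+ k by rewrite divr_gt0 ?exprn_gt0.
have /nbhs_cP[d d0 Hd] := Hr _ eM.
near=> h.
have h1 : cmod (eta h) <= M * cmod h.
  by rewrite -[X in X <= _]ger0_norm ?cmod_ge0 // -[cmod h]expr1; near: h.
have h2 : cmod h < d / M by near: h; apply: near_cball0; rewrite divr_gt0.
have h3 : cmod (eta h - 0) < d.
  by rewrite subr0; apply: le_lt_trans h1 _; rewrite mulrC -ltr_pdivlMr.
apply: le_trans (Hd _ h3) _.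
rewrite mulrAC ler_pdivrMr ?exprn_gt0 // -mulrA ler_wpM2l ?(ltW e0) // -exprMn [cmod h * _]mulrC.
by apply: lerXn2r => //; rewrite nnegrE ?mulr_ge0 ?cmod_ge0 ?(ltW M0).
Unshelve. all: by end_near. Qed.

Lemma oh_re k (q : C -> C) : oh k (fun h => cmod (q h)) -> oh k (fun h => re (q h)).
Proof.
apply: oh_le; apply: nearC => h; rewrite [X in _ <= X]ger0_norm ?cmod_ge0 //.
exact: re_le_cmod.
Qed.
Lemma oh_cM k l (q : C -> C) (a : C -> C) : oh k (fun h => cmod (q h)) ->
  Oh l (fun h => cmod (a h)) -> oh (k + l) (fun h => cmod (q h * a h)).
Proof. by move=> Hq Ha; apply: oh_eq (ohM Hq Ha) => h; rewrite cmodM. Qed.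
Lemma Oh_cM k l (q : C -> C) (a : C -> C) : Oh k (fun h => cmod (q h)) ->
  Oh l (fun h => cmod (a h)) -> Oh (k + l) (fun h => cmod (q h * a h)).
Proof. by move=> Hq Ha; apply: Oh_eq (OhM Hq Ha) => h; rewrite cmodM. Qed.
Lemma oh_cD k (q a : C -> C) : oh k (fun h => cmod (q h)) ->
  oh k (fun h => cmod (a h)) -> oh k (fun h => cmod (q h + a h)).
Proof.
move=> Hq Ha; apply: oh_le (ohD Hq Ha); apply: nearC => h.
by rewrite !ger0_norm ?addr_ge0 ?cmod_ge0 // cmodD.
Qed.
Lemma Oh_cD k (q a : C -> C) : Oh k (fun h => cmod (q h)) ->
  Oh k (fun h => cmod (a h)) -> Oh k (fun h => cmod (q h + a h)).
Proof.
move=> Hq Ha; apply: Oh_le (OhD Hq Ha); apply: nearC => h.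
by rewrite !ger0_norm ?addr_ge0 ?cmod_ge0 // cmodD.
Qed.
Lemma Oh_ccst (c : C) : Oh 0 (fun=> cmod c).
Proof. exact: Oh_cst. Qed.
Lemma oh_ceq k (q a : C -> C) : (forall h, q h = a h) -> oh k (fun h => cmod (a h)) -> oh k (fun h => cmod (q h)).
Proof. by move=> E; apply: oh_eq => h; rewrite E. Qed.
Lemma oh_cZ k (q : C -> C) c : oh k (fun h => cmod (q h)) -> oh k (fun h => cmod (c * q h)).
Proof.
move=> H; apply: (@oh_ceq _ _ (fun h => q h * c)) => [h|]; first by rewrite mulrC.
by rewrite -[k]addn0; apply: oh_cM H (Oh_ccst c).
Qed.

Lemma hjet_sq g z a b : hjet g z a b ->
  oh 2 (fun h => cmod ((g (z + h) - g z) ^+ 2 - (a * h) ^+ 2)).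
Proof.
move=> H; have := oh_cM (hjet_cdiff H) (Oh_cD (cdiff_Oh (hjet_cdiff H)) (Oh_cmodM a 1)).
by apply: oh_ceq => h; rewrite expr1; ring.
Qed.

(** Chain rule: composing with a holomorphic map multiplies the Laplacian by
    the squared modulus of the derivative. *)
Lemma jet_comp u g z a b al be ga : hjet g z a b -> jet u (g z) al be ga ->
  jet (fun w => u (g w)) z (al * a) (al * b + be * a ^+ 2) (ga * cmod a ^+ 2).
Proof.
move=> Hg Hu.
pose eta h := g (z + h) - g z.
have Heta : Oh 1 (fun h => cmod (eta h)) := cdiff_Oh (hjet_cdiff Hg).
have H1 := oh_subst Heta Hu.
have H2 : oh 2 (fun h => re (al * (eta h - a * h - b * h ^+ 2))).
  exact/oh_re/oh_cZ.
have H3 : oh 2 (fun h => re (be * (eta h ^+ 2 - (a * h) ^+ 2))).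
  exact/oh_re/oh_cZ/(hjet_sq Hg).
have H4 : oh 2 (fun h => ga * (cmod (eta h) ^+ 2 - cmod (a * h) ^+ 2)).
  apply: ohZ; apply: oh_le (hjet_sq Hg); apply: nearC => h.
  by rewrite [X in _ <= X]ger0_norm ?cmod_ge0 // -!cmodX cmod_distB.
apply: oh_eq (ohD (ohD H1 H2) (ohD H3 H4)) => h.
rewrite /= (_ : g z + eta h = g (z + h)); last by rewrite /eta addrC subrK.
rewrite cmodM.
have -> : re (al * a * h) = re (al * (a * h)) by rewrite mulrA.
have -> : re ((al * b + be * a ^+ 2) * h ^+ 2) = re (al * (b * h ^+ 2)) + re (be * (a * h) ^+ 2).
  by rewrite -reD; congr re; ring.
have -> : re (al * (eta h - a * h - b * h ^+ 2)) = re (al * eta h) - re (al * (a * h)) - re (al * (b * h ^+ 2)).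
  by rewrite -!reN -!reD; congr re; ring.
have -> : re (be * (eta h ^+ 2 - (a * h) ^+ 2)) = re (be * eta h ^+ 2) - re (be * (a * h) ^+ 2).
  by rewrite -!reN -!reD; congr re; ring.
by ring.
Qed.

(** [rjet phi x d1 d2]: second order expansion of a function of one real
    variable, [d2] being half the second derivative. *)
Definition rjet (phi : R -> R) (x d1 d2 : R) :=
  forall e, 0 < e -> exists2 d, 0 < d & forall t, `|t| < d ->
    `|phi (x + t) - phi x - d1 * t - d2 * t ^+ 2| <= e * t ^+ 2.

Lemma jet_Oh u z al be ga : jet u z al be ga -> Oh 1 (fun h => u (z + h) - u z).
Proof.
move=> /oh_Oh/OhS H.
have H2 := OhS (OhM (Oh_cst ga) (Oh_X R 2)).
have := OhD H (OhD (OhD (Oh_re al) (OhS (Oh_re2 be))) H2).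
by apply: Oh_eq => h; ring.
Qed.

(** The new multiple of |h|^2 comes from 2 re (al h)^2 = re (al^2 h^2) + |al|^2 |h|^2. *)
Lemma jet_phi phi u z al be ga d1 d2 : rjet phi (u z) d1 d2 -> jet u z al be ga ->
  jet (fun w => phi (u w)) z (rc d1 * al) (rc d1 * be + rc (d2 / 2) * al ^+ 2)
    (d1 * ga + d2 * cmod al ^+ 2 / 2).
Proof.
move=> Hp Hu.
pose tau h := u (z + h) - u z.
have Htau : Oh 1 tau := jet_Oh Hu.
have H1 : oh 2 (fun h => phi (u z + tau h) - phi (u z) - d1 * tau h - d2 * tau h ^+ 2).
  move=> e e0; have [M M0 HM] := Htau.
  have eM : 0 < e / M ^+ 2 by rewrite divr_gt0 ?exprn_gt0.
  have [d d0 Hd] := Hp _ eM; near=> h.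
  have h1 : `|tau h| <= M * cmod h by rewrite -[cmod h]expr1; near: h.
  have h2 : cmod h < d / M by near: h; apply: near_cball0; rewrite divr_gt0.
  have h3 : `|tau h| < d by apply: le_lt_trans h1 _; rewrite mulrC -ltr_pdivlMr.
  apply: le_trans (Hd _ h3) _.
  rewrite mulrAC ler_pdivrMr ?exprn_gt0 // -mulrA ler_wpM2l ?(ltW e0) // -exprMn [cmod h * _]mulrC.
  rewrite -[tau h ^+ 2]real_normK ?num_real //.
  by apply: lerXn2r => //; rewrite nnegrE ?mulr_ge0 ?cmod_ge0 ?(ltW M0).
have H2 := ohZ d1 Hu.
have H3 : oh 2 (fun h => d2 * (tau h ^+ 2 - re (al * h) ^+ 2)).
  apply: ohZ; apply: Oh_oh.
  have A : Oh 2 (fun h => tau h - re (al * h)).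
    have := OhD (oh_Oh Hu) (OhD (Oh_re2 be) (OhM (Oh_cst ga) (Oh_X R 2))).
    by apply: Oh_eq => h; rewrite /tau; ring.
  by have := OhM A (OhD Htau (Oh_re al)); apply: Oh_eq => h; ring.
apply: oh_eq (ohD H1 (ohD H2 H3)) => h; rewrite /= /tau [u z + _]addrC subrK.
have -> : re (rc d1 * al * h) = d1 * re (al * h).
  by rewrite -mulrA reM re_rc im_rc mul0r subr0.
have -> : re ((rc d1 * be + rc (d2 / 2) * al ^+ 2) * h ^+ 2) =
  d1 * re (be * h ^+ 2) + d2 * re (al * h) ^+ 2 - d2 * cmod al ^+ 2 / 2 * cmod h ^+ 2.
  by rewrite !cmod_sq !expr2 !reimE'; field.
by ring.
Unshelve. all: by end_near. Qed.

Lemma hjet_id z : hjet id z 1 0.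
Proof.
by apply: oh_eq (@oh0 _ 2) => h; rewrite (_ : _ - _ = 0) ?cmod0 //; ring.
Qed.
Lemma hjet_near g k z a b :
  (\forall w \near z, g w = k w) -> hjet g z a b -> hjet k z a b.
Proof.
move=> uv; apply: oh_ext; have uvz := nbhs_singleton uv.
by move/near_shift: uv; apply: filterS => h /= ->; rewrite uvz.
Qed.

Lemma jet_sqmod z0 z : jet (fun w => cmod (w - z0) ^+ 2) z (rc 2 * cconj (z - z0)) 0 1.
Proof.
apply: oh_eq (@oh0 _ 2) => h.
by rewrite !cmod_sq !expr2 !reimE'; ring.
Qed.
Lemma cmod_2conj w : cmod (rc 2 * cconj w) ^+ 2 = 4 * cmod w ^+ 2.
Proof. by rewrite !cmod_sq !expr2 !reimE'; ring. Qed.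
End Jets.

(** * Expansions of smooth functions and of metrics of negative curvature *)

Section RealTaylor.
Variable R : realType.
Implicit Types (phi dphi : R -> R) (a b x y e d t : R).

Lemma mvt_bound phi dphi a b K : a <= b ->
  (forall x, a <= x <= b -> is_derive x 1 phi (dphi x)) ->
  (forall x, a <= x <= b -> `|dphi x| <= K) -> `|phi b - phi a| <= K * (b - a).
Proof.
rewrite le_eqVlt => /predU1P[->|ab] Hd HK; first by rewrite !subrr normr0 mulr0.
have [| |c cab ->] := @MVT R phi dphi a b ab.
- by move=> x; rewrite in_itv /= => /andP[ax xb]; apply: Hd; rewrite !ltW.
- apply: derivable_within_continuous => x; rewrite in_itv /= => xab.
  by have [] := Hd x xab.
- move: cab; rewrite in_itv /= => /andP[ac cb].
  rewrite normrM [`|b - a|]gtr0_norm ?subr_gt0 // ler_wpM2r ?subr_ge0 ?(ltW ab) //.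
  by apply: HK; rewrite !ltW.
Qed.

Lemma mvt_bound_sym phi dphi x t K :
  (forall s, `|s| <= `|t| -> is_derive (x + s) 1 phi (dphi (x + s))) ->
  (forall s, `|s| <= `|t| -> `|dphi (x + s)| <= K) -> `|phi (x + t) - phi x| <= K * `|t|.
Proof.
move=> Hd HK; have [t0|t0] := leP 0 t.
- have := @mvt_bound phi dphi x (x + t) K; rewrite lerDl t0 => /(_ isT).
  rewrite [x + t - x]addrAC subrr add0r (ger0_norm t0); apply.
  + move=> y /andP[xy yt]; rewrite -[y](subrKC x); apply: Hd.
    by rewrite !ger0_norm ?subr_ge0 // lerBlDl.
  + move=> y /andP[xy yt]; rewrite -[y](subrKC x); apply: HK.
    by rewrite !ger0_norm ?subr_ge0 // lerBlDl.
- have := @mvt_bound phi dphi (x + t) x K.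
  have -> : x + t <= x by rewrite gerDl ltW.
  move=> /(_ isT); rewrite distrC opprD addNKr (ltr0_norm t0); apply.
  + move=> y /andP[xy yt]; rewrite -[y](subrKC x); apply: Hd.
    rewrite [`|t|]ltr0_norm // ler0_norm ?subr_le0 //; lra.
  + move=> y /andP[xy yt]; rewrite -[y](subrKC x); apply: HK.
    rewrite [`|t|]ltr0_norm // ler0_norm ?subr_le0 //; lra.
Qed.

Lemma is_derive_eps phi x (l : R) : is_derive x 1 phi l <->
  forall e, 0 < e -> exists2 d, 0 < d & forall t, `|t| < d ->
    `|phi (x + t) - phi x - l * t| <= e * `|t|.
Proof.
split.
- move=> [Hd Hl] e e0; move: Hd; rewrite /derivable => /cvg_ex[l' /= Hl'].
  have ll : l' = l by rewrite -Hl /derive; apply/esym/cvg_lim.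
  rewrite {}ll in Hl'.
  move/cvgrPdist_le: Hl' => /(_ e e0); rewrite near_withinE => /nbhs_ballP[d /= d0 Hd].
  exists d => // t td; have [->|t0] := eqVneq t 0.
    by rewrite addr0 subrr mulr0 subrr normr0 mulr0.
  have := Hd t; rewrite /ball /= sub0r normrN => /(_ td t0).
  rewrite /GRing.scale /= mulr1 => H.
  rewrite -[X in `|X|](_ : (t^-1 * (phi (t + x) - phi x) - l) * t = _); last first.
    by rewrite [t + x]addrC; field.
  by rewrite normrM ler_wpM2r // distrC.
- move=> H.
  have C : h^-1 *: ((phi \o shift x) (h *: (1 : R)) - phi x) @[h --> 0^'] --> l.
    apply/cvgrPdist_le => e e0; have [d d0 Hd] := H e e0.
    rewrite near_withinE; apply/nbhs_ballP; exists d => //= t.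
    rewrite /ball /= sub0r normrN => td t0; have := Hd t td.
    rewrite /GRing.scale /= mulr1 => Ht.
    have t1 : 0 < `|t| by rewrite normr_gt0.
    rewrite -(ler_pM2r t1) distrC -normrM; apply: le_trans _ Ht.
    by rewrite [t + x]addrC le_eqVlt; apply/orP; left; apply/eqP; congr `|_|; field.
  by apply: DeriveDef; [apply/cvg_ex; exists l|exact: cvg_lim].
Qed.

(** The mean value inequality for phi minus its quadratic polynomial. *)
Lemma mvt_quad phi dphi x t (l q : R) K :
  (forall s, `|s| <= `|t| -> is_derive (x + s) 1 phi (dphi (x + s))) ->
  (forall s, `|s| <= `|t| -> `|dphi (x + s) - l - q * s| <= K) ->
  `|phi (x + t) - phi x - l * t - q / 2 * t ^+ 2| <= K * `|t|.
Proof.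
move=> Hd HK; pose psi y := phi y - l * (y - x) - q / 2 * (y - x) ^+ 2.
have := @mvt_bound_sym psi (fun y => dphi y - l - q * (y - x)) x t K.
have -> : psi (x + t) - psi x = phi (x + t) - phi x - l * t - q / 2 * t ^+ 2.
  by rewrite /psi; ring.
apply.
- move=> s st; have B := Hd s st.
  have -> : psi = phi \- (fun y => l * (y - x) + q / 2 * (y - x) ^+ 2).
    by apply/funext => y; rewrite /psi /= opprD addrA.
  apply: is_derive_eq.
  by rewrite /GRing.scale /=; field.
- by move=> s st; rewrite addrAC addrAC [x + s - x]addrAC subrr add0r HK.
Qed.

Lemma rjet_deriv phi dphi x (d2 : R) :
  (\forall y \near x, is_derive y (1 : R) phi (dphi y)) -> is_derive x 1 dphi d2 ->
  rjet phi x (dphi x) (d2 / 2).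
Proof.
move=> /nbhs_ballP[r /= r0 Hr] /is_derive_eps H2 e e0.
have [d d0 Hd] := H2 e e0; exists (Num.min r d); first by rewrite lt_min r0.
move=> t; rewrite lt_min => /andP[tr td].
rewrite [X in _ <= X](_ : _ = e * `|t| * `|t|); last first.
  by rewrite -mulrA -expr2 real_normK ?num_real.
apply: (@mvt_quad _ dphi) => s st.
- by apply: Hr; rewrite /ball /= opprD addNKr normrN; exact: le_lt_trans tr.
- apply: le_trans (Hd s (le_lt_trans st td)) _.
  by rewrite ler_wpM2l // ltW.
Qed.
Lemma rjet_ln x : 0 < x -> rjet (@ln R) x x^-1 (- (x ^+ 2)^-1 / 2).
Proof.
move=> x0; apply: (@rjet_deriv _ (fun y => y^-1)).
- near=> y; apply: is_derive1_ln; near: y; exact: lt_nbhsr.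
- apply: is_derive_eq; first by apply: (is_deriveV (f := id)); exact: lt0r_neq0.
  by rewrite /GRing.scale /= mulr1.
Unshelve. all: by end_near. Qed.
Lemma rjet_expR x : rjet (@expR R) x (expR x) (expR x / 2).
Proof.
apply: rjet_deriv.
  by near=> y; exact: is_derive_expR.
Unshelve. all: by end_near. Qed.
End RealTaylor.

Section C2jets.
Variable R : realType.
Local Notation C := (CC R).
Implicit Types (z w h : C) (u mu : C -> R) (G : set C) (f g : R -> R).

Lemma is_derive_near f g (x l : R) : (\forall y \near x, f y = g y) ->
  is_derive x 1 f l -> is_derive x 1 g l.
Proof.
move=> fg /is_derive_eps H; apply/is_derive_eps => e e0.
have [d d0 Hd] := H e e0.
move/nbhs_ballP: (fg) => [r /= r0 Hr].
exists (Num.min d r); first by rewrite lt_min d0.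
move=> t; rewrite lt_min => /andP[td tr].
rewrite -(nbhs_singleton fg) -Hr; first exact: Hd.
by rewrite /ball /= opprD addNKr normrN.
Qed.

Lemma is_derive_derive1 f (x l : R) : is_derive x 1 f l -> derive1 f x = l.
Proof. by move=> [_ <-]; rewrite derive1E. Qed.
Lemma derivable_is_derive f (x : R) : derivable f x 1 -> is_derive x 1 f (derive1 f x).
Proof. by move=> H; apply: (DeriveDef H); rewrite derive1E. Qed.

Lemma is_derive_dx u z : derivable (fun x : R => u (mkC x (im z))) (re z) 1 ->
  is_derive (re z) 1 (fun x : R => u (mkC x (im z))) (dx u z).
Proof. exact: derivable_is_derive. Qed.
Lemma is_derive_dy u z : derivable (fun y : R => u (mkC (re z) y)) (im z) 1 ->
  is_derive (im z) 1 (fun y : R => u (mkC (re z) y)) (dy u z).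
Proof. exact: derivable_is_derive. Qed.

Lemma C1_is_derive_dx G u (x y : R) : C1_on G u -> G (mkC x y) ->
  is_derive x 1 (fun t : R => u (mkC t y)) (dx u (mkC x y)).
Proof. by move=> H /H[D _ _ _]; exact: (is_derive_dx D). Qed.
Lemma C1_is_derive_dy G u (x y : R) : C1_on G u -> G (mkC x y) ->
  is_derive y 1 (fun t : R => u (mkC x t)) (dy u (mkC x y)).
Proof. by move=> H /H[_ D _ _]; exact: (is_derive_dy D). Qed.

Opaque dx dy.
Lemma cmod_mk_le (s t : R) h : `|s| <= `|re h| -> `|t| <= `|im h| -> cmod (mkC s t) <= cmod h.
Proof.
move=> H1 H2; rewrite -(ler_pXn2r (n := 2)) ?nnegrE ?cmod_ge0 // !cmod_sq re_mk im_mk.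
by rewrite lerD // -[X in X <= _]real_normK ?num_real // -[X in _ <= X]real_normK ?num_real // lerXn2r ?nnegrE.
Qed.

(** An increment is split into a horizontal and a vertical one, and the mean value
    inequality is applied to each. *)
Lemma C1_expansion G u z : nbhs z G -> C1_on G u ->
  oh 1 (fun h => u (z + h) - u z - dx u z * re h - dy u z * im h).
Proof.
move=> Gz H e e0; have [_ _ /cont_RP cx /cont_RP cy] := H z (nbhs_singleton Gz).
have e2 : 0 < e / 2 by lra.
have /near_shift/nbhs_cP[d d0 Hd] : \forall w \near z,
    [/\ G w, `|dx u w - dx u z| < e / 2 & `|dy u w - dy u z| < e / 2].
  by apply: filterS3 Gz (cx _ e2) (cy _ e2) => w g1 g2 g3; exact: And3 g1 g2 g3.
apply/nbhs_cP; exists d => // h; rewrite subr0 => hd.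
have sub s t : `|s| <= `|re h| -> `|t| <= `|im h| -> 
    [/\ G (z + mkC s t), `|dx u (z + mkC s t) - dx u z| < e / 2 & `|dy u (z + mkC s t) - dy u z| < e / 2].
  by move=> hs ht; apply: Hd; rewrite subr0; apply: le_lt_trans hd; exact: cmod_mk_le.
have zE s t : z + mkC s t = mkC (re z + s) (im z + t) by apply: CP; rewrite !reimE.
have I1 := @mvt_quad R (fun x => u (mkC x (im z + im h))) (fun x => dx u (mkC x (im z + im h)))
  (re z) (re h) (dx u z) 0 (e / 2).
have I2 := @mvt_quad R (fun y => u (mkC (re z) y)) (fun y => dy u (mkC (re z) y))
  (im z) (im h) (dy u z) 0 (e / 2).
have -> : u (z + h) - u z - dx u z * re h - dy u z * im h =
   (u (mkC (re z + re h) (im z + im h)) - u (mkC (re z) (im z + im h)) - dx u z * re h - 0 / 2 * re h ^+ 2)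
 + (u (mkC (re z) (im z + im h)) - u (mkC (re z) (im z)) - dy u z * im h - 0 / 2 * im h ^+ 2).
  have -> : mkC (re z + re h) (im z + im h) = z + h by apply: CP; rewrite !reimE.
  rewrite mkCE; move: (re h) (im h) (u (z + h)) (u (mkC _ _)) (u z) (dx u z) (dy u z).
  by move=> *; field.
apply: le_trans (ler_normD _ _) _.
have -> : e * cmod h ^+ 1 = e / 2 * cmod h + e / 2 * cmod h by rewrite expr1; field.
apply: lerD.
- apply: le_trans (I1 _ _) _; last by rewrite ler_wpM2l ?(ltW e2) // re_le_cmod.
  + move=> s hs.
    have [Gs _ _] := sub s (im h) hs (lexx _); rewrite zE in Gs.
    exact: (C1_is_derive_dx H Gs).
  + move=> s hs; have [_ Gs _] := sub s (im h) hs (lexx _); rewrite zE in Gs.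
    by rewrite mul0r subr0 ltW.
- apply: le_trans (I2 _ _) _; last by rewrite ler_wpM2l ?(ltW e2) // im_le_cmod.
  + move=> s hs.
    have := sub 0 s; rewrite normr0 => /(_ (normr_ge0 _) hs)[Gs _ _]; rewrite zE addr0 in Gs.
    exact: (C1_is_derive_dy H Gs).
  + move=> s hs; have := sub 0 s; rewrite normr0 => /(_ (normr_ge0 _) hs)[_ _ Gs].
    by rewrite zE addr0 in Gs; rewrite mul0r subr0 ltW.
Unshelve. all: by end_near. Qed.

(** Again a horizontal and a vertical step; the term dy (dx u) re h im h arises
    because the horizontal step is made at height im z + im h. Only the
    differentiability at [z] of the first derivatives enters. *)
Lemma C2_jet G u z : nbhs z G -> C2_on G u ->
  exists be, jet u z (mkC (dx u z) (- dy u z)) be (laplacian u z / 4).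
Proof.
move=> Gz [H1 Hx Hy].
exists (mkC ((dx (dx u) z - dy (dy u) z) / 4) (- dy (dx u) z / 2)).
move=> e e0; have e2 : 0 < e / 2 by lra.
have /nbhs_cP[dX dX0 HX] := C1_expansion Gz Hx e2.
have /nbhs_cP[dY dY0 HY] := C1_expansion Gz Hy e2.
have /near_shift/nbhs_cP[d d0 Hd] := Gz.
near=> h.
have hX : cmod h < dX by near: h; exact: near_cball0.
have hY : cmod h < dY by near: h; exact: near_cball0.
have hd : cmod h < d by near: h; exact: near_cball0.
have sub s t : `|s| <= `|re h| -> `|t| <= `|im h| ->
    [/\ G (z + mkC s t), 
     `|dx u (z + mkC s t) - dx u z - dx (dx u) z * s - dy (dx u) z * t| <= e / 2 * cmod h &
     `|dy u (z + mkC s t) - dy u z - dx (dy u) z * s - dy (dy u) z * t| <= e / 2 * cmod h].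
  move=> hs ht; have le := cmod_mk_le hs ht; split.
  - by apply: Hd; rewrite subr0; apply: le_lt_trans hd.
  - have := HX (mkC s t); rewrite subr0 expr1 => /(_ (le_lt_trans le hX)) /le_trans; apply.
    by rewrite ler_wpM2l ?(ltW e2).
  - have := HY (mkC s t); rewrite subr0 expr1 => /(_ (le_lt_trans le hY)) /le_trans; apply.
    by rewrite ler_wpM2l ?(ltW e2).
have zE s t : z + mkC s t = mkC (re z + s) (im z + t) by apply: CP; rewrite !reimE.
have I1 := @mvt_quad R (fun x => u (mkC x (im z + im h))) (fun x => dx u (mkC x (im z + im h)))
  (re z) (re h) (dx u z + dy (dx u) z * im h) (dx (dx u) z) (e / 2 * cmod h).
have I2 := @mvt_quad R (fun y => u (mkC (re z) y)) (fun y => dy u (mkC (re z) y))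
  (im z) (im h) (dy u z) (dy (dy u) z) (e / 2 * cmod h).
rewrite [X in `|X|](_ : _ = 
   (u (mkC (re z + re h) (im z + im h)) - u (mkC (re z) (im z + im h))
      - (dx u z + dy (dx u) z * im h) * re h - dx (dx u) z / 2 * re h ^+ 2)
 + (u (mkC (re z) (im z + im h)) - u (mkC (re z) (im z)) - dy u z * im h
      - dy (dy u) z / 2 * im h ^+ 2)); last first.
  have -> : mkC (re z + re h) (im z + im h) = z + h by apply: CP; rewrite !reimE.
  rewrite mkCE cmod_sq /laplacian !expr2 !reimE.
  move: (re h) (im h) (u (z + h)) (u (mkC _ _)) (u z) (dx u z) (dy u z) (dx (dx u) z) (dy (dx u) z) (dy (dy u) z).
  by move=> *; field.
apply: le_trans (ler_normD _ _) _.
have -> : e * cmod h ^+ 2 = e / 2 * cmod h * cmod h + e / 2 * cmod h * cmod h by field.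
have eh : 0 <= e / 2 * cmod h by rewrite mulr_ge0 ?cmod_ge0 // ltW.
apply: lerD.
- apply: le_trans (I1 _ _) _; last by rewrite ler_wpM2l // re_le_cmod.
  + move=> s hs.
    have [Gs _ _] := sub s (im h) hs (lexx _); rewrite zE in Gs.
    exact: (C1_is_derive_dx H1 Gs).
  + move=> s hs; have [_ Gs _] := sub s (im h) hs (lexx _); rewrite zE in Gs.
    by rewrite opprD addrA [_ - dx u z - _ - _]addrAC.
- apply: le_trans (I2 _ _) _; last by rewrite ler_wpM2l // im_le_cmod.
  + move=> s hs.
    have := sub 0 s; rewrite normr0 => /(_ (normr_ge0 _) hs)[Gs _ _]; rewrite zE addr0 in Gs.
    exact: (C1_is_derive_dy H1 Gs).
  + move=> s hs; have := sub 0 s; rewrite normr0 => /(_ (normr_ge0 _) hs)[_ _ Gs].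
    move: Gs; rewrite zE addr0.
    move: (dx (dy u) z) (dy (dy u) z) (dy u z) (dy u _) => a b c f.
    by rewrite mulr0 subr0.
Unshelve. all: by end_near. Qed.

Transparent dx dy.
Lemma near_line_x z (P : set C) : (\forall w \near z, P w) ->
  \forall x \near re z, P (mkC x (im z)).
Proof.
move=> /nbhs_cP[d d0 Hd]; apply/nbhs_ballP; exists d => //= x; rewrite /ball /= => xd.
apply: Hd; have -> : mkC x (im z) - z = rc (x - re z) by apply: CP; rewrite !reimE' ?subrr.
by rewrite cmod_rc distrC.
Qed.
Lemma near_line_y z (P : set C) : (\forall w \near z, P w) ->
  \forall y \near im z, P (mkC (re z) y).
Proof.
move=> /nbhs_cP[d d0 Hd]; apply/nbhs_ballP; exists d => //= y; rewrite /ball /= => yd.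
apply: Hd; have -> : mkC (re z) y - z = mkC 0 (y - im z) by apply: CP; rewrite !reimE' ?subrr.
by rewrite /cmod /= expr0n /= add0r sqrtr_sqr distrC.
Qed.

Lemma is_derive_lnmu f (x l : R) : 0 < f x -> is_derive x 1 f l ->
  is_derive x 1 (fun y => ln (f y)) (l / f x).
Proof.
move=> f0 Hf; have Hln := is_derive1_ln f0.
by rewrite mulrC; exact: (is_derive1_comp (f := @ln R) Hln Hf).
Qed.
Lemma is_derive_quot (f g : R -> R) (x l m : R) : f x != 0 -> is_derive x 1 f l ->
  is_derive x 1 g m -> is_derive x 1 (fun y => g y / f y) (m / f x - g x * l / f x ^+ 2).
Proof.
move=> f0 Hf Hg; have Hv := is_deriveV f0 Hf.
by apply: is_derive_eq; rewrite /GRing.scale /=; field.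
Qed.

Lemma curvature_algebra (p q r s m : R) : 0 < m ->
  - (r / m - p * p / m ^+ 2 + (s / m - q * q / m ^+ 2)) <= - 4 * m ^+ 2 ->
  m ^+ 2 <= m^-1 * ((r + s) / 4) + - (m ^+ 2)^-1 / 2 * (p ^+ 2 + (- q) ^+ 2) / 2.
Proof.
move=> m0 Hk.
have -> : m^-1 * ((r + s) / 4) + - (m ^+ 2)^-1 / 2 * (p ^+ 2 + (- q) ^+ 2) / 2 =
  (r / m - p * p / m ^+ 2 + (s / m - q * q / m ^+ 2)) / 4 by field; exact: lt0r_neq0.
by lra.
Qed.

(** At a point where kappa <= -4 the Laplacian 4 ga of ln mu is at least 4 mu^2. *)
Lemma curvature_jet G mu z : nbhs z G -> C2_on G mu -> (forall w, G w -> 0 < mu w) ->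
  plane_curvature mu z <= - 4 ->
  exists al be ga, jet (fun w => ln (mu w)) z al be ga /\ mu z ^+ 2 <= ga.
Proof.
move=> Gz HC Hpos Hk; have [H1 Hx Hy] := HC.
have Gz0 := nbhs_singleton Gz; have mu0 := Hpos z Gz0.
have [be Hj] := C2_jet Gz HC.
have nzr : \forall w \near z, G w by [].
have lx w : G w -> is_derive (re w) 1 (fun x => ln (mu (mkC x (im w)))) (dx mu w / mu w).
  move=> Gw; have [d1 _ _ _] := H1 w Gw.
  have := is_derive_lnmu (f := fun x => mu (mkC x (im w))) (x := re w).
  by rewrite mkCE; apply; [exact: Hpos|exact: is_derive_dx].
have ly w : G w -> is_derive (im w) 1 (fun y => ln (mu (mkC (re w) y))) (dy mu w / mu w).
  move=> Gw; have [_ d1 _ _] := H1 w Gw.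
  have := is_derive_lnmu (f := fun x => mu (mkC (re w) x)) (x := im w).
  by rewrite mkCE; apply; [exact: Hpos|exact: is_derive_dy].
have [d1 d2 _ _] := H1 z Gz0; have [dxx _ _ _] := Hx z Gz0; have [_ dyy _ _] := Hy z Gz0.
have Lx : dx (dx (fun w => ln (mu w))) z = dx (dx mu) z / mu z - dx mu z * dx mu z / mu z ^+ 2.
  apply: is_derive_derive1.
  have := @is_derive_quot (fun x => mu (mkC x (im z))) (fun x => dx mu (mkC x (im z))) (re z).
  rewrite mkCE => /(_ _ _ (lt0r_neq0 mu0) (is_derive_dx d1) (is_derive_dx dxx)).
  apply: is_derive_near; have := near_line_x nzr; apply: filterS => x Gx.
  by apply/esym/is_derive_derive1; exact: lx.
have Ly : dy (dy (fun w => ln (mu w))) z = dy (dy mu) z / mu z - dy mu z * dy mu z / mu z ^+ 2.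
  apply: is_derive_derive1.
  have := @is_derive_quot (fun x => mu (mkC (re z) x)) (fun x => dy mu (mkC (re z) x)) (im z).
  rewrite mkCE => /(_ _ _ (lt0r_neq0 mu0) (is_derive_dy d2) (is_derive_dy dyy)).
  apply: is_derive_near; have := near_line_y nzr; apply: filterS => x Gx.
  by apply/esym/is_derive_derive1; exact: ly.
have := jet_phi (rjet_ln mu0) Hj => HJ; do 3 eexists; split; first exact: HJ.
move: Hk; rewrite /plane_curvature {1}/laplacian Lx Ly ler_pdivrMr ?exprn_gt0 //.
rewrite cmod_sq re_mk im_mk /laplacian; exact: curvature_algebra.
Qed.
End C2jets.

(** * Goursat's theorem and potentials of closed forms *)

Section Goursat.
Variable R : realType.
Implicit Types (a b c d w h x y e : R) (P Q X Y Z : R -> R -> R).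

Lemma antiderivative (phi : R -> R) (m : R) : continuous phi ->
  exists Phi : R -> R, forall x, m < x -> is_derive x 1 Phi (phi x).
Proof.
move=> cphi; exists (fun x => \int[lebesgue_measure]_(t in [set` Interval (BLeft m) (BRight x)]) phi t).
move=> x mx.
have xx : x < x + 1 by rewrite ltrDl.
have I : lebesgue_measure.-integrable [set` Interval (BLeft m) (BRight (x + 1))] (EFin \o phi).
  apply: continuous_compact_integrable; first exact: segment_compact.
  exact: continuous_subspaceT.
have [D E] := @continuous_FTC1 R phi (BLeft m) x (x + 1) xx I mx (cphi x).
by rewrite -E; apply: DeriveDef D _; rewrite derive1E.
Qed.

Lemma nested (a b : nat -> R) : (forall n, a n <= a n.+1) -> (forall n, b n.+1 <= b n) ->
  (forall n, a n <= b n) -> exists x, forall n, a n <= x <= b n.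
Proof.
move=> ai bd ab.
have ai' m n : (m <= n)%N -> a m <= a n.
  by move=> /subnK <-; elim: (n - m)%N => [//|k IH]; rewrite addSn (le_trans IH).
have bd' m n : (m <= n)%N -> b n <= b m.
  by move=> /subnK <-; elim: (n - m)%N => [//|k IH]; rewrite addSn (le_trans _ IH).
have amb m n : a m <= b n.
  by have := leq_total m n => /orP[mn|nm]; [rewrite (le_trans (ai' _ _ mn))|rewrite (le_trans (ab m) (bd' _ _ nm))].
exists (sup (range a)) => n; apply/andP; split.
- by apply: ub_le_sup; [exists (b 0) => _ [m _ <-]|exists n].
- by apply: ge_sup; [exists (a 0), 0|move=> _ [m _ <-]].
Qed.

Definition incr2 Z a c w h :=
  Z (a + w) (c + h) - Z a (c + h) - Z (a + w) c + Z a c.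

(** The second increment over a rectangle is the sum of those over its quarters. *)
Lemma incr2_quarter Z a c w h : 0 <= w -> 0 <= h -> exists a' c',
  [/\ a <= a', a' + w / 2 <= a + w, c <= c', c' + h / 2 <= c + h &
   `|incr2 Z a c w h| / 4 <= `|incr2 Z a' c' (w / 2) (h / 2)|].
Proof.
move=> w0 h0.
pose I i j := incr2 Z (a + i) (c + j) (w / 2) (h / 2).
have E : incr2 Z a c w h = I 0 0 + I (w / 2) 0 + I 0 (h / 2) + I (w / 2) (h / 2).
  have ww : a + w / 2 + w / 2 = a + w by field.
  have hh : c + h / 2 + h / 2 = c + h by field.
  by rewrite /I /incr2 !addr0 ww hh; ring.
have [M|] := leP (`|incr2 Z a c w h| / 4) `|I 0 0|.
  exists (a + 0), (c + 0); split; rewrite ?addr0 //; try lra; by rewrite -{2}[a]addr0 -{2}[c]addr0.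
have [M _|] := leP (`|incr2 Z a c w h| / 4) `|I (w / 2) 0|.
  exists (a + w / 2), (c + 0); split=> //; lra.
have [M _ _|] := leP (`|incr2 Z a c w h| / 4) `|I 0 (h / 2)|.
  exists (a + 0), (c + h / 2); split=> //; lra.
have [M _ _ _|] := leP (`|incr2 Z a c w h| / 4) `|I (w / 2) (h / 2)|.
  exists (a + w / 2), (c + h / 2); split=> //; lra.
move=> H4 H3 H2 H1; exfalso.
have := ler_normD (I 0 0 + I (w / 2) 0 + I 0 (h / 2)) (I (w / 2) (h / 2)).
have := ler_normD (I 0 0 + I (w / 2) 0) (I 0 (h / 2)).
have := ler_normD (I 0 0) (I (w / 2) 0).
rewrite -E; move: H1 H2 H3 H4.
move: `|incr2 Z a c w h| `|I 0 0 + I (w / 2) 0 + I 0 (h / 2)| `|I 0 0 + I (w / 2) 0|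
  `|I 0 0| `|I (w / 2) 0| `|I 0 (h / 2)| `|I (w / 2) (h / 2)|.
by clear; move=> *; lra.
Qed.

Lemma two_in_itv (u r s t : R) : u <= s <= u + r -> u <= t <= u + r -> `|s - t| <= r.
Proof. by move=> /andP[? ?] /andP[? ?]; rewrite ler_norml; apply/andP; split; lra. Qed.

Definition rdiff_in (a c w h : R) P x y (p1 p2 : R) := forall e, 0 < e ->
  exists2 d, 0 < d & forall x' y', a <= x' <= a + w -> c <= y' <= c + h ->
    `|x' - x| <= d -> `|y' - y| <= d ->
    `|P x' y' - P x y - p1 * (x' - x) - p2 * (y' - y)| <= e * (`|x' - x| + `|y' - y|).

Lemma sub_bound (u1 u2 u3 k s t st B : R) : `|u1 - u3 - k - s| <= B ->
  `|u2 - u3 - k - t| <= B -> s - t = st -> `|u1 - u2 - st| <= 2 * B.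
Proof. by rewrite !ler_norml => /andP[? ?] /andP[? ?] <-; apply/andP; split; lra. Qed.

(** Where P dx + Q dy is closed at (x, y), with common mixed derivative p2, both X and
    Y have the second increment p2 w h up to the stated error. *)
Lemma incr2_small P Q X Y x y p1 p2 q2 e a c w h : 0 <= e -> 0 <= w -> 0 <= h ->
  a <= x <= a + w -> c <= y <= c + h ->
  (forall x' y', a <= x' <= a + w -> c <= y' <= c + h -> is_derive x' 1 (X ^~ y') (P x' y')) ->
  (forall x' y', a <= x' <= a + w -> c <= y' <= c + h -> is_derive y' 1 (Y x') (Q x' y')) ->
  (forall x' y', a <= x' <= a + w -> c <= y' <= c + h ->
    `|P x' y' - P x y - p1 * (x' - x) - p2 * (y' - y)| <= e * (`|x' - x| + `|y' - y|) /\
    `|Q x' y' - Q x y - p2 * (x' - x) - q2 * (y' - y)| <= e * (`|x' - x| + `|y' - y|)) ->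
  `|incr2 (fun x y => X x y - Y x y) a c w h| <= 2 * e * (w + h) ^+ 2.
Proof.
move=> e0 w0 h0 xin yin HX HY HPQ.
have near_x x' : a <= x' <= a + w -> `|x' - x| <= w.
  by move=> x'in; apply: two_in_itv x'in _.
have near_y y' : c <= y' <= c + h -> `|y' - y| <= h.
  by move=> x'in; apply: two_in_itv x'in _.
have aw : a <= a + w by lra.
have ch : c <= c + h by lra.
have cin : c <= c <= c + h by rewrite lexx.
have din : c <= c + h <= c + h by rewrite lexx ch.
have ain : a <= a <= a + w by rewrite lexx.
have bin : a <= a + w <= a + w by rewrite lexx aw.
have le_e s t : s <= w -> t <= h -> e * (s + t) <= e * (w + h).
  by move=> sw th; rewrite ler_wpM2l // lerD.
have EX : `|(X (a + w) (c + h) - X (a + w) c - p2 * h * (a + w)) - (X a (c + h) - X a c - p2 * h * a)|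
    <= 2 * (e * (w + h)) * (a + w - a).
  apply: (@mvt_bound R (fun x' => X x' (c + h) - X x' c - p2 * h * x')
    (fun x' => P x' (c + h) - P x' c - p2 * h)) => // x' x'in.
    have H1 := HX x' _ x'in din; have H2 := HX x' _ x'in cin.
    have -> : (fun x' => X x' (c + h) - X x' c - p2 * h * x') =
       ((X ^~ (c + h)) \- (X ^~ c)) \- (fun x' => p2 * h * x') by [].
    by apply: is_derive_eq; rewrite /GRing.scale /= !mulr1.
  have [H1 _] := HPQ x' _ x'in din; have [H2 _] := HPQ x' _ x'in cin.
  have le1 := le_trans H1 (le_e _ _ (near_x _ x'in) (near_y _ din)).
  have le2 := le_trans H2 (le_e _ _ (near_x _ x'in) (near_y _ cin)).
  by apply: (sub_bound le1 le2); ring.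
have EY : `|(Y (a + w) (c + h) - Y a (c + h) - p2 * w * (c + h)) - (Y (a + w) c - Y a c - p2 * w * c)|
    <= 2 * (e * (w + h)) * (c + h - c).
  apply: (@mvt_bound R (fun y' => Y (a + w) y' - Y a y' - p2 * w * y')
    (fun y' => Q (a + w) y' - Q a y' - p2 * w)) => // y' y'in.
    have H1 := HY _ y' bin y'in; have H2 := HY _ y' ain y'in.
    have -> : (fun y' => Y (a + w) y' - Y a y' - p2 * w * y') =
       ((Y (a + w)) \- (Y a)) \- (fun y' => p2 * w * y') by [].
    by apply: is_derive_eq; rewrite /GRing.scale /= !mulr1.
  have [_ H1] := HPQ _ y' bin y'in; have [_ H2] := HPQ _ y' ain y'in.
  have le1 := le_trans H1 (le_e _ _ (near_x _ bin) (near_y _ y'in)).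
  have le2 := le_trans H2 (le_e _ _ (near_x _ ain) (near_y _ y'in)).
  rewrite [X in `|X|]addrAC in le1; rewrite [X in `|X|]addrAC in le2.
  by apply: (sub_bound le1 le2); ring.
rewrite (_ : incr2 _ a c w h = 
   ((X (a + w) (c + h) - X (a + w) c - p2 * h * (a + w)) - (X a (c + h) - X a c - p2 * h * a)) -
   ((Y (a + w) (c + h) - Y a (c + h) - p2 * w * (c + h)) - (Y (a + w) c - Y a c - p2 * w * c))); last first.
  by rewrite /incr2; ring.
apply: le_trans (ler_normB _ _) _; apply: le_trans (lerD EX EY) _.
by rewrite le_eqVlt; apply/orP; left; apply/eqP; ring.
Qed.

Lemma half_pow_lt w d : 0 <= w -> 0 < d -> exists N, forall n, (N <= n)%N -> w / 2 ^+ n <= d.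
Proof.
move=> w0 d0; exists (Num.bound (w / d)) => n Nn.
rewrite ler_pdivrMr ?exprn_gt0 // mulrC -ler_pdivrMr //.
have := archi_boundP (divr_ge0 w0 (ltW d0)); move/ltW/le_trans; apply.
apply: le_trans (_ : n%:R <= _); first by rewrite ler_nat.
by rewrite -natrX ler_nat ltnW // ltn_expl.
Qed.

(** Goursat's theorem for the form P dx + Q dy, closed at each point but without
    continuity of the derivatives. With partial antiderivatives X and Y of P and
    Q, the integral over the boundary of a rectangle is, up to sign, the second
    increment of X - Y. *)
Lemma goursat P Q X Y a c w h : 0 <= w -> 0 <= h ->
  (forall x y, a <= x <= a + w -> c <= y <= c + h -> is_derive x 1 (X ^~ y) (P x y)) ->
  (forall x y, a <= x <= a + w -> c <= y <= c + h -> is_derive y 1 (Y x) (Q x y)) ->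
  (forall x y, a <= x <= a + w -> c <= y <= c + h -> exists p1 p2 q2,
    rdiff_in a c w h P x y p1 p2 /\ rdiff_in a c w h Q x y p2 q2) ->
  incr2 (fun x y => X x y - Y x y) a c w h = 0.
Proof.
move=> w0 h0 HX HY HD; pose Z x y := X x y - Y x y; rewrite -/Z.
(* q = (n, (u, v)) stands for the rectangle of sides w / 2^n, h / 2^n at (u, v) *)
have step : forall q : nat * (R * R), exists q' : nat * (R * R),
   [/\ q'.1 = q.1.+1, q.2.1 <= q'.2.1, q'.2.1 + w / 2 ^+ q'.1 <= q.2.1 + w / 2 ^+ q.1,
     q.2.2 <= q'.2.2 /\ q'.2.2 + h / 2 ^+ q'.1 <= q.2.2 + h / 2 ^+ q.1 &
     `|incr2 Z q.2.1 q.2.2 (w / 2 ^+ q.1) (h / 2 ^+ q.1)| / 4 <=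
     `|incr2 Z q'.2.1 q'.2.2 (w / 2 ^+ q'.1) (h / 2 ^+ q'.1)|].
  move=> [n [u v]].
  have wn : 0 <= w / 2 ^+ n by rewrite divr_ge0 ?exprn_ge0.
  have hn : 0 <= h / 2 ^+ n by rewrite divr_ge0 ?exprn_ge0.
  have [u' [v' [H1 H2 H3 H4 H5]]] := incr2_quarter Z u v wn hn.
  exists (n.+1, (u', v')) => /=.
  have E (t : R) : t / 2 ^+ n.+1 = t / 2 ^+ n / 2 by rewrite exprSr invfM mulrA.
  by rewrite !E; split.
have [f Hf] := choice step.
pose s n := iter n f (0%N, (a, c)).
have s1 n : (s n).1 = n by elim: n => [//|n IH]; rewrite /s iterS; have [-> _ _ _ _] := Hf (s n); rewrite IH.
pose A n := (s n).2.1; pose B n := (s n).2.2.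
have St n : [/\ A n <= A n.+1, A n.+1 + w / 2 ^+ n.+1 <= A n + w / 2 ^+ n,
     B n <= B n.+1, B n.+1 + h / 2 ^+ n.+1 <= B n + h / 2 ^+ n &
     `|incr2 Z (A n) (B n) (w / 2 ^+ n) (h / 2 ^+ n)| / 4 <=
     `|incr2 Z (A n.+1) (B n.+1) (w / 2 ^+ n.+1) (h / 2 ^+ n.+1)|].
  have [_ h1 h2 [h3 h4] h5] := Hf (s n).
  rewrite -[f (s n)]/(s n.+1) !s1 in h1 h2 h3 h4 h5.
  by split.
have w2 n : 0 <= w / 2 ^+ n by rewrite divr_ge0 ?exprn_ge0.
have h2 n : 0 <= h / 2 ^+ n by rewrite divr_ge0 ?exprn_ge0.
have [x Hx] : exists x, forall n, A n <= x <= A n + w / 2 ^+ n.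
  apply: nested => n; [by have [] := St n|by have [] := St n|by rewrite lerDl].
have [y Hy] : exists y, forall n, B n <= y <= B n + h / 2 ^+ n.
  apply: nested => n; [by have [] := St n|by have [] := St n|by rewrite lerDl].
have A0 n : a <= A n /\ A n + w / 2 ^+ n <= a + w.
  elim: n => [|n [IH1 IH2]]; first by rewrite /A /s /= expr0 divr1.
  by have [k1 k2 _ _ _] := St n; rewrite (le_trans IH1) // (le_trans k2).
have B0 n : c <= B n /\ B n + h / 2 ^+ n <= c + h.
  elim: n => [|n [IH1 IH2]]; first by rewrite /B /s /= expr0 divr1.
  by have [_ _ k1 k2 _] := St n; rewrite (le_trans IH1) // (le_trans k2).
have D0 n : `|incr2 Z a c w h| / 4 ^+ n <= `|incr2 Z (A n) (B n) (w / 2 ^+ n) (h / 2 ^+ n)|.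
  elim: n => [|n IH]; first by rewrite /A /B /s /= !expr0 !divr1.
  have [_ _ _ _ k] := St n; apply: le_trans k.
  by rewrite exprSr invfM mulrA ler_pM2r.
have xin : a <= x <= a + w.
  by have := Hx 0%N; rewrite /A /s /= expr0 divr1.
have yin : c <= y <= c + h.
  by have := Hy 0%N; rewrite /B /s /= expr0 divr1.
have [p1 [p2 [q2 [HP HQ]]]] := HD x y xin yin.
apply/eqP; rewrite -normr_eq0 eq_le normr_ge0 andbT.
have wh0 : 0 <= (w + h) ^+ 2 by rewrite exprn_ge0 // addr_ge0.
apply/ler_addgt0Pr => e' e'0; rewrite add0r.
pose e := e' / (2 * ((w + h) ^+ 2 + 1)).
have e0 : 0 < e by rewrite divr_gt0 // mulr_gt0 // ltr_wpDl.
have [dP dP0 HdP] := HP e e0; have [dQ dQ0 HdQ] := HQ e e0.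
pose d := Num.min dP dQ; have d0 : 0 < d by rewrite lt_min dP0.
have [N1 HN1] := half_pow_lt w0 d0; have [N2 HN2] := half_pow_lt h0 d0.
pose n := maxn N1 N2.
have wd : w / 2 ^+ n <= d by apply: HN1; rewrite leq_maxl.
have hd : h / 2 ^+ n <= d by apply: HN2; rewrite leq_maxr.
have [An1 An2] := A0 n; have [Bn1 Bn2] := B0 n.
have inA t : A n <= t <= A n + w / 2 ^+ n -> a <= t <= a + w.
  by move=> /andP[t1 t2]; rewrite (le_trans An1 t1) (le_trans t2).
have inB t : B n <= t <= B n + h / 2 ^+ n -> c <= t <= c + h.
  by move=> /andP[t1 t2]; rewrite (le_trans Bn1 t1) (le_trans t2).
have I := @incr2_small P Q X Y x y p1 p2 q2 e (A n) (B n) (w / 2 ^+ n) (h / 2 ^+ n)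
  (ltW e0) (w2 n) (h2 n) (Hx n) (Hy n).
have {}I := I (fun x' y' i1 i2 => HX x' y' (inA _ i1) (inB _ i2)).
have {}I := I (fun x' y' i1 i2 => HY x' y' (inA _ i1) (inB _ i2)).
have dd : d <= dP /\ d <= dQ by rewrite !ge_min !lexx orbT.
have {}I : `|incr2 Z (A n) (B n) (w / 2 ^+ n) (h / 2 ^+ n)| <= 2 * e * (w / 2 ^+ n + h / 2 ^+ n) ^+ 2.
  apply: I => x' y' i1 i2.
  have l1 : `|x' - x| <= d.
    exact: le_trans (two_in_itv i1 (Hx n)) wd.
  have l2 : `|y' - y| <= d.
    exact: le_trans (two_in_itv i2 (Hy n)) hd.
  split.
    exact: (HdP _ _ (inA _ i1) (inB _ i2) (le_trans l1 dd.1) (le_trans l2 dd.1)).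
  exact: (HdQ _ _ (inA _ i1) (inB _ i2) (le_trans l1 dd.2) (le_trans l2 dd.2)).
have := le_trans (D0 n) I; rewrite -mulrDl expr_div_n -exprM mulnC exprM.
have -> : (2 : R) ^+ 2 = 4 by rewrite expr2 -natrM.
rewrite mulrA ler_pM2r ?invr_gt0 ?exprn_gt0 // => /le_trans; apply.
rewrite /e; move: wh0; move: ((w + h) ^+ 2) => S S0.
have S1 : S + 1 != 0 by rewrite gt_eqF // ltr_wpDl.
have -> : 2 * (e' / (2 * (S + 1))) * S = e' * (S / (S + 1)) by field.
by rewrite ler_piMr ?(ltW e'0) // ler_pdivrMr ?mul1r ?ltr_wpDl // lerDl.
Qed.
End Goursat.

Section Primitive.
Variable R : realType.
Local Notation C := (CC R).
Implicit Types (x y s t e d r : R) (P Q : R -> R -> R) (z w : C) (g F : C -> C).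

Lemma clamp_props x0 s x : 0 <= s ->
  let k := Num.max (x0 - s) (Num.min (x0 + s) x) in
  (x0 - s <= k <= x0 + s) /\ (x0 - s <= x <= x0 + s -> k = x).
Proof.
move=> s0 /=; split.
- rewrite le_max lexx /= ge_max ge_min lexx /= andbT; lra.
- by move=> /andP[h1 h2]; rewrite (min_idPr h2) (max_idPr h1).
Qed.

Lemma max_lip (a u v : R) : `|Num.max a u - Num.max a v| <= `|u - v|.
Proof.
have h1 := ler_norm (u - v); have h2 := ler_norm (v - u); rewrite distrC in h2.
by rewrite ler_norml; have [k1|k1] := leP a u; have [k2|k2] := leP a v; apply/andP; split; lra.
Qed.
Lemma min_lip (a u v : R) : `|Num.min a u - Num.min a v| <= `|u - v|.
Proof.
have h1 := ler_norm (u - v); have h2 := ler_norm (v - u); rewrite distrC in h2.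
by rewrite ler_norml; have [k1|k1] := leP a u; have [k2|k2] := leP a v; apply/andP; split; lra.
Qed.
(** The coefficients are controlled on a square only; composing them with the
    retraction of the line onto an interval makes them continuous everywhere. *)
Lemma clamp_cont x0 s :
  continuous (fun x : R => Num.max (x0 - s) (Num.min (x0 + s) x)).
Proof.
move=> x; apply/cont_RP => e e0; apply/nbhs_ballP; exists e => //= y.
rewrite /ball /= distrC; apply: le_lt_trans.
exact: le_trans (max_lip _ _ _) (min_lip _ _ _).
Qed.

(** By Goursat's theorem X - Y has vanishing second increments, so it splits as
    u(x) + v(y); subtracting u from X yields the potential. *)
Lemma potential P Q x0 y0 s : 0 < s ->
  (forall x y, x0 - s <= x <= x0 + s -> y0 - s <= y <= y0 + s -> exists p1 p2 q2, forall e, 0 < e ->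
    exists2 d, 0 < d & forall x' y', `|x' - x| <= d -> `|y' - y| <= d ->
    `|P x' y' - P x y - p1 * (x' - x) - p2 * (y' - y)| <= e * (`|x' - x| + `|y' - y|) /\
    `|Q x' y' - Q x y - p2 * (x' - x) - q2 * (y' - y)| <= e * (`|x' - x| + `|y' - y|)) ->
  exists A : R -> R -> R, forall x y, x0 - s < x < x0 + s -> y0 - s < y < y0 + s ->
    is_derive x 1 (A ^~ y) (P x y) /\ is_derive y 1 (A x) (Q x y).
Proof.
move=> s0 H.
pose kx x := Num.max (x0 - s) (Num.min (x0 + s) x).
pose ky y := Num.max (y0 - s) (Num.min (y0 + s) y).
have Kx x : x0 - s <= kx x <= x0 + s by have [] := clamp_props x0 x (ltW s0).
have Ky y : y0 - s <= ky y <= y0 + s by have [] := clamp_props y0 y (ltW s0).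
have kxE x : x0 - s <= x <= x0 + s -> kx x = x by have [_] := clamp_props x0 x (ltW s0).
have kyE y : y0 - s <= y <= y0 + s -> ky y = y by have [_] := clamp_props y0 y (ltW s0).
have ckx : continuous kx := @clamp_cont _ _.
have cky : continuous ky := @clamp_cont _ _.
have cP y : continuous (fun x => P (kx x) (ky y)).
  move=> x; apply: (@continuous_comp _ _ _ kx (fun x => P x (ky y))); first exact: ckx.
  have [p1 [p2 [q2 Hp]]] := H _ _ (Kx x) (Ky y).
  apply/cont_RP => e e0; have [d d0 Hd] := Hp 1 ltr01.
  pose m := Num.min d (e / 2 / (`|p1| + 1 + 1)).
  have p0 : 0 < `|p1| + 1 + 1 by rewrite ltr_pwDr // addr_ge0.
  have m0 : 0 < m by rewrite lt_min d0 !divr_gt0.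
  apply/nbhs_ballP; exists m => //= x'; rewrite /ball /= distrC lt_min => /andP[xd xe].
  have := (Hd x' (ky y) (ltW xd)); rewrite subrr normr0 => /(_ (ltW d0))[+ _].
  rewrite mulr0 subr0 addr0 mul1r => h1.
  move: xe; rewrite ltr_pdivlMr // => xe.
  have h2 := ler_normD (P x' (ky y) - P (kx x) (ky y) - p1 * (x' - kx x)) (p1 * (x' - kx x)).
  rewrite subrK normrM in h2.
  apply: le_lt_trans h2 _; move: h1 xe (normr_ge0 (x' - kx x)) => {}h1 xe h3.
  apply: le_lt_trans (lerD h1 (lexx _)) _.
  move: xe; rewrite !mulrDr mulr1 [_ * `|p1|]mulrC; move: (`|p1| * _) => pp; lra.
have cQ x : continuous (fun y => Q (kx x) (ky y)).
  move=> y; apply: (@continuous_comp _ _ _ ky (fun y => Q (kx x) y)); first exact: cky.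
  have [p1 [p2 [q2 Hp]]] := H _ _ (Kx x) (Ky y).
  apply/cont_RP => e e0; have [d d0 Hd] := Hp 1 ltr01.
  pose m := Num.min d (e / 2 / (`|q2| + 1 + 1)).
  have p0 : 0 < `|q2| + 1 + 1 by rewrite ltr_pwDr // addr_ge0.
  have m0 : 0 < m by rewrite lt_min d0 !divr_gt0.
  apply/nbhs_ballP; exists m => //= x'; rewrite /ball /= distrC lt_min => /andP[xd xe].
  have := (Hd (kx x) x'); rewrite subrr normr0 => /(_ (ltW d0) (ltW xd))[_].
  rewrite mulr0 subr0 add0r mul1r => h1.
  move: xe; rewrite ltr_pdivlMr // => xe.
  have h2 := ler_normD (Q (kx x) x' - Q (kx x) (ky y) - q2 * (x' - ky y)) (q2 * (x' - ky y)).
  rewrite subrK normrM in h2.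
  apply: le_lt_trans h2 _; move: h1 xe (normr_ge0 (x' - ky y)) => {}h1 xe h3.
  apply: le_lt_trans (lerD h1 (lexx _)) _.
  move: xe; rewrite !mulrDr mulr1 [_ * `|q2|]mulrC; move: (`|q2| * _) => pp; lra.
have /choice[X HX] : forall y, exists Phi : R -> R,
    forall x, x0 - s - 1 < x -> is_derive x 1 Phi (P (kx x) (ky y)).
  by move=> y; exact: antiderivative.
have /choice[Y HY] : forall x, exists Phi : R -> R,
    forall y, y0 - s - 1 < y -> is_derive y 1 Phi (Q (kx x) (ky y)).
  by move=> x; exact: antiderivative.
pose Z x y := X y x - Y x y.
have Zx x y : x0 - s <= x <= x0 + s -> y0 - s <= y <= y0 + s -> 
   Z x y = Z (x0 - s) y + Z x (y0 - s) - Z (x0 - s) (y0 - s).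
  move=> /andP[x1 x2] /andP[y1 y2].
  have wx : x0 - s + (x - (x0 - s)) = x by ring.
  have wy : y0 - s + (y - (y0 - s)) = y by ring.
  have inx u : x0 - s <= u <= x -> x0 - s <= u <= x0 + s.
    by move=> /andP[-> u2]; exact: le_trans x2.
  have iny v : y0 - s <= v <= y -> y0 - s <= v <= y0 + s.
    by move=> /andP[-> v2]; exact: le_trans y2.
  have lt1 (u k : R) : k <= u -> k - 1 < u by move=> ku; rewrite ltrBlDr (le_lt_trans ku) // ltrDl.
  have := @goursat R P Q (fun x y => X y x) Y (x0 - s) (y0 - s) (x - (x0 - s)) (y - (y0 - s)).
  rewrite !subr_ge0 wx wy /incr2 wx wy => /(_ x1 y1) G.
  suff : Z x y - Z (x0 - s) y - Z x (y0 - s) + Z (x0 - s) (y0 - s) = 0 by lra.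
  apply: G.
  - move=> u v ui vi; have := HX v u; rewrite (kxE u (inx u ui)) (kyE v (iny v vi)).
    by apply; apply: lt1; case/andP: ui.
  - move=> u v ui vi; have := HY u v; rewrite (kxE u (inx u ui)) (kyE v (iny v vi)).
    by apply; apply: lt1; case/andP: vi.
  - move=> u v ui vi; have [p1 [p2 [q2 Hp]]] := H u v (inx u ui) (iny v vi).
    exists p1, p2, q2; split=> e e0; have [d d0 Hd] := Hp e e0; exists d => // x' y' _ _ h1 h2.
      by have [] := Hd x' y' h1 h2.
    by have [] := Hd x' y' h1 h2.
exists (fun x y => X y x - Z (x0 - s) y) => x y /andP[x1 x2] /andP[y1 y2].
have xi : x0 - s <= x <= x0 + s by rewrite !ltW.
have yi : y0 - s <= y <= y0 + s by rewrite !ltW.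
have hx := HX y x; have hy := HY x y; rewrite kxE // kyE // in hx hy.
split.
- have {}hx : is_derive x 1 (X y) (P x y) by apply: hx; lra.
  have -> : (fun t => X y t - Z (x0 - s) y) = X y \- cst (Z (x0 - s) y) by [].
  by apply: is_derive_eq; rewrite subr0.
- have {}hy : is_derive y 1 (Y x) (Q x y) by apply: hy; lra.
  pose k := Z x (y0 - s) - Z (x0 - s) (y0 - s).
  apply: (@is_derive_near _ (fun t => Y x t + k)).
    near=> t; have ti : y0 - s <= t <= y0 + s.
      by apply/andP; split; apply: ltW; near: t; [exact: lt_nbhsr|exact: lt_nbhsl].
    by have := Zx x t xi ti; rewrite {1}/Z /k; lra.
  have -> : (fun t => Y x t + k) = Y x \+ cst k by [].
  by apply: is_derive_eq; rewrite addr0.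
Unshelve. all: by end_near. Qed.
End Primitive.

(** * Primitives of holomorphic functions *)

Section Compactness.
Variable R : realType.
Local Notation C := (CC R).
Implicit Types (z w : C) (K : set C).

Lemma mkC_continuous : continuous (fun p : R * R => mkC p.1 p.2 : C).
Proof.
move=> [x y]; apply/cont_CP => e e0.
apply/nbhs_ballP; exists (e / 2); first by rewrite /= divr_gt0.
move=> [u v]; rewrite /ball /prod_ball /= => -[h1 h2].
apply: (le_lt_trans (cmod_le_reim (mkC u v - mkC x y))).
by rewrite !reimE [e]splitr; apply: ltrD; rewrite distrC.
Qed.

Lemma compact_C K (M : R) : closed K -> (forall z, K z -> cmod z <= M) -> compact K.
Proof.
move=> clK bK.
have H : compact ((fun p : R * R => mkC p.1 p.2 : C) @` (`[- M, M] `*` `[- M, M])).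
  apply: continuous_compact; last by apply: compact_setX; exact: segment_compact.
  exact/continuous_subspaceT/mkC_continuous.
apply: (subclosed_compact clK H) => z Kz; exists (re z, im z); last exact: mkCE.
have := bK z Kz => zM; split; rewrite /= in_itv /= -ler_norml.
  exact: le_trans (re_le_cmod z) zM.
exact: le_trans (im_le_cmod z) zM.
Qed.

Lemma closed_CP K : (forall z, ~ K z -> \forall w \near z, ~ K w) -> closed K.
Proof.
move=> H; rewrite -[K]setCK; apply: open_closedC.
by rewrite openE => z /= /H; apply: filterS.
Qed.

Lemma cmod_cont z0 : continuous (fun z : C => cmod (z - z0)).
Proof.
move=> z; apply/cont_RP => e e0; apply: filterS (near_cball z e0) => w.
apply: le_lt_trans; apply: le_trans (cmod_distB _ _) _.
by rewrite opprB addrA subrK.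
Qed.

Lemma near_lt_cont (u : C -> R) (m : R) z :
  {for z, continuous u} -> u z < m -> \forall w \near z, u w < m.
Proof.
move=> cu um; have d0 : 0 < m - u z by rewrite subr_gt0.
move/cont_RP: cu => /(_ _ d0); apply: filterS => w; rewrite ltr_norml => /andP[_].
by rewrite ltrD2r.
Qed.
Lemma near_gt_cont (u : C -> R) (m : R) z :
  {for z, continuous u} -> m < u z -> \forall w \near z, m < u w.
Proof.
move=> cu um; have d0 : 0 < u z - m by rewrite subr_gt0.
move/cont_RP: cu => /(_ _ d0); apply: filterS => w; rewrite ltr_norml => /andP[+ _].
by rewrite opprB ltrD2r.
Qed.

Lemma evt_max K (M : R) (u : C -> R) : K !=set0 -> closed K -> (forall z, K z -> cmod z <= M) ->
  (forall z, K z -> {for z, continuous u}) ->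
  exists2 c, K c & forall z, K z -> u z <= u c.
Proof.
move=> K0 clK bK cu; have cK := compact_C clK bK.
have [] := compact_EVT_max K0 cK (f := u).
  apply: continuous_in_subspaceT => z; rewrite inE; exact: cu.
by move=> c; rewrite inE => Kc H; exists c => // z Kz; apply: H; rewrite inE.
Qed.

Lemma closed_annulus z0 (s r : R) : closed [set z : C | s <= cmod (z - z0) <= r].
Proof.
apply: closed_CP => z /= /negP; rewrite negb_and -!ltNge => /orP[h|h].
- by apply: filterS (near_lt_cont (@cmod_cont z0 z) h) => w h1 /andP[]; rewrite leNgt h1.
- by apply: filterS (near_gt_cont (@cmod_cont z0 z) h) => w h1 /andP[_]; rewrite leNgt h1.
Qed.

Lemma annulus_bound z0 (s r : R) z : s <= cmod (z - z0) <= r -> cmod z <= r + cmod z0.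
Proof.
by move=> /andP[_ h]; have := cmodD (z - z0) z0; rewrite subrK => /le_trans; apply; rewrite lerD2r.
Qed.
End Compactness.

Section Holomorphic.
Variable R : realType.
Local Notation C := (CC R).
Implicit Types (z w h a b c : C) (x y e d r : R) (u : C -> R) (g f F : C -> C).

Lemma oh_cmodP k (q : C -> C) : oh k (fun h => re (q h)) -> oh k (fun h => im (q h)) ->
  oh k (fun h => cmod (q h)).
Proof.
move=> H1 H2 e e0; have e2 : 0 < e / 2 by rewrite divr_gt0.
apply: filterS2 (H1 _ e2) (H2 _ e2) => h h1 h2.
rewrite ger0_norm ?cmod_ge0 //; apply: le_trans (cmod_le_reim _) _.
by apply: le_trans (lerD h1 h2) _; rewrite -mulrDl -splitr.
Qed.

Lemma cdiffP g z a : cdiff g z a <-> forall e, 0 < e -> exists2 d, 0 < d &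
  forall h, cmod h < d -> cmod (g (z + h) - g z - a * h) <= e * cmod h.
Proof.
split=> [H e /H/nbhs_cP[d d0 Hd]|H e /H[d d0 Hd]].
- exists d => // h hd; have := Hd h; rewrite subr0 => /(_ hd).
  by rewrite ger0_norm ?cmod_ge0.
- apply/nbhs_cP; exists d => // h; rewrite subr0 => hd.
  by rewrite ger0_norm ?cmod_ge0 // expr1 Hd.
Qed.

Lemma cdiff_id z : cdiff id z 1.
Proof. exact: hjet_cdiff (hjet_id z). Qed.
Lemma cdiffD f g z a b : cdiff f z a -> cdiff g z b -> cdiff (fun w => f w + g w) z (a + b).
Proof. by move=> Hf Hg; have := oh_cD Hf Hg; apply: oh_ceq => h; ring. Qed.
Lemma cdiffZ f z a c : cdiff f z a -> cdiff (fun w => c * f w) z (c * a).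
Proof. by move=> /(oh_cZ c); apply: oh_ceq => h; ring. Qed.
Lemma cdiffN f z a : cdiff f z a -> cdiff (fun w => - f w) z (- a).
Proof.
by move=> H; apply: oh_eq H => h; rewrite -cmodN; congr cmod; ring.
Qed.
Lemma cdiff_shift f z a k : cdiff f (z + k) a -> cdiff (fun w => f (w + k)) z a.
Proof. by apply: oh_ceq => h; rewrite [z + h + k]addrAC. Qed.

(** By the Cauchy-Riemann equations re g dx - im g dy and im g dx + re g dy are
    closed at each point; their potentials are the two parts of the primitive. *)
Lemma primitive g (g1 : C -> C) z0 r : 0 < r ->
  (forall w, cmod (w - z0) < r -> cdiff g w (g1 w)) ->
  exists F, forall w, cmod (w - z0) < r / 3 -> cdiff F w (g w).
Proof.
move=> r0 Hg; pose s := r / 3; have s0 : 0 < s by rewrite divr_gt0.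
have insq x y : re z0 - s <= x <= re z0 + s -> im z0 - s <= y <= im z0 + s ->
    cmod (mkC x y - z0) < r.
  move=> hx hy; apply: le_lt_trans (cmod_le_reim _) _; rewrite !reimE.
  have : `|x - re z0| <= s by rewrite ler_norml; lra.
  have : `|y - im z0| <= s by rewrite ler_norml; lra.
  have : r = 3 * s by rewrite /s; field.
  lra.
have est x y : re z0 - s <= x <= re z0 + s -> im z0 - s <= y <= im z0 + s ->
   let a := g1 (mkC x y) in
   forall e, 0 < e -> exists2 d, 0 < d & forall x' y', `|x' - x| <= d -> `|y' - y| <= d ->
    `|re (g (mkC x' y')) - re (g (mkC x y)) - re a * (x' - x) - - im a * (y' - y)|
       <= e * (`|x' - x| + `|y' - y|) /\
    `|im (g (mkC x' y')) - im (g (mkC x y)) - im a * (x' - x) - re a * (y' - y)|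
       <= e * (`|x' - x| + `|y' - y|).
  move=> hx hy a e e0; have /cdiffP/(_ e e0)[d d0 Hd] := Hg _ (insq _ _ hx hy).
  exists (d / 3) => [|x' y' h1 h2]; first by rewrite divr_gt0.
  have b : cmod (mkC (x' - x) (y' - y)) <= `|x' - x| + `|y' - y|.
    exact: (cmod_le_reim (mkC (x' - x) (y' - y))).
  have hd : cmod (mkC (x' - x) (y' - y)) < d by apply: le_lt_trans b _; lra.
  have := Hd _ hd.
  have <- : mkC x' y' = mkC x y + mkC (x' - x) (y' - y).
    by apply: CP; rewrite !reimE addrC subrK.
  rewrite -/a; move: (g (mkC x' y')) (g (mkC x y)) a => G1 G2 a {}Hd.
  have {}Hd : cmod (G1 - G2 - a * mkC (x' - x) (y' - y)) <= e * (`|x' - x| + `|y' - y|).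
    by apply: le_trans Hd _; rewrite ler_wpM2l // ltW.
  split; apply: le_trans Hd.
  - rewrite [X in `|X|](_ : _ = re (G1 - G2 - a * mkC (x' - x) (y' - y))); first exact: re_le_cmod.
    by rewrite !reimE; ring.
  - rewrite [X in `|X|](_ : _ = im (G1 - G2 - a * mkC (x' - x) (y' - y))); first exact: im_le_cmod.
    by rewrite !reimE; ring.
have neg (u v p q k l : R) : `|- u - - v - - p * k - - q * l| = `|u - v - p * k - q * l|.
  by rewrite -normrN; congr `|_|; ring.
have [A HA] : exists A : R -> R -> R, forall x y, re z0 - s < x < re z0 + s -> im z0 - s < y < im z0 + s ->
    is_derive x 1 (A ^~ y) (re (g (mkC x y))) /\ is_derive y 1 (A x) (- im (g (mkC x y))).
  apply: (potential s0) => x y hx hy; have E := est x y hx hy.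
  exists (re (g1 (mkC x y))), (- im (g1 (mkC x y))), (- re (g1 (mkC x y))) => e e0.
  have [d d0 Hd] := E e e0; exists d => // x' y' h1 h2.
  by rewrite neg; exact: Hd.
have [B HB] : exists B : R -> R -> R, forall x y, re z0 - s < x < re z0 + s -> im z0 - s < y < im z0 + s ->
    is_derive x 1 (B ^~ y) (im (g (mkC x y))) /\ is_derive y 1 (B x) (re (g (mkC x y))).
  apply: (potential s0) => x y hx hy; have E := est x y hx hy.
  exists (im (g1 (mkC x y))), (re (g1 (mkC x y))), (- im (g1 (mkC x y))) => e e0.
  have [d d0 Hd] := E e e0; exists d => // x' y' h1 h2.
  by have [E1 E2] := Hd x' y' h1 h2.
exists (fun w => mkC (A (re w) (im w)) (B (re w) (im w))) => w ws.
pose G := [set v : C | cmod (v - z0) < s].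
have Gopen v : G v -> nbhs v G.
  move=> Gv; apply/nbhs_cP; exists (s - cmod (v - z0)); first by rewrite subr_gt0.
  move=> v' h; have := cmodD (v' - v) (v - z0); rewrite addrA subrK /G /=; lra.
have Gin v : G v -> (re z0 - s < re v < re z0 + s) /\ (im z0 - s < im v < im z0 + s).
  move=> Gv; have := le_lt_trans (re_le_cmod (v - z0)) Gv.
  have := le_lt_trans (im_le_cmod (v - z0)) Gv; rewrite !reimE !ltr_norml; lra.
have gcont v : G v -> {for v, continuous g}.
  move=> Gv; apply: (@cdiff_cont _ _ _ (g1 v)); apply: Hg; apply: lt_trans Gv _.
  by rewrite /s ltr_pdivrMr // ltr_pMr // ltr1n.
have key (U : R -> R -> R) (P Q : C -> R) :
   (forall v, G v -> is_derive (re v) 1 (U ^~ (im v)) (P v) /\ is_derive (im v) 1 (U (re v)) (Q v)) ->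
   (forall v, G v -> {for v, continuous P} /\ {for v, continuous Q}) ->
   oh 1 (fun h => U (re (w + h)) (im (w + h)) - U (re w) (im w) - P w * re h - Q w * im h).
  move=> HU cPQ.
  have Hdx v : G v -> dx (fun v => U (re v) (im v)) v = P v.
    by move=> /HU[h _]; apply: is_derive_derive1.
  have Hdy v : G v -> dy (fun v => U (re v) (im v)) v = Q v.
    by move=> /HU[_ h]; apply: is_derive_derive1.
  have C1 : C1_on G (fun v => U (re v) (im v)).
    move=> v Gv; have [h1 h2] := HU v Gv; have [c1 c2] := cPQ v Gv; split.
    - by have [] := h1.
    - by have [] := h2.
    - apply/cont_RP => e e0; move/cont_RP: c1 => /(_ e e0).
      apply: filterS2 (Gopen v Gv) => v' Gv' h; by rewrite !Hdx.
    - apply/cont_RP => e e0; move/cont_RP: c2 => /(_ e e0).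
      apply: filterS2 (Gopen v Gv) => v' Gv' h; by rewrite !Hdy.
  by have := C1_expansion (Gopen w ws) C1; rewrite Hdx // Hdy.
have recont v : G v -> {for v, continuous (fun v => re (g v))}.
  move=> /gcont/cont_CP H; apply/cont_RP => e /H; apply: filterS => v' h.
  by apply: le_lt_trans h; rewrite -reN -reD re_le_cmod.
have imcont v : G v -> {for v, continuous (fun v => im (g v))}.
  move=> /gcont/cont_CP H; apply/cont_RP => e /H; apply: filterS => v' h.
  by apply: le_lt_trans h; rewrite -imN -imD im_le_cmod.
have K1 : oh 1 (fun h => A (re (w + h)) (im (w + h)) - A (re w) (im w) - re (g w) * re h - - im (g w) * im h).
  apply: (key A (fun v => re (g v)) (fun v => - im (g v))) => v Gv.
    by have [h1 h2] := Gin v Gv; rewrite -{3 6}[v]mkCE; exact: HA.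
  split; first exact: recont.
  by apply: continuousN; exact: imcont.
have K2 : oh 1 (fun h => B (re (w + h)) (im (w + h)) - B (re w) (im w) - im (g w) * re h - re (g w) * im h).
  apply: (key B (fun v => im (g v)) (fun v => re (g v))) => v Gv.
    by have [h1 h2] := Gin v Gv; rewrite -{3 6}[v]mkCE; exact: HB.
  by split; [exact: imcont|exact: recont].
apply: oh_cmodP.
- by apply: oh_eq K1 => h; rewrite !reimE; ring.
- by apply: oh_eq K2 => h; rewrite !reimE; ring.
Qed.
End Holomorphic.

(** * Cauchy's estimates and the derivative of a holomorphic function *)

Section Regularity.
Variable R : realType.
Local Notation C := (CC R).
Implicit Types (z w h a b c : C) (x y e d r t : R) (g f F G H : C -> C).

Lemma cdiff_line g z a h : cdiff g z a ->
  forall (u : C), is_derive (0 : R) 1 (fun t => re (u * g (z + rc t * h))) (re (u * (a * h))).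
Proof.
move=> /cdiffP Hg u; apply/is_derive_eps => e e0.
pose K := cmod u * cmod h + 1.
have K0 : 0 < K by rewrite ltr_wpDl // mulr_ge0 ?cmod_ge0.
have [d d0 Hd] := Hg (e / K) (divr_gt0 e0 K0).
exists (d / (cmod h + 1)) => [|t td]; first by rewrite divr_gt0 // ltr_wpDl ?cmod_ge0.
have ch : cmod (rc t * h) = `|t| * cmod h by rewrite cmodM cmod_rc.
have th : cmod (rc t * h) < d.
  rewrite ch; move: td; rewrite ltr_pdivlMr ?ltr_wpDl ?cmod_ge0 // mulrDr mulr1.
  by apply: le_lt_trans; rewrite lerDl.
have := Hd _ th; rewrite ch => E.
have r0 : rc (0 : R) = 0 by [].
rewrite add0r r0 mul0r addr0.
rewrite [X in `|X|](_ : _ = re (u * (g (z + rc t * h) - g z - a * (rc t * h)))); last first.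
  by rewrite !reimE'; ring.
apply: le_trans (re_le_cmod _) _; rewrite cmodM.
apply: le_trans (ler_wpM2l (cmod_ge0 u) E) _.
have -> : cmod u * (e / K * (`|t| * cmod h)) = e * `|t| * (cmod u * cmod h / K) by ring.
by rewrite ler_piMr ?mulr_ge0 ?(ltW e0) // ler_pdivrMr // mul1r /K lerDl.
Qed.

Lemma is_derive_shift0 (f : R -> R) x l : is_derive (0 : R) 1 (fun s => f (x + s)) l ->
  is_derive x 1 f l.
Proof.
move=> /is_derive_eps H; apply/is_derive_eps => e /H[d d0 Hd]; exists d => // t td.
by have := Hd t td; rewrite add0r addr0.
Qed.

(** The real mean value inequality is applied to re (cconj u * g) along the segment,
    where u is the increment of g. *)
Lemma cmvt g (g1 : C -> C) z h (K : R) :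
  (forall t, 0 <= t <= 1 -> cdiff g (z + rc t * h) (g1 (z + rc t * h))) ->
  (forall t, 0 <= t <= 1 -> cmod (g1 (z + rc t * h)) <= K) ->
  cmod (g (z + h) - g z) <= K * cmod h.
Proof.
move=> Hg HK; pose u := g (z + h) - g z.
pose phi t := re (cconj u * g (z + rc t * h)).
pose dphi t := re (cconj u * (g1 (z + rc t * h) * h)).
have := @mvt_bound R phi dphi 0 1 (cmod u * K * cmod h) ler01.
have K0 : 0 <= K by apply: le_trans (HK 0 _); rewrite ?lexx ?ler01 // cmod_ge0.
have rc0 : rc (0 : R) = 0 by []. have rc1 : rc (1 : R) = 1 by [].
have -> : phi 1 - phi 0 = cmod u ^+ 2.
  rewrite /phi rc0 rc1 mul0r addr0 mul1r -reN -reD -mulrN -mulrDr -/u.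
  by rewrite cmod_sq !expr2 !reimE'; ring.
rewrite subr0 mulr1 [ `|_ ^+ 2| ]ger0_norm ?exprn_ge0 ?cmod_ge0 // => E.
have {}E : cmod u ^+ 2 <= cmod u * K * cmod h.
  apply: E => t ht.
  - apply: is_derive_shift0; have := cdiff_line h (Hg t ht) (cconj u).
    apply: is_derive_near; near=> s; rewrite /phi; congr re; congr (_ * g _).
    by rewrite -addrA -mulrDl; congr (_ + _ * _); apply: CP; rewrite !reimE' ?addr0.
  - apply: le_trans (re_le_cmod _) _; rewrite !cmodM cmod_conj -mulrA.
    by rewrite ler_wpM2l ?cmod_ge0 // ler_wpM2r ?cmod_ge0 // HK.
have [u0|u0] := eqVneq u 0; first by rewrite -/u u0 cmod0 mulr_ge0 ?cmod_ge0.
by move: E; rewrite expr2 -mulrA ler_pM2l // cmod_gt0.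
Unshelve. all: by end_near. Qed.

Lemma segment_in z h t : 0 <= t <= 1 -> cmod (rc t * h) <= cmod h.
Proof.
by move=> /andP[t0 t1]; rewrite cmodM cmod_rc ger0_norm // ler_piMl ?cmod_ge0.
Qed.

Lemma cdiff_quad z c (a b : C) w :
  cdiff (fun v => a + b * (v - z) + c * (v - z) ^+ 2) w (b + 2 * c * (w - z)).
Proof.
apply: Oh_oh; apply: Oh_le (Oh_cmodM c 2); apply: nearC => h.
rewrite [X in `|cmod X| <= _](_ : _ = c * h ^+ 2) //; ring.
Qed.

(** The mean value inequality for F minus its quadratic polynomial. *)
Lemma hjet_of_cdiff F f z c : (\forall w \near z, cdiff F w (f w)) -> cdiff f z c ->
  hjet F z (f z) (c / 2).
Proof.
move=> /near_shift/nbhs_cP[d d0 Hd] /cdiffP Hf e e0.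
have [d' d'0 Hd'] := Hf e e0; near=> h.
have hd : cmod h < d by near: h; exact: near_cball0.
have hd' : cmod h < d' by near: h; exact: near_cball0.
pose G v := F v + - (0 + f z * (v - z) + c / 2 * (v - z) ^+ 2).
have := @cmvt G (fun v => f v + - (f z + 2 * (c / 2) * (v - z))) z h (e * cmod h).
rewrite {1}(_ : G (z + h) - G z = F (z + h) - F z - f z * h - c / 2 * h ^+ 2); last first.
  by rewrite /G; ring.
have E : e * cmod h ^+ 2 = e * cmod h * cmod h by rewrite expr2 mulrA.
rewrite ger0_norm ?cmod_ge0 // E; apply => t ht.
- apply: cdiffD; last by apply: cdiffN; exact: cdiff_quad.
  by apply: Hd; rewrite subr0; exact: le_lt_trans (segment_in z h ht) hd.
- have h1 := le_lt_trans (segment_in z h ht) hd'.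
  have h2 := Hd' _ h1; rewrite [X in cmod X](_ : _ = f (z + rc t * h) - f z - c * (rc t * h)).
    by apply: le_trans h2 _; rewrite ler_wpM2l ?(ltW e0) // segment_in.
  have two : (2 : C) != 0 by rewrite pnatr_eq0.
  by field.
Unshelve. all: by end_near. Qed.

Lemma hjetM g f z a b a' b' : hjet g z a b -> hjet f z a' b' ->
  hjet (fun w => g w * f w) z (a * f z + g z * a') (b * f z + a * a' + g z * b').
Proof.
move=> Hg Hf.
have Of : Oh 1 (fun h => cmod (f (z + h) - f z)) := cdiff_Oh (hjet_cdiff Hf).
have H1 : oh 2 (fun h => cmod (f (z + h) * (g (z + h) - g z - a * h - b * h ^+ 2))).
  have B : Oh 0 (fun h => cmod (f (z + h))).
    have := Oh_cD (OhS Of) (Oh_ccst (f z)); apply: Oh_eq => h; by rewrite subrK.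
  by have := oh_cM Hg B; apply: oh_ceq => h; rewrite mulrC.
have H2 := oh_cZ (g z) Hf.
have H3 : oh 2 (fun h => cmod ((f (z + h) - f z - a' * h) * (a * h ^+ 1))).
  exact: oh_cM (hjet_cdiff Hf) (Oh_cmodM a 1).
have H4 : oh 2 (fun h => cmod ((f (z + h) - f z) * (b * h ^+ 2))).
  by apply: Oh_oh; exact: Oh_cM Of (Oh_cmodM b 2).
apply: oh_ceq (oh_cD (oh_cD H1 H2) (oh_cD H3 H4)) => h.
rewrite expr1; ring.
Qed.

Lemma hjet_inv z : z != 0 -> hjet (fun w => w^-1) z (- z ^- 2) (z ^- 3).
Proof.
move=> z0; apply: Oh_oh; exists (2 / cmod z ^+ 4); first by rewrite divr_gt0 ?exprn_gt0 ?cmod_gt0.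
near=> h.
have hz : cmod h < cmod z / 2 by near: h; apply: near_cball0; rewrite divr_gt0 // cmod_gt0.
have zh : cmod z / 2 <= cmod (z + h).
  have := cmodD (z + h) (- h); rewrite addrK cmodN; lra.
have cz : 0 < cmod z by rewrite cmod_gt0.
have zh0 : z + h != 0 by rewrite -cmod_gt0; apply: lt_le_trans zh; rewrite divr_gt0.
rewrite ger0_norm ?cmod_ge0 //.
have -> : (z + h)^-1 - z^-1 - - z ^- 2 * h - z ^- 3 * h ^+ 2 = - (h ^+ 3 * (z ^+ 3)^-1 * (z + h)^-1).
  by field; rewrite z0 zh0.
have ab : (cmod z ^+ 3)^-1 * (cmod (z + h))^-1 <= 2 / cmod z ^+ 4.
  have -> : 2 / cmod z ^+ 4 = (cmod z ^+ 3)^-1 * (cmod z / 2)^-1.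
    by field; exact: lt0r_neq0.
  rewrite ler_wpM2l ?invr_ge0 ?exprn_ge0 ?cmod_ge0 // lef_pV2 ?posrE ?divr_gt0 //.
  by rewrite cmod_gt0.
rewrite cmodN cmodM cmodM !cmodV !cmodX -mulrA [X in _ <= X]mulrC.
by rewrite ler_wpM2l // exprn_ge0 ?cmod_ge0.
Unshelve. all: by end_near. Qed.

Lemma hjet_shift g z k a b : hjet g (z + k) a b -> hjet (fun w => g (w + k)) z a b.
Proof. by apply: oh_ceq => h; rewrite [z + h + k]addrAC. Qed.

Lemma hjet_invn z0 k z : z != z0 -> exists a b, hjet (fun w => (w - z0) ^- k) z a b.
Proof.
move=> zz; elim: k => [|k [a [b IH]]].
  exists 0, 0; apply: oh_ceq (@oh_ceq _ 2 (fun=> 0) (fun=> 0) _ _) => [h|//|]; last first.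
    by apply: oh_eq (@oh0 _ 2) => h; rewrite cmod0.
  by rewrite !expr0; ring.
have I : hjet (fun w => (w - z0)^-1) z (- (z - z0) ^- 2) ((z - z0) ^- 3).
  by apply: (hjet_shift (g := fun w => w^-1)); apply: hjet_inv; rewrite subr_eq0.
do 2 eexists; have := hjetM IH I; apply: hjet_near; apply: nearC => w.
by rewrite exprSr invfM.
Qed.

(** ln |w - z0| is half the logarithm of |w - z0|^2; it is harmonic. *)
Lemma jet_lnmod z0 z : z != z0 ->
  exists2 al, exists be, jet (fun w => ln (cmod (w - z0))) z al be 0
            & cmod al ^+ 2 = (cmod (z - z0) ^+ 2)^-1.
Proof.
move=> zz; have m0 : 0 < cmod (z - z0) by rewrite cmod_gt0 subr_eq0.
have m2 : 0 < cmod (z - z0) ^+ 2 by rewrite exprn_gt0.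
have J := jetZ (2^-1) (jet_phi (rjet_ln m2) (jet_sqmod z0 z)).
exists (rc 2^-1 * (rc (cmod (z - z0) ^+ 2)^-1 * (rc 2 * cconj (z - z0)))); last first.
  rewrite cmodM exprMn cmodM exprMn cmod_2conj !cmod_rc.
  rewrite !ger0_norm ?invr_ge0 ?(ltW m2) //; field; exact: lt0r_neq0.
eexists; move: J.
rewrite [X in jet _ _ _ _ X -> _](_ : _ = 0); last first.
  rewrite cmod_2conj; move: (cmod _ ^+ 2) m2 => N N0; field; exact: lt0r_neq0.
apply: jet_near; near=> w.
have w0 : 0 < cmod (w - z0).
  by near: w; exact: (near_gt_cont (@cmod_cont _ z0 z) m0).
by rewrite lnXn // -[ln _ *+ 2]mulr_natl mulKf.
Unshelve. all: by end_near. Qed.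

(** For e > 0 the function |H|^2 + e ln |w - z0| + e |w - z0|^2 has a positive
    Laplacian, hence no interior maximum, and tends to -oo at z0, so that only the
    outer circle counts; then e tends to 0. *)
Lemma max_modulus_punctured H z0 (rho B M0 d : R) : 0 < rho -> 0 <= B -> 0 < d ->
  (forall w, 0 < cmod (w - z0) <= rho -> exists a b, hjet H w a b) ->
  (forall w, 0 < cmod (w - z0) < d -> cmod (H w) <= M0) ->
  (forall w, cmod (w - z0) = rho -> cmod (H w) <= B) ->
  forall w, 0 < cmod (w - z0) <= rho -> cmod (H w) <= B.
Proof.
move=> rho0 B0 d0 HH Hd HB w1 /andP[w10 w1r].
suff key e : 0 < e -> cmod (H w1) ^+ 2 <= B ^+ 2 + e * (ln rho - ln (cmod (w1 - z0)) + rho ^+ 2).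
  rewrite -(ler_pXn2r (n := 2)) ?nnegrE ?cmod_ge0 //.
  pose L := ln rho - ln (cmod (w1 - z0)) + rho ^+ 2.
  have L0 : 0 < L.
    by rewrite /L ltr_wpDl ?exprn_gt0 // subr_ge0 ler_ln ?posrE.
  apply/ler_addgt0Pr => e e0; have := key (e / L) (divr_gt0 e0 L0).
  by rewrite -/L divfK ?gt_eqF.
move=> e0; rewrite leNgt; apply/negP => viol.
pose T w := cmod (H w - 0) ^+ 2 + (e * ln (cmod (w - z0)) + e * cmod (w - z0) ^+ 2).
pose c0 := B ^+ 2 + e * (ln rho + rho ^+ 2).
have T1 : c0 < T w1.
  rewrite /c0 /T subr0; have : 0 <= e * cmod (w1 - z0) ^+ 2.
    by rewrite mulr_ge0 ?(ltW e0) // exprn_ge0 ?cmod_ge0.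
  move: viol; rewrite !mulrDr mulrN; lra.
pose tau := Num.min (cmod (w1 - z0)) (Num.min (d / 2) (rho * expR (- (M0 ^+ 2 / e + 1)))).
have tau0 : 0 < tau by rewrite !lt_min w10 divr_gt0 // mulr_gt0 ?expR_gt0.
have [tau1 [tau2 tau3]] : tau <= cmod (w1 - z0) /\ tau <= d / 2 /\ tau <= rho * expR (- (M0 ^+ 2 / e + 1)).
  by rewrite /tau !ge_min !lexx !orbT.
pose K := [set w : C | tau <= cmod (w - z0) <= rho].
have Kin w : K w -> 0 < cmod (w - z0) <= rho.
  by move=> /andP[k1 k2]; rewrite (lt_le_trans tau0 k1).
have Tjet w : K w -> exists al be a, jet T w al be (cmod a ^+ 2 + e).
  move=> /Kin/[dup] wr /andP[w0 _]; have [a [b Hj]] := HH w wr.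
  have wz : w != z0 by rewrite -subr_eq0 -cmod_gt0.
  have J1 := jet_comp Hj (jet_sqmod 0 (H w)).
  have [al [be J2] _] := jet_lnmod wz.
  have J3 := jetD J1 (jetD (jetZ e J2) (jetZ e (jet_sqmod z0 w))).
  rewrite (_ : 1 * cmod a ^+ 2 + (e * 0 + e * 1) = cmod a ^+ 2 + e) in J3; last by ring.
  do 3 eexists; exact: J3.
have cT w : K w -> {for w, continuous T}.
  move=> /Tjet[al [be [a /jet_Oh[M M00 HM]]]]; apply/cont_RP => x x0; apply/near_shift.
  have := near_cball0 (divr_gt0 x0 M00); apply: filterS2 HM => h h1 h2.
  by apply: le_lt_trans h1 _; rewrite expr1 mulrC -ltr_pdivlMr.
have [c Kc Hc] : exists2 c, K c & forall z, K z -> T z <= T c.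
  apply: (@evt_max R K (rho + cmod z0)) => //.
  - by exists w1; rewrite /K /= tau1.
  - exact: closed_annulus.
  - by move=> z; exact: annulus_bound.
have Kw1 : K w1 by rewrite /K /= tau1.
have Tc : c0 < T c by apply: lt_le_trans T1 (Hc _ Kw1).
have /andP[c1 c2] := Kc.
have c2' : cmod (c - z0) < rho.
  rewrite lt_neqAle c2 andbT; apply/eqP => E; move: Tc; rewrite ltNge => /negP; apply.
  rewrite /T /c0 E subr0 mulrDr lerD2r; by rewrite lerXn2r ?nnegrE ?cmod_ge0 // HB.
have c1' : tau < cmod (c - z0).
  rewrite lt_neqAle c1 andbT; apply/eqP => E; move: Tc; rewrite ltNge => /negP; apply.
  rewrite /T -E subr0.
  have HM : cmod (H c) ^+ 2 <= M0 ^+ 2.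
    have h : cmod (H c) <= M0.
      by apply: Hd; rewrite -E tau0 /=; apply: le_lt_trans tau2 _; rewrite ltr_pdivrMr // ltr_pMr // ltr1n.
    by rewrite lerXn2r ?nnegrE ?cmod_ge0 // (le_trans (cmod_ge0 _) h).
  have lt : e * ln tau <= e * ln rho - M0 ^+ 2 - e.
    have : ln tau <= ln rho - (M0 ^+ 2 / e + 1).
      have -> : ln rho - (M0 ^+ 2 / e + 1) = ln (rho * expR (- (M0 ^+ 2 / e + 1))).
        by rewrite lnM ?posrE ?expR_gt0 // expRK.
      by rewrite ler_ln ?posrE // mulr_gt0 ?expR_gt0.
    move=> /(ler_wpM2l (ltW e0)) h; apply: le_trans h _.
    by rewrite le_eqVlt; apply/orP; left; apply/eqP; field; exact: lt0r_neq0.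
  have tt : e * tau ^+ 2 <= e * rho ^+ 2.
    rewrite ler_wpM2l ?(ltW e0) // lerXn2r ?nnegrE ?(ltW tau0) ?(ltW rho0) //.
    by rewrite E.
  have B2 : 0 <= B ^+ 2 by rewrite exprn_ge0.
  rewrite /c0 mulrDr; lra.
have [al [be [a J]]] := Tjet c Kc.
have : cmod a ^+ 2 + e <= 0.
  apply: jet_max J; near=> w; apply: Hc; rewrite /K /=.
  apply/andP; split; apply: ltW.
    by near: w; exact: (near_gt_cont (@cmod_cont _ z0 c) c1').
  by near: w; exact: (near_lt_cont (@cmod_cont _ z0 c) c2').
by have := exprn_ge0 2 (cmod_ge0 a); lra.
Unshelve. all: by end_near. Qed.
(** Schwarz's lemma: the maximum principle for G / (w - z0)^k, whose value at z0 is c. *)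
Lemma schwarz_coef G z0 k (c : C) (rho B : R) : 0 < rho -> 0 <= B ->
  (forall w, 0 < cmod (w - z0) <= rho -> exists a b, hjet G w a b) ->
  (forall w, cmod (w - z0) = rho -> cmod (G w) <= B) ->
  oh k (fun h => cmod (G (z0 + h) - c * h ^+ k)) -> cmod c <= B / rho ^+ k.
Proof.
move=> rho0 B0 HG HB Hc; pose H w := G w * (w - z0) ^- k.
have Hlim e : 0 < e -> exists2 d, 0 < d & forall w, 0 < cmod (w - z0) < d -> cmod (H w - c) <= e.
  move=> e0; have /nbhs_cP[d d0 Hd] := Hc e e0; exists d => // w /andP[w0 wd].
  have := Hd (w - z0); rewrite subr0 subrKC => /(_ wd); rewrite ger0_norm ?cmod_ge0 //.
  have wz : (w - z0) ^+ k != 0 by rewrite expf_neq0 // -cmod_gt0.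
  have -> : G w - c * (w - z0) ^+ k = (H w - c) * (w - z0) ^+ k by rewrite /H mulrBl divfK.
  by rewrite cmodM cmodX ler_pM2r // exprn_gt0.
have HB' : forall w, 0 < cmod (w - z0) <= rho -> cmod (H w) <= B / rho ^+ k.
  have [d d0 Hd] := Hlim 1 ltr01.
  apply: (@max_modulus_punctured H z0 rho (B / rho ^+ k) (cmod c + 1) d) => //.
  - by rewrite divr_ge0 // exprn_ge0 // ltW.
  - move=> w w0; have [a [b Hab]] := HG w w0.
    have wz : w != z0 by rewrite -subr_eq0 -cmod_gt0; case/andP: w0.
    have [a' [b' Hab']] := hjet_invn k wz.
    by do 2 eexists; exact: hjetM Hab Hab'.
  - move=> w /Hd; have := cmodD (H w - c) c; rewrite subrK; lra.
  - move=> w wr; rewrite /H cmodM cmodV cmodX wr ler_wpM2r ?HB //.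
    by rewrite invr_ge0 exprn_ge0 // ltW.
apply/ler_addgt0Pr => e e0; have [d d0 Hd] := Hlim e e0.
pose m := Num.min (d / 2) rho; have m0 : 0 < m by rewrite lt_min divr_gt0.
have [m1 m2] : m <= d / 2 /\ m <= rho by rewrite !ge_min !lexx orbT.
pose w := z0 + rc m.
have wm : cmod (w - z0) = m by rewrite /w addrAC subrr add0r cmod_rc gtr0_norm.
have h1 : cmod (H w) <= B / rho ^+ k by apply: HB'; rewrite wm m0.
have h2 : cmod (H w - c) <= e by apply: Hd; rewrite wm m0 /=; lra.
have := cmodD (H w) (c - H w); rewrite subrKC => /le_trans; apply.
by rewrite cmodB in h2; rewrite lerD.
Qed.

(** Schwarz's lemma for F - F(z0), and then for F - F(z0) - f(z0) (w - z0), where the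
    linear term is bounded by the first estimate. *)
Lemma cauchy_estimates F f f1 z0 (rho r M : R) : 0 < rho -> rho < r ->
  (forall w, cmod (w - z0) < r -> cdiff F w (f w) /\ cdiff f w (f1 w)) ->
  (forall w, cmod (w - z0) < r -> cmod (F w) <= M) ->
  cmod (f z0) <= 2 * M / rho /\ cmod (f1 z0) <= 8 * M / rho ^+ 2.
Proof.
move=> rho0 rr Hd HM.
have z0r : cmod (z0 - z0) < r by rewrite subrr cmod0 (lt_trans rho0).
have M0 : 0 <= M by apply: le_trans (cmod_ge0 _) (HM z0 z0r).
have HJ w : cmod (w - z0) < r -> hjet F w (f w) (f1 w / 2).
  move=> wr; have [_ h2] := Hd w wr; apply: hjet_of_cdiff => //.
  apply: filterS (near_lt_cont (@cmod_cont _ z0 w) wr) => v vr.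
  by have [] := Hd v vr.
have Hq (a b : C) w : hjet (fun v => a + b * (v - z0)) w b 0.
  apply: (@oh_eq _ _ _ (fun=> 0)) => [h|]; last exact: oh0.
  by rewrite [X in cmod X](_ : _ = 0) ?cmod0 //; ring.
have hjetD' (p q : C -> C) w a b a' b' : hjet p w a b -> hjet q w a' b' ->
    hjet (fun v => p v + q v) w (a + a') (b + b').
  by move=> Hp Hq'; apply: oh_ceq (oh_cD Hp Hq') => h; ring.
have E1 : cmod (f z0) <= 2 * M / rho.
  have := @schwarz_coef (fun w => F w + (- F z0 + 0 * (w - z0))) z0 1 (f z0) rho (2 * M) rho0.
  rewrite expr1; apply; first by rewrite mulr_ge0.
  - move=> w /andP[_ wr]; do 2 eexists; apply: hjetD' (HJ w _) (Hq _ _ w).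
    exact: le_lt_trans wr rr.
  - move=> w wr; rewrite mul0r addr0; apply: le_trans (cmodD _ _) _.
    rewrite cmodN mulr_natl mulr2n lerD ?HM // wr //.
  - have := hjet_cdiff (HJ z0 z0r); apply: oh_ceq => h; ring.
split => //.
have := @schwarz_coef (fun w => F w + (- F z0 + - f z0 * (w - z0))) z0 2 (f1 z0 / 2) rho (4 * M) rho0.
have -> : cmod (f1 z0 / 2) = cmod (f1 z0) / 2.
  have -> : (2 : C) = rc 2 by apply: CP; rewrite mulr2n !reimE' ?addr0.
  by rewrite cmodM cmodV cmod_rc ger0_norm.
move=> E; have {}E : cmod (f1 z0) / 2 <= 4 * M / rho ^+ 2.
  apply: E; first by rewrite mulr_ge0.
  - move=> w /andP[_ wr]; do 2 eexists; apply: hjetD' (HJ w _) (Hq _ _ w).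
    exact: le_lt_trans wr rr.
  - move=> w wr; apply: le_trans (cmodD _ _) _.
    have h1 : cmod (F w) <= M by apply: HM; rewrite wr.
    have h2 := cmodD (- F z0) (- f z0 * (w - z0)); rewrite cmodN cmodM cmodN wr in h2.
    have h3 := HM z0 z0r.
    have h4 : cmod (f z0) * rho <= 2 * M by rewrite -ler_pdivlMr.
    lra.
  - have := HJ z0 z0r; apply: oh_ceq => h; ring.
have -> : 8 * M / rho ^+ 2 = 4 * M / rho ^+ 2 * 2 by ring.
by rewrite -ler_pdivrMr.
Qed.
End Regularity.

Section Regularity2.
Variable R : realType.
Local Notation C := (CC R).
Implicit Types (z w h a b c : C) (x y e d r t : R) (g f F G H : C -> C).

Lemma cauchy_limit (D : C -> C) :
  (forall e, 0 < e -> exists2 d, 0 < d & forall k l, 0 < cmod k < d -> 0 < cmod l < d ->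
     cmod (D k - D l) <= e) ->
  exists c, forall e, 0 < e -> exists2 d, 0 < d & forall k, 0 < cmod k < d -> cmod (D k - c) <= e.
Proof.
move=> HD.
pose s n : C := rc n.+1%:R^-1.
have s0 n : 0 < cmod (s n) by rewrite cmod_rc gtr0_norm ?invr_gt0 // ltr0n.
have sd d : 0 < d -> \forall n \near \oo, cmod (s n) < d.
  move=> d0; near=> n; rewrite cmod_rc gtr0_norm ?invr_gt0 ?ltr0n //.
  by near: n; exact: near_infty_natSinv_lt (PosNum d0).
have lim (p : C -> R) : (forall u v, `|p u - p v| <= cmod (u - v)) ->
    exists l : R, p (D (s n)) @[n --> \oo] --> l.
  move=> Hp; apply/cvg_ex; apply/cauchy_cvgP; apply/cauchy_exP => e e0.
  have e2 : 0 < e / 2 by rewrite divr_gt0.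
  have [d d0 Hd] := HD _ e2.
  have [N _ HN] := sd d d0.
  exists (p (D (s N))); rewrite /fmap /=; exists N => // n /= Nn.
  rewrite /ball /=; apply: le_lt_trans (Hp _ _) _.
  apply: le_lt_trans (Hd _ _ _ _) _; rewrite ?s0 ?HN //=.
  by rewrite ltr_pdivrMr // ltr_pMr // ltr1n.
have [l1 H1] := lim (@re R) ltac:(by move=> u v; rewrite -reN -reD; exact: re_le_cmod).
have [l2 H2] := lim (@im R) ltac:(by move=> u v; rewrite -imN -imD; exact: im_le_cmod).
exists (mkC l1 l2) => e e0; have e3 : 0 < e / 3 by rewrite divr_gt0.
have [d d0 Hd] := HD _ e3; exists d => // k kd.
have [n [n1 n2 n3]] : exists n, [/\ cmod (s n) < d, `|l1 - re (D (s n))| < e / 3 & `|l2 - im (D (s n))| < e / 3].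
  have A := sd d d0.
  move/cvgrPdist_lt: H1 => /(_ _ e3) A1; move/cvgrPdist_lt: H2 => /(_ _ e3) A2.
  have [N _ HN] := filterI A (filterI A1 A2).
  by exists N; have [a1 [a2 a3]] := HN N (leqnn N).
have h1 : cmod (D k - D (s n)) <= e / 3 by apply: Hd; rewrite ?s0.
have h2 : cmod (D (s n) - mkC l1 l2) <= `|l1 - re (D (s n))| + `|l2 - im (D (s n))|.
  by apply: le_trans (cmod_le_reim _) _; rewrite !reimE ![`|_ - l1|]distrC ![`|_ - l2|]distrC.
have := cmodD (D k - D (s n)) (D (s n) - mkC l1 l2).
rewrite addrA subrK; lra.
Unshelve. all: by end_near. Qed.

(** The derivative of a holomorphic function is holomorphic. Difference quotients
    of a primitive F converge uniformly, hence by Cauchy's estimates so do their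
    second derivatives, which are the difference quotients of F''. *)
Lemma holomorphic_deriv g (g1 : C -> C) z0 r : 0 < r ->
  (forall w, cmod (w - z0) < r -> cdiff g w (g1 w)) -> exists c, cdiff g1 z0 c.
Proof.
move=> r0 Hg; have [F HF] := primitive r0 Hg.
pose rho := r / 12; have rho0 : 0 < rho by rewrite divr_gt0.
have r12 : r = 12 * rho by rewrite /rho; field.
have tri u v w : cmod (u - w) <= cmod (u - v) + cmod (v - w).
  by have := cmodD (u - v) (v - w); rewrite addrA subrK.
have HA w : cmod (w - z0) < 4 * rho -> cdiff F w (g w) /\ cdiff g w (g1 w).
  by move=> h; split; [apply: HF|apply: Hg]; rewrite r12; lra.
have [M HM] : exists M, forall w, cmod (w - z0) <= 3 * rho -> cmod (F w) <= M.
  have [||||c _ Hc] := @evt_max R [set w | 0 <= cmod (w - z0) <= 3 * rho] (3 * rho + cmod z0) (fun w => cmod (F w)).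
  - by exists z0; rewrite /= subrr cmod0 lexx mulr_ge0 ?(ltW rho0).
  - exact: closed_annulus.
  - by move=> z; exact: annulus_bound.
  - move=> z /andP[_ zr]; have [h _] := HA z ltac:(lra).
    have /cont_CP cF := cdiff_cont h; apply/cont_RP => e /cF; apply: filterS => w.
    by apply: le_lt_trans; exact: cmod_distB.
  - by exists (cmod (F c)) => w wr; apply: Hc; rewrite /= cmod_ge0.
have M0 : 0 <= M by apply: le_trans (cmod_ge0 (F z0)) (HM z0 _); rewrite subrr cmod0 mulr_ge0 ?ltW.
pose C1 := 8 * M / (rho / 2) ^+ 2.
have rho2 : 0 < rho / 2 by rewrite divr_gt0.
have rhor : rho / 2 < rho by rewrite ltr_pdivrMr // ltr_pMr // ltr1n.
have g1b w : cmod (w - z0) < 2 * rho -> cmod (g1 w) <= C1.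
  move=> wr; have [||_] := @cauchy_estimates R F g g1 w (rho / 2) rho M rho2 rhor.
  - by move=> v vr; apply: HA; have := tri v w z0; lra.
  - by move=> v vr; apply: HM; have := tri v w z0; lra.
  - exact.
have seg w h t : 0 <= t <= 1 -> cmod h < rho -> cmod (w - z0) < rho -> cmod (w + rc t * h - z0) < 2 * rho.
  move=> t01 hr wr; have := tri (w + rc t * h) w z0.
  rewrite [w + _ - w]addrAC subrr add0r; have := segment_in w h t01; lra.
have glip w h : cmod (w - z0) < rho -> cmod h < rho -> cmod (g (w + h) - g w) <= C1 * cmod h.
  move=> wr hr; apply: (@cmvt _ g g1) => t t01.
  - by have [] := HA (w + rc t * h) ltac:(have := seg w h t t01 hr wr; lra).
  - exact/g1b/seg.
have Flip w h : cmod (w - z0) < rho -> cmod h < rho ->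
    cmod (F (w + h) - F w - g w * h) <= C1 * cmod h ^+ 2.
  move=> wr hr; pose G v := F v + - (g w * v).
  have := @cmvt R G (fun v => g v + - (g w * 1)) w h (C1 * cmod h).
  rewrite /G (_ : F (w + h) - g w * (w + h) - (F w - g w * w) = F (w + h) - F w - g w * h); last by ring.
  rewrite expr2 mulrA; apply => t t01.
  - apply: cdiffD; last by apply: cdiffN; apply: cdiffZ; exact: cdiff_id.
    by have [] := HA (w + rc t * h) ltac:(have := seg w h t t01 hr wr; lra).
  - rewrite mulr1; apply: le_trans (glip _ _ wr _) _.
      exact: le_lt_trans (segment_in w h t01) hr.
    rewrite ler_wpM2l ?(segment_in w h t01) //.
    by rewrite divr_ge0 ?mulr_ge0 ?exprn_ge0 // ltW.
pose q k w := k^-1 * (F (w + k) - F w).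
pose q1 k w := k^-1 * (g (w + k) - g w).
pose q2 k w := k^-1 * (g1 (w + k) - g1 w).
have qd k w : cmod k < rho -> cmod (w - z0) < rho -> cdiff (q k) w (q1 k w) /\ cdiff (q1 k) w (q2 k w).
  move=> kr wr; have h1 : cmod (w + k - z0) < 4 * rho.
    by have := tri (w + k) w z0; rewrite [w + k - w]addrAC subrr add0r; lra.
  have [f1 f2] := HA _ h1; have [f3 f4] := HA w ltac:(lra).
  by split; apply/cdiffZ/cdiffD; [exact: cdiff_shift|exact: cdiffN|exact: cdiff_shift|exact: cdiffN].
have qg k w : 0 < cmod k < rho -> cmod (w - z0) < rho -> cmod (q k w - g w) <= C1 * cmod k.
  move=> /andP[k0 kr] wr; have k0' : k != 0 by rewrite -cmod_gt0.
  rewrite (_ : q k w - g w = (F (w + k) - F w - g w * k) / k); last by rewrite /q; field.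
  by rewrite cmodM cmodV ler_pdivrMr // -mulrA -expr2 Flip.
have [c Hc] : exists c, forall e, 0 < e -> exists2 d, 0 < d & forall k, 0 < cmod k < d -> cmod (q2 k z0 - c) <= e.
  apply: cauchy_limit => e e0.
  pose C2 := 8 * C1 / (rho / 2) ^+ 2.
  have C10 : 0 <= C1 by rewrite divr_ge0 ?mulr_ge0 ?exprn_ge0 // ltW.
  have C2ge : 0 <= C2.
    have r2 : 0 <= (rho / 2) ^+ 2 by rewrite exprn_ge0 // ltW.
    by apply: divr_ge0 => //; apply: mulr_ge0.
  have C20 : 0 < 2 * (C2 + 1) by rewrite mulr_gt0 // ltr_wpDl.
  exists (Num.min rho (e / (2 * (C2 + 1)))) => [|k l]; first by rewrite lt_min rho0 divr_gt0.
  rewrite !lt_min => /andP[k0 /andP[kr ke]] /andP[l0 /andP[lr le]].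
  have z00 : cmod (z0 - z0) < rho by rewrite subrr cmod0.
  have [||_] := @cauchy_estimates R (fun w => q k w + - q l w) (fun w => q1 k w + - q1 l w)
     (fun w => q2 k w + - q2 l w) z0 (rho / 2) rho (C1 * (cmod k + cmod l)) rho2 rhor.
  - move=> w wr; have [a1 a2] := qd k w kr wr; have [b1 b2] := qd l w lr wr.
    by split; apply: cdiffD => //; exact: cdiffN.
  - move=> w wr; have h1 := qg k w; have h2 := qg l w; rewrite k0 kr in h1; rewrite l0 lr in h2.
    have := tri (q k w) (g w) (q l w); rewrite [cmod (g w - _)]cmodB.
    by have {}h1 := h1 isT wr; have {}h2 := h2 isT wr; lra.
  - move=> h; apply: le_trans h _.
    have -> : 8 * (C1 * (cmod k + cmod l)) / (rho / 2) ^+ 2 = C2 * (cmod k + cmod l).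
      by rewrite /C2; ring.
    move: ke le; rewrite !ltr_pdivlMr // => ke le.
    have := cmod_ge0 k; have := cmod_ge0 l.
    have -> : e = e / 2 + e / 2 by field.
    lra.
exists c; apply/cdiffP => e e0; have [d d0 Hd] := Hc e e0.
exists d => // h hd; have [->|h0] := eqVneq h 0.
  by rewrite addr0 subrr mulr0 subrr cmod0 mulr0.
have h0' : 0 < cmod h by rewrite cmod_gt0.
have := Hd h; rewrite h0' hd => /(_ isT) E.
rewrite (_ : g1 (z0 + h) - g1 z0 - c * h = (q2 h z0 - c) * h); last by rewrite /q2; field.
by rewrite cmodM ler_wpM2r ?cmod_ge0.
Qed.
End Regularity2.

(** * Punctured neighbourhoods of an isolated boundary point *)

Section Sphere.
Variable R : realType.
Local Notation C := (CC R).
Local Notation S2 := (sphere R).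
Implicit Types (z w a : C) (p q : S2) (A W : set S2) (K M : R).

Lemma nbhs_ptP z A : nbhs (pt z : S2) A <-> \forall w \near z, A (pt w).
Proof. by []. Qed.

Lemma compact_bounded_C (K : set C) : compact K -> exists M : R, forall z, K z -> cmod z <= M.
Proof.
move=> cK; have [->|/set0P K0] := eqVneq K set0; first by exists 0.
have [] := compact_EVT_max K0 cK (f := fun z => cmod (z - 0)).
  by apply: continuous_subspaceT; exact: cmod_cont.
move=> c _ H; exists (cmod (c - 0)) => z Kz; rewrite -[z]subr0.
by apply: H; rewrite inE.
Qed.

Lemma nbhs_inftyP A : nbhs (infty : S2) A <->
  A infty /\ exists M : R, forall z, M < cmod z -> A (pt z).
Proof.
split.
- move=> [K [cK clK] HA]; split; first by apply: HA; right.
  have [M HM] := compact_bounded_C cK; exists M => z Mz; apply: HA; left.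
  by exists z => // /HM; rewrite leNgt Mz.
- move=> [Ai [M HM]]; exists [set z : C | 0 <= cmod (z - 0) <= M].
    split; last exact: closed_annulus.
    apply: (@compact_C R _ (M + cmod (0 : C))); first exact: closed_annulus.
    by move=> z; exact: annulus_bound.
  move=> q [[z nz <-]|-> //]; apply: HM; rewrite ltNge; apply/negP => zM.
  by apply: nz; rewrite /= subr0 cmod_ge0.
Qed.

Definition ctr p : C := if p is Some a then a else 0.
(** Near [p] the coordinate is z - p, or z itself when p is infinity. The function
    [ell p] is harmonic off the centre and tends to +oo at [p]. *)
Definition ell p z : R := if p is Some _ then - ln (cmod (z - ctr p)) else ln (cmod (z - ctr p)).
Definition cusp p K : set S2 := [set q | exists z, [/\ q = pt z, z != ctr p & K <= ell p z]].

Lemma dist_ctr_gt0 p z : (0 < cmod (z - ctr p)) = (z != ctr p).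
Proof. by rewrite cmod_gt0 subr_eq0. Qed.

Lemma ell_jet p z : z != ctr p -> exists2 al, exists be, jet (ell p) z al be 0
   & cmod al ^+ 2 = (cmod (z - ctr p) ^+ 2)^-1.
Proof.
move=> /jet_lnmod[al [be J] E].
case: p => [a|] in J E *; last by exists al => //; exists be.
exists (rc (-1) * al); last by rewrite cmodM cmod_rc normrN1 mul1r.
exists (rc (-1) * be); have := jetZ (-1) J; rewrite mulr0.
by apply: jet_near; apply: nearC => w; rewrite mulN1r.
Qed.

Lemma jet_cont (u : C -> R) z al be ga : jet u z al be ga -> {for z, continuous u}.
Proof.
move=> /jet_Oh[M M0 HM]; apply/cont_RP => e e0; apply/near_shift.
have := near_cball0 (divr_gt0 e0 M0); apply: filterS2 HM => h h1 h2.
by apply: le_lt_trans h1 _; rewrite expr1 mulrC -ltr_pdivlMr.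
Qed.

Lemma ell_cont p z : z != ctr p -> {for z, continuous (ell p)}.
Proof. by move=> /ell_jet[al [be J] _]; exact: jet_cont J. Qed.

Lemma near_neq z a : z != a -> \forall w \near z, w != a.
Proof.
rewrite -subr_eq0 -cmod_gt0 => h.
by apply: filterS (near_gt_cont (@cmod_cont _ a z) h) => w; rewrite cmod_gt0 subr_eq0.
Qed.

Lemma nbhs_cusp p A : nbhs p A -> exists K, forall z, z != ctr p -> K < ell p z -> A (pt z).
Proof.
case: p => [a /nbhs_cP[d d0 Hd]|/nbhs_inftyP[_ [M HM]]].
- exists (- ln d) => z za; rewrite ltrN2 ltr_ln ?posrE ?dist_ctr_gt0 //; exact: Hd.
- exists (ln (Num.max M 1)) => z z0.
  rewrite /ell ltr_ln ?posrE ?dist_ctr_gt0 ?lt_max ?ltr01 ?orbT //= subr0 gt_max => /andP[Mz _].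
  exact: HM.
Qed.

Lemma cusp_nbhs p K : nbhs p [set q | q = p \/ cusp p K q].
Proof.
case: p => [a|].
- apply/nbhs_cP; exists (expR (- K)); first exact: expR_gt0.
  move=> z zd /=; have [->|za] := eqVneq z a; first by left.
  right; exists z; split => //; rewrite /ell lerNr.
  have h : 0 < cmod (z - ctr (Some a : S2)) by rewrite dist_ctr_gt0.
  by rewrite -[- K]expRK ler_ln ?posrE ?expR_gt0 // ltW.
- apply/nbhs_inftyP; split; first by left.
  exists (expR K) => z zK; right.
  have z0 : 0 < cmod z by apply: lt_trans zK; exact: expR_gt0.
  have zz : z != 0 by rewrite -cmod_gt0.
  exists z; split => //; rewrite /ell /= subr0.
  by rewrite -[K]expRK ler_ln ?posrE ?expR_gt0 // ltW.
Qed.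

Lemma ncusp_nbhs p K q : q <> p -> ~ cusp p K q -> nbhs q [set q' | ~ cusp p K q'].
Proof.
case: q => [z|] qp nc.
- have [zc|zc] := eqVneq z (ctr p).
    case: p qp nc zc => [a|] qp nc /= zc; first by case: qp; rewrite zc.
    apply/nbhs_cP; exists (expR K); first exact: expR_gt0.
    move=> w; rewrite zc subr0 => wK [w' [[<-] w0]]; rewrite /ell /= subr0.
    have w0' : 0 < cmod w by rewrite cmod_gt0.
    by rewrite -{1}[K]expRK ler_ln ?posrE ?expR_gt0 // leNgt wK.
  have lt : ell p z < K.
    by rewrite ltNge; apply/negP => h; apply: nc; exists z.
  apply: filterS (near_lt_cont (ell_cont zc) lt) => w wK [w' [[<-] _]].
  by rewrite leNgt wK.
- case: p qp nc => [a|//] qp nc; apply/nbhs_inftyP; split => //.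
  exists (cmod a + expR (- K)) => z zM [w [[<-] za]]; rewrite /ell /= lerNr.
  have h : 0 < cmod (z - a) by rewrite cmod_gt0 subr_eq0.
  rewrite -[- K]expRK ler_ln ?posrE ?expR_gt0 // leNgt => /negP; apply.
  by have := cmodD (z - a) a; rewrite subrK; lra.
Qed.

Lemma pt_neq_p p z : z != ctr p -> pt z <> p.
Proof. by case: p => [a|] //= /eqP h [E]; exact: h. Qed.

Lemma polar w : w != 0 -> exists y : R, w = mkC (cmod w * cos y) (cmod w * sin y).
Proof.
move=> w0; have m0 : 0 < cmod w by rewrite cmod_gt0.
pose x := re w / cmod w.
have E : x ^+ 2 + (im w / cmod w) ^+ 2 = 1.
  by rewrite /x !expr_div_n -mulrDl -cmod_sq divff // expf_neq0 // gt_eqF.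
have x1 : -1 <= x <= 1.
  rewrite -ler_norml -(ler_pXn2r (n := 2)) ?nnegrE // real_normK ?num_real // expr1n -E.
  by rewrite lerDl sqr_ge0.
have Es : sin (acos x) = `|im w| / cmod w.
  rewrite sin_acos // -E [x ^+ 2 + _]addrC addrK sqrtr_sqr normrM normfV.
  by rewrite [`|cmod w|]gtr0_norm.
have rew : cmod w * x = re w by rewrite /x mulrC divfK ?gt_eqF.
have iw : cmod w * (`|im w| / cmod w) = `|im w| by rewrite mulrC divfK ?gt_eqF.
have [i0|i0] := leP 0 (im w).
- exists (acos x); apply: CP; rewrite !reimE ?acosK ?rew // Es iw ger0_norm //.
- exists (- acos x); apply: CP; rewrite !reimE ?cosN ?sinN ?acosK ?rew // Es mulrN iw ltr0_norm // opprK //.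
Qed.

Lemma mkC_comp_cont (u v : R -> R) t : {for t, continuous u} -> {for t, continuous v} ->
  {for t, continuous (fun t => mkC (u t) (v t) : C)}.
Proof.
move=> /cont_RP cu /cont_RP cv; apply/cont_CP => e e0; have e2 : 0 < e / 2 by rewrite divr_gt0.
apply: filterS2 (cu _ e2) (cv _ e2) => s h1 h2; apply: le_lt_trans (cmod_le_reim _) _.
by rewrite !reimE [e]splitr ltrD.
Qed.

(** In logarithmic polar coordinates the set ell > K is a half-plane, so two of its
    points are joined by the image of a segment; a predicate that is locally constant
    along this curve is constant by the intermediate value theorem. *)
Lemma cusp_connected p K z1 z2 (A : set C) : z1 != ctr p -> z2 != ctr p -> K < ell p z1 -> K < ell p z2 ->
  (forall z, z != ctr p -> K < ell p z -> (\forall w \near z, A w) \/ (\forall w \near z, ~ A w)) ->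
  A z1 -> A z2.
Proof.
move=> h1 h2 k1 k2 HA A1; apply: contrapT => A2.
have [y1 E1] : exists y, z1 - ctr p = mkC (cmod (z1 - ctr p) * cos y) (cmod (z1 - ctr p) * sin y).
  by apply: polar; rewrite subr_eq0.
have [y2 E2] : exists y, z2 - ctr p = mkC (cmod (z2 - ctr p) * cos y) (cmod (z2 - ctr p) * sin y).
  by apply: polar; rewrite subr_eq0.
have c1 : 0 < cmod (z1 - ctr p) by rewrite dist_ctr_gt0.
have c2 : 0 < cmod (z2 - ctr p) by rewrite dist_ctr_gt0.
pose x1 := ln (cmod (z1 - ctr p)); pose x2 := ln (cmod (z2 - ctr p)).
pose X (t : R) := x1 + t * (x2 - x1); pose Y (t : R) := y1 + t * (y2 - y1).
pose ga t : C := ctr p + mkC (expR (X t) * cos (Y t)) (expR (X t) * sin (Y t)).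
have cX : continuous X by move=> t; apply: cvgD; [exact: cvg_cst|apply: cvgMl; exact: cvg_id].
have cY : continuous Y by move=> t; apply: cvgD; [exact: cvg_cst|apply: cvgMl; exact: cvg_id].
have cga : continuous ga.
  move=> t; have H : {for t, continuous (fun t => mkC (expR (X t) * cos (Y t)) (expR (X t) * sin (Y t)) : C)}.
    have cE : {for t, continuous (fun t => expR (X t))} := continuous_comp (cX t) (@continuous_expR R (X t)).
    have cC : {for t, continuous (fun t => cos (Y t))} := continuous_comp (cY t) (@continuous_cos R (Y t)).
    have cS : {for t, continuous (fun t => sin (Y t))} := continuous_comp (cY t) (@continuous_sin R (Y t)).
    exact: (mkC_comp_cont (continuousM cE cC) (continuousM cE cS)).
  by move/cont_CP: H => H; apply/cont_CP => e /H; apply: filterS => s; rewrite /ga opprD addrACA subrr add0r.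
have gac t : cmod (ga t - ctr p) = expR (X t).
  rewrite /ga addrAC subrr add0r.
  have -> : mkC (expR (X t) * cos (Y t)) (expR (X t) * sin (Y t)) = rc (expR (X t)) * mkC (cos (Y t)) (sin (Y t)).
    by apply: CP; rewrite !reimE'; ring.
  rewrite cmodM cmod_rc gtr0_norm ?expR_gt0 // -[RHS]mulr1; congr (_ * _).
  apply/eqP; rewrite -(eqrXn2 (n := 2)) ?cmod_ge0 ?ler01 // cmod_sq !reimE cos2Dsin2 expr1n //.
have gan t : ga t != ctr p by rewrite -dist_ctr_gt0 gac expR_gt0.
have gaK t : 0 <= t <= 1 -> K < ell p (ga t).
  move=> /andP[t0 t1]; move: k1 k2; rewrite /ell gac expRK -/x1 -/x2.
  have t1' : 0 <= 1 - t by rewrite subr_ge0.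
  have -> : X t = (1 - t) * x1 + t * x2 by rewrite /X; ring.
  case: (p) => [a|] k1 k2.
  - have : (1 - t) * K + t * K < (1 - t) * (- x1) + t * (- x2).
      have [->|tn] := eqVneq t 0; first by rewrite subr0 !mul0r !mul1r !addr0.
      apply: ler_ltD; first by rewrite ler_wpM2l // ltW.
      by rewrite ltr_pM2l // lt_def tn.
    lra.
  - have : (1 - t) * K + t * K < (1 - t) * x1 + t * x2.
      have [->|tn] := eqVneq t 0; first by rewrite subr0 !mul0r !mul1r !addr0.
      apply: ler_ltD; first by rewrite ler_wpM2l // ltW.
      by rewrite ltr_pM2l // lt_def tn.
    lra.
have ga0 : ga 0 = z1.
  rewrite /ga /X /Y !mul0r !addr0 /x1 lnK ?posrE //.
  by rewrite -E1 addrC subrK.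
have ga1 : ga 1 = z2.
  rewrite /ga /X /Y !mul1r ![_ + (_ - _)]subrKC /x2 lnK ?posrE //.
  by rewrite -E2 addrC subrK.
pose chi t : R := if `[< A (ga t) >] then 1 else -1.
have cchi : {within `[0, 1], continuous chi}.
  apply: continuous_in_subspaceT => t; rewrite inE /= in_itv /= => t01.
  apply/cont_RP => e e0.
  have [H|H] := HA (ga t) (gan t) (gaK t t01).
  - have A0 := nbhs_singleton H; have nA : \forall s \near t, A (ga s) := cga t A H.
    apply: filterS nA => s As.
    by rewrite /chi !asboolT // subrr normr0.
  - have A0 := nbhs_singleton H; have nA : \forall s \near t, ~ A (ga s) := cga t (~` A) H.
    apply: filterS nA => s As.
    by rewrite /chi !asboolF // subrr normr0.
have [] := @IVT R chi 0 1 0 ler01 cchi.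
  rewrite /chi ga0 ga1 asboolT // asboolF // /Num.min /Num.max.
  have -> : (1 < -1 :> R) = false by apply/negbTE; rewrite -leNgt; lra.
  by rewrite lerN10 ler01.
move=> t _; rewrite /chi; case: ifP => _ /eqP; rewrite ?oppr_eq0 oner_eq0 //.
Qed.

(** A small punctured neighbourhood of [p] contains no boundary point, so it is
    covered by W and the complement of its closure; being connected and meeting W, it
    lies in W. *)
Lemma isolated_cusp W p : open W -> isolated_boundary_point W p ->
  ~ W p /\ exists K, cusp p K `<=` W.
Proof.
move=> oW [/set_mem[cWp nWp] [V Vp Vb]].
have oWi : W° = W by apply/interior_id.
rewrite oWi in nWp; split => //.
have [K HK] := nbhs_cusp Vp; exists (K + 1).
have dich z : z != ctr p -> K < ell p z -> W (pt z) \/ ~ closure W (pt z).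
  move=> zc zK; have Vz := HK z zc zK.
  have nb : ~ boundary W (pt z).
    move=> bz; have : [set p] (pt z) by rewrite -Vb.
    exact: pt_neq_p.
  have [Wz|nW] := pselect (W (pt z)); [by left|right=> cz; apply: nb].
  by split; rewrite ?oWi.
have [q [Wq [qp|[z1 [q1 z1c z1K]]]]] := cWp _ (cusp_nbhs p (K + 1)).
  by case: nWp; rewrite -qp.
move=> q2 [z2 [-> z2c z2K]].
apply: (@cusp_connected p K z1 z2 (fun z => W (pt z))) => //.
- by apply: lt_le_trans z1K; rewrite ltrDl.
- by apply: lt_le_trans z2K; rewrite ltrDl.
- move=> z zc zK; have [Wz|nW] := dich z zc zK.
    left; move: oW; rewrite openE => /(_ _ Wz); exact.
  right; have : nbhs (pt z : S2) (~` closure W).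
    by apply: open_nbhs_nbhs; split => //; apply: closed_openC; exact: closed_closure.
  by move/nbhs_ptP; apply: filterS => w nw Ww; apply: nw; exact: subset_closure.
- by rewrite -q1.
Qed.
End Sphere.

(** * Pulling metrics back by holomorphic maps *)

Section Pullback.
Variable R : realType.
Local Notation C := (CC R).
Local Notation S2 := (sphere R).
Implicit Types (z w a b c : C) (p q : S2) (g : C -> C) (r : R).

Lemma derivable_cdiff g z : derivable g z 1 -> cdiff g z (derive1 g z).
Proof.
rewrite derive1E /derivable /derive => /cvg_ex[l /= Hl].
have -> : lim (h^-1 *: ((g \o shift z) (h *: 1) - g z) @[h --> 0^']) = l.
  by apply: cvg_lim; [exact: norm_hausdorff|exact: Hl].
apply/cdiffP => e e0.
have nb : \forall h \near (0 : C)^', cmod (h^-1 *: ((g \o shift z) (h *: (1 : C)) - g z) - l) < e.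
  exact: Hl [set v | cmod (v - l) < e] (near_cball l e0).
move: nb; rewrite near_withinE => /nbhs_cP[d d0 Hd]; exists d => // h hd.
have [->|h0] := eqVneq h 0; first by rewrite addr0 subrr mulr0 subrr cmod0 mulr0.
have := Hd h; rewrite subr0 => /(_ hd h0) /=.
rewrite /GRing.scale /= mulr1 [h + z]addrC => E.
rewrite (_ : g (z + h) - g z - l * h = (h^-1 * (g (z + h) - g z) - l) * h); last by field.
by rewrite cmodM ler_wpM2r ?cmod_ge0 // ltW.
Qed.

Lemma cdiff_near g k z a : (\forall w \near z, g w = k w) -> cdiff g z a -> cdiff k z a.
Proof.
move=> uv; apply: oh_ext; have uvz := nbhs_singleton uv.
by move/near_shift: uv; apply: filterS => h /= ->; rewrite uvz.
Qed.

Lemma cdiff_inv g z a : g z != 0 -> cdiff g z a -> cdiff (fun w => (g w)^-1) z (- a / g z ^+ 2).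
Proof.
move=> gz Hg; have I := hjet_cdiff (hjet_inv gz).
have H1 := oh_subst (cdiff_Oh Hg) I.
have H2 : oh 1 (fun h => cmod (- g z ^- 2 * (g (z + h) - g z - a * h))) by apply: oh_cZ.
apply: oh_ceq (oh_cD H1 H2) => h; rewrite /= subrKC.
by move: (g z) gz (g (z + h)) (g (z + h))^-1 => u u0 v vi; field.
Qed.

Lemma cdiff_inverse g (s : C -> C) v b : {for v, continuous s} ->
  (\forall u \near v, g (s u) = u) -> cdiff g (s v) b -> b != 0 -> cdiff s v b^-1.
Proof.
move=> /cont_CP cs Hs /cdiffP Hg b0; apply/cdiffP => e e0.
have cb : 0 < cmod b by rewrite cmod_gt0.
pose e1 := Num.min (cmod b / 2) (e * cmod b ^+ 2 / 2).
have e10 : 0 < e1 by rewrite lt_min !divr_gt0 // mulr_gt0 ?exprn_gt0.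
have [e1a e1b] : e1 <= cmod b / 2 /\ e1 <= e * cmod b ^+ 2 / 2 by rewrite !ge_min !lexx orbT.
have [d d0 Hd] := Hg _ e10.
have /near_shift/nbhs_cP[d' d'0 Hd'] : \forall u \near (v : C), cmod (s u - s v) < d /\ g (s u) = u.
  by apply: filterI; [exact: cs|exact: Hs].
exists d' => // k kd; have := Hd' k; rewrite subr0 => /(_ kd)[sd gs].
have gsv := nbhs_singleton Hs.
pose eta := s (v + k) - s v; have := Hd eta sd.
rewrite /eta subrKC gs gsv -/eta [v + k - v]addrAC subrr add0r => E.
(* |b eta| <= |k| + e1 |eta| gives |eta| <= 2 |k| / |b| *)
have eta_le : cmod eta * cmod b <= 2 * cmod k.
  have E' : cmod (b * eta - k) <= e1 * cmod eta by rewrite -cmodN opprB.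
  have := cmodD (b * eta - k) k; rewrite subrK cmodM => h.
  have : e1 * cmod eta <= cmod b / 2 * cmod eta by rewrite ler_wpM2r ?cmod_ge0.
  have -> : cmod b / 2 * cmod eta = cmod b * cmod eta / 2 by ring.
  by rewrite [cmod eta * _]mulrC => h'; lra.
rewrite (_ : s (v + k) - s v - b^-1 * k = b^-1 * - (k - b * eta)); last first.
  by rewrite -/eta; field.
rewrite cmodM cmodN cmodV mulrC ler_pdivrMr //; apply: le_trans E _.
apply: le_trans (ler_wpM2r (cmod_ge0 _) e1b) _.
have -> : e * cmod b ^+ 2 / 2 * cmod eta = e * cmod b / 2 * (cmod eta * cmod b) by ring.
have -> : e * cmod k * cmod b = e * cmod b / 2 * (2 * cmod k) by field.
by rewrite ler_wpM2l // divr_ge0 // mulr_ge0 ?cmod_ge0 // ltW.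
Qed.

(** The derivative of a holomorphic function is holomorphic, and so is its own. *)
Lemma holomorphic_hjets g (g1 : C -> C) z r : 0 < r ->
  (forall w, cmod (w - z) < r -> cdiff g w (g1 w)) ->
  exists b a' b', hjet g z (g1 z) b /\ hjet g1 z a' b'.
Proof.
move=> r0 Hg.
have sub w : cmod (w - z) < r -> exists2 r', 0 < r' & forall v, cmod (v - w) < r' -> cmod (v - z) < r.
  move=> wr; exists (r - cmod (w - z)); first by rewrite subr_gt0.
  by move=> v vw; have := cmodD (v - w) (w - z); rewrite addrA subrK; lra.
have /choice[g2 Hg2] : forall w, exists c, cmod (w - z) < r -> cdiff g1 w c.
  move=> w; have [wr|wr] := ltP (cmod (w - z)) r; last by exists 0.
  have [r' r'0 Hr'] := sub w wr.
  have [c Hc] := @holomorphic_deriv R g g1 w r' r'0 (fun v h => Hg v (Hr' v h)).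
  by exists c.
have [c Hc] := @holomorphic_deriv R g1 g2 z r r0 Hg2.
have nz : \forall w \near z, cmod (w - z) < r by exact: near_cball.
exists (g2 z / 2), (g2 z), (c / 2); split.
- apply: hjet_of_cdiff; first by apply: filterS nz => w; exact: Hg.
  by apply: Hg2; rewrite subrr cmod0.
- by apply: hjet_of_cdiff => //; apply: filterS nz => w; exact: Hg2.
Qed.

(** Pulling a metric back: ln |g'| has no Laplacian, so only the factor |g'|^2
    of the chain rule remains. *)
Lemma jet_pullback (mu : C -> R) g (g1 : C -> C) z r al be ga : 0 < r ->
  (forall w, cmod (w - z) < r -> cdiff g w (g1 w)) -> g1 z != 0 ->
  {for g z, continuous mu} -> 0 < mu (g z) ->
  jet (fun w => ln (mu w)) (g z) al be ga ->
  exists al' be', jet (fun w => ln (mu (g w) * cmod (g1 w))) z al' be' (ga * cmod (g1 z) ^+ 2).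
Proof.
move=> r0 Hg g10 cmu mu0 J; have [b [a' [b' [h1 h2]]]] := holomorphic_hjets r0 Hg.
have [al2 [be2 J2] _] := jet_lnmod g10.
have J3 := jetD (jet_comp h1 J) (jet_comp h2 J2); rewrite mul0r addr0 in J3.
have cg : {for z, continuous g} := cdiff_cont (hjet_cdiff h1).
have cg1 : {for z, continuous g1} := cdiff_cont (hjet_cdiff h2).
do 2 eexists; move: J3; apply: jet_near.
have n1 : \forall w \near z, 0 < mu (g w).
  exact: (near_gt_cont (u := fun w => mu (g w)) (continuous_comp cg cmu) mu0).
have n2 : \forall w \near z, 0 < cmod (g1 w - 0).
  apply: (near_gt_cont (u := fun w => cmod (g1 w - 0)) (continuous_comp cg1 (@cmod_cont _ 0 _))).
  by rewrite subr0 cmod_gt0.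
apply: filterS2 n1 n2 => w m1 m2; rewrite lnM ?posrE //.
  by rewrite subr0.
by rewrite -[g1 w]subr0.
Qed.

(** The metric r / (r^2 - |z - c|^2) has curvature -4. *)
Lemma lambda_disk_jet c (r : R) z : cmod (z - c) < r ->
  exists al be, jet (fun w => ln (r ^+ 2 - cmod (w - c) ^+ 2)) z al be
    (- (r / (r ^+ 2 - cmod (z - c) ^+ 2)) ^+ 2).
Proof.
move=> zr; have r0 : 0 < r by apply: le_lt_trans zr; exact: cmod_ge0.
have m0 : 0 < r ^+ 2 - cmod (z - c) ^+ 2.
  by rewrite subr_gt0 ltrXn2r ?nnegrE ?cmod_ge0 ?(ltW r0).
have J0 := jetD (jet_cst (r ^+ 2) z) (jetZ (-1) (jet_sqmod c z)).
have J1 := jet_near (v := fun w => r ^+ 2 - cmod (w - c) ^+ 2) _ J0.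
have {}J1 := J1 ltac:(by apply: nearC => w; rewrite mulN1r).
do 2 eexists; move: (jet_phi (rjet_ln m0) J1).
rewrite [X in jet _ _ _ _ X -> _](_ : _ = - (r / (r ^+ 2 - cmod (z - c) ^+ 2)) ^+ 2); first exact.
rewrite !add0r cmodM cmod_rc normrN1 mul1r cmod_2conj expr_div_n.
move: m0; move: (cmod (z - c) ^+ 2) => N N0.
by field; exact: lt0r_neq0.
Qed.
End Pullback.

(** * The covering, the pulled-back densities and the hyperbolic metric *)

Section Covering.
Variable R : realType.
Local Notation C := (CC R).
Local Notation S2 := (sphere R).
Implicit Types (z w a c : C) (p q : S2) (g : C -> C) (r : R) (lam : S2 -> R) (f : C -> S2).

(** The two standard charts of the sphere, and densities read in them. *)
Definition emb (b : bool) z : S2 := if b then pt z else sinv (pt z).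
Definition dens (b : bool) lam : C -> R := if b then density_z lam else density_w lam.

Lemma disk_nbhs z : disk z -> \forall w \near z, disk w.
Proof.
rewrite /disk /= -[cmod z]/(cmod z) => h.
have h' : cmod (z - 0) < 1 by rewrite subr0.
by apply: filterS (near_lt_cont (@cmod_cont _ 0 z) h') => w; rewrite subr0.
Qed.

Lemma holomorphic_at_cdiff f w : holomorphic_at f w ->
  cdiff (chart (f w) \o f) w (derive1 (chart (f w) \o f) w).
Proof. by move=> [_ /derivable_cdiff]. Qed.

(** Near each point of the disc the covering is read in one fixed chart of the
    sphere, although [cderiv_mod] changes charts with the point. If this is the chart
    1/z, the centre is sent to 0, the only point at which the curvature is defined
    through that chart. *)
Lemma local_chart f z : (forall z, disk z -> holomorphic_at f z) -> disk z ->
  exists b g (g1 : C -> C) r, [/\ 0 < r, (b = false -> g z = 0) & forall w, cmod (w - z) < r ->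
    [/\ disk w, cdiff g w (g1 w), emb b (g w) = f w & forall lam,
       lam (f w) * cderiv_mod f w = dens b lam (g w) * cmod (g1 w)]].
Proof.
move=> Hf Dz; have [cf _] := Hf z Dz; have nD := disk_nbhs Dz.
case Ez : (f z) => [z0|].
- pose g w : C := odflt 0 (f w).
  have nS : \forall w \near z, f w <> infty.
    by apply: (cf [set q | q <> infty]); rewrite Ez; apply/nbhs_ptP; exact: nearC.
  have /nbhs_cP[r r0 Hr] : \forall w \near z, disk w /\ f w <> infty by exact: filterI.
  exists true, g, (derive1 g), r; apply: (And3 r0 _ _); first by [].
  move=> w /Hr[Dw fw].
  have E : chart (f w) \o f = g by apply/funext => v /=; rewrite /chart; case: (f w) fw.
  have Hd := holomorphic_at_cdiff (Hf w Dw); rewrite E in Hd.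
  have Eg : pt (g w) = f w by rewrite /g; case: (f w) fw.
  apply: (And4 Dw Hd Eg _) => lam.
  by rewrite /cderiv_mod E /dens /density_z Eg.
- pose g w : C := odflt 0 (sinv (f w)).
  pose k w : C := odflt 0 (f w).
  have nS : \forall w \near z, f w = infty \/ exists2 v, f w = pt v & v != 0.
    apply: (cf [set q | q = infty \/ exists2 v, q = pt v & v != 0]); rewrite Ez.
    apply/nbhs_inftyP; split; first by left.
    exists 0 => v v0; right; exists v => //; by rewrite -cmod_gt0.
  have /nbhs_cP[r r0 Hr] : \forall w \near z,
      disk w /\ (f w = infty \/ exists2 v, f w = pt v & v != 0) by exact: filterI.
  pose g1 w : C := if f w is Some v then - derive1 k w / v ^+ 2 else derive1 g w.
  exists false, g, g1, r; apply: (And3 r0 _ _); first by rewrite /g Ez.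
  move=> w /Hr[Dw [fw|[v fw v0]]].
  + have E : chart (f w) \o f = g by apply/funext => u /=; rewrite /chart fw.
    have Hd := holomorphic_at_cdiff (Hf w Dw); rewrite E in Hd.
    have gw : g w = 0 by rewrite /g fw.
    have g1w : g1 w = derive1 g w by rewrite /g1 fw.
    rewrite -g1w in Hd; apply: (And4 Dw Hd _ _).
      by rewrite /emb gw /= eqxx fw.
    by move=> lam; rewrite /cderiv_mod E /dens /density_w gw eqxx g1w fw.
  + have E : chart (f w) \o f = k by apply/funext => u /=; rewrite /chart fw.
    have Hd := holomorphic_at_cdiff (Hf w Dw); rewrite E in Hd.
    have kw : k w = v by rewrite /k fw.
    have gw : g w = v^-1 by rewrite /g fw /= (negbTE v0).
    have k0 : k w != 0 by rewrite kw.
    have nw : \forall u \near w, (k u)^-1 = g u.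
      have [cw _] := Hf w Dw.
      have : \forall u \near w, f u <> infty.
        by apply: (cw [set q | q <> infty]); rewrite fw; apply/nbhs_ptP; exact: nearC.
      apply: filterS => u; rewrite /k /g; case: (f u) => [v'|//] _ /=.
      by have [->|] := eqVneq v' 0; rewrite ?invr0.
    have g1w : g1 w = - derive1 k w / v ^+ 2 by rewrite /g1 fw.
    have Hg : cdiff g w (g1 w).
      by rewrite g1w -kw; apply: cdiff_near nw _; exact: cdiff_inv.
    apply: (And4 Dw Hg _ _).
    * by rewrite /emb gw /= invr_eq0 (negbTE v0) invrK fw.
    * move=> lam; rewrite /cderiv_mod E /dens /density_w gw invr_eq0 (negbTE v0) invrK g1w fw.
      rewrite cmodM cmodN !cmodV cmodX; have cv : cmod v != 0 by rewrite cmod_eq0.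
      move: (cmod v) cv (lam _) (cmod (derive1 k w)) => x x0 ? ?; field; exact: x0.
Qed.

Lemma emb_nbhs b (W : set S2) z : open W -> (b = false -> z = 0) -> W (emb b z) ->
  nbhs z [set w | W (emb b w)].
Proof.
rewrite openE => oW; case: b => /= z0 Wz; first by have := oW _ Wz.
have {}z0 := z0 erefl; rewrite z0 /= eqxx in Wz *.
have /nbhs_inftyP[_ [M HM]] := oW _ Wz.
have M1 : 0 < `|M| + 1 by rewrite ltr_wpDl.
apply/nbhs_cP; exists ((`|M| + 1)^-1); first by rewrite invr_gt0.
move=> w; rewrite subr0 => wM /=; case: eqVneq => // w0.
apply: HM; rewrite cmodV; have cw : 0 < cmod w by rewrite cmod_gt0.
apply: le_lt_trans (ler_norm M) _; apply: lt_trans (_ : `|M| + 1 < _); first by rewrite ltrDl.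
by rewrite -[X in X < _]invrK ltf_pV2 ?posrE ?invr_gt0.
Qed.

Lemma pseudometric_dens b W lam : conformal_pseudometric W lam ->
  plane_pseudometric [set z | W (emb b z)] (dens b lam).
Proof. by case: b => -[]. Qed.

Lemma curvature_dens b lam z : (b = false -> z = 0) ->
  curvature lam (emb b z) = plane_curvature (dens b lam) z.
Proof. by case: b => //= /(_ erefl) ->; rewrite eqxx. Qed.

Lemma dens_chart b lam z : (b = false -> z = 0) -> dens b lam z = lam (emb b z).
Proof. by case: b => //= /(_ erefl) ->; rewrite /density_w !eqxx. Qed.

Definition pull lam f z : R := lam (f z) * cderiv_mod f z.

Lemma ln_jet_cont (mu : C -> R) z al be ga : (\forall w \near z, 0 < mu w) ->
  jet (fun w => ln (mu w)) z al be ga -> {for z, continuous mu}.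
Proof.
move=> mu0 /jet_cont H.
have H2 : {for z, continuous (fun w => expR (ln (mu w)))}.
  exact: (continuous_comp H (@continuous_expR R _)).
apply/cont_RP => e e0; move/cont_RP: H2 => /(_ e e0).
have m0 := nbhs_singleton mu0.
by apply: filterS2 mu0 => w mw; rewrite !lnK ?posrE.
Qed.

Section Pull.
Variables (W : set S2) (f : C -> S2) (lam : S2 -> R).
Hypothesis oW : open W.
Hypothesis Hf : forall z, disk z -> holomorphic_at f z.
Hypothesis fW : forall z, disk z -> W (f z).
Hypothesis Hlam : conformal_pseudometric W lam.

Lemma pull_ge0 z : disk z -> 0 <= pull lam f z.
Proof.
move=> Dz; rewrite mulr_ge0 ?cmod_ge0 //; have [[H1 _ _] [H2 _ _]] := Hlam.
have := fW Dz; case: (f z) => [v|] Wv; first exact: H1.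
have := H2 0; rewrite /= eqxx /density_w eqxx; exact.
Qed.

Lemma pull_cont z : disk z -> {for z, continuous (pull lam f)}.
Proof.
move=> Dz; have [b [g [g1 [r [r0 gz Hg]]]]] := local_chart Hf Dz.
have zz : cmod (z - z) < r by rewrite subrr cmod0.
have [_ cgz embz _] := Hg z zz.
have [c [a' [b' [h1 h2]]]] := @holomorphic_hjets R g g1 z r r0 (fun w h => let: And4 _ H _ _ := Hg w h in H).
have cg := cdiff_cont (hjet_cdiff h1); have cg1 := cdiff_cont (hjet_cdiff h2).
have [_ cd _] := pseudometric_dens b Hlam.
have Wz : W (emb b (g z)) by rewrite embz; exact: fW.
have H : {for z, continuous (fun w => dens b lam (g w) * cmod (g1 w - 0))}.
  apply: continuousM; first exact: (continuous_comp cg (cd _ Wz)).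
  exact: (continuous_comp cg1 (@cmod_cont _ 0 _)).
apply/cont_RP => e e0; move/cont_RP: H => /(_ e e0).
apply: filterS2 (near_cball z r0) => w wr; have [_ _ _ Ew] := Hg w wr; have [_ _ _ Ez] := Hg z zz.
by rewrite !subr0 /pull Ew Ez.
Qed.

(** A curvature bound is preserved by the pullback. *)
Lemma pull_jet z : curvature_le W lam (- 4) -> disk z -> 0 < pull lam f z ->
  exists al be ga, jet (fun w => ln (pull lam f w)) z al be ga /\ pull lam f z ^+ 2 <= ga.
Proof.
move=> Hk Dz pz; have [b [g [g1 [r [r0 gz Hg]]]]] := local_chart Hf Dz.
have zz : cmod (z - z) < r by rewrite subrr cmod0.
have [_ cgz embz Ez] := Hg z zz.
have Wz : W (emb b (g z)) by rewrite embz; exact: fW.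
have [d0 cd dC2] := pseudometric_dens b Hlam.
have dz0 := d0 _ Wz.
move: (pz); rewrite /pull Ez => pz'.
have dz : 0 < dens b lam (g z).
  by rewrite lt_def dz0 andbT; apply: contraTneq pz' => ->; rewrite mul0r ltxx.
have g10 : g1 z != 0.
  by rewrite -cmod_eq0; apply: contraTneq pz' => ->; rewrite mulr0 ltxx.
have nG : nbhs (g z) ([set w | W (emb b w)] `&` [set w | 0 < dens b lam w]).
  apply: filterI; first exact: emb_nbhs.
  exact: near_gt_cont (cd _ Wz) dz.
have [|al [be [ga [J le]]]] := @curvature_jet R _ (dens b lam) (g z) nG dC2 (fun w h => h.2).
  rewrite -curvature_dens // embz; apply: Hk; first exact: fW.
  by rewrite -embz -dens_chart.
have [al' [be' J']] := jet_pullback r0 (fun w h => let: And4 _ H _ _ := Hg w h in H) g10 (cd _ Wz) dz J.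
exists al', be', (ga * cmod (g1 z) ^+ 2); split.
  apply: jet_near J'; apply: filterS (near_cball z r0) => w wr.
  by have [_ _ _ Ew] := Hg w wr; rewrite /pull Ew.
by rewrite exprMn ler_wpM2r // exprn_ge0 ?cmod_ge0.
Qed.
End Pull.

Section HyperbolicMetric.
Variables (W : set S2) (f : C -> S2) (lam : S2 -> R).
Hypothesis Hcov : holomorphic_universal_covering W f.
Hypothesis Hlam : forall z, disk z -> pull lam f z = lambda_disk z.

Lemma cov_in z : disk z -> W (f z).
Proof. by move=> Dz; have [_ <- _] := Hcov; exists z. Qed.
Lemma cov_surj p : W p -> exists2 z, disk z & f z = p.
Proof. by have [_ <- _] := Hcov. Qed.
Lemma cov_hol z : disk z -> holomorphic_at f z.
Proof. by have [H _ _] := Hcov; exact: H. Qed.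

Lemma lambda_disk_gt0 z : disk z -> 0 < lambda_disk z.
Proof.
move=> Dz; rewrite /lambda_disk divr_gt0 // subr_gt0 expr_lt1 ?cmod_ge0 //.
Qed.

Lemma hyp_pos z : disk z -> 0 < cderiv_mod f z /\ 0 < lam (f z).
Proof.
move=> Dz; have := lambda_disk_gt0 Dz; rewrite -Hlam // /pull => h.
have c0 : 0 < cderiv_mod f z.
  by rewrite lt_def cmod_ge0 andbT; apply: contraTneq h => ->; rewrite mulr0 ltxx.
by split => //; move: h; rewrite pmulr_lgt0.
Qed.

Lemma hyp_gt0 p : W p -> 0 < lam p.
Proof. by move=> /cov_surj[z Dz <-]; have [] := hyp_pos Dz. Qed.

(** Over a finite point the covering has a local inverse, and the hyperbolic density is
    the pullback of that of the disc by it. *)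
Lemma section_at z1 : W (pt z1) -> exists (s s1 : C -> C) r, 0 < r /\
  forall v, cmod (v - z1) < r -> [/\ disk (s v), f (s v) = pt v, cdiff s v (s1 v),
     s1 v != 0 & lam (pt v) = lambda_disk (s v) * cmod (s1 v)].
Proof.
move=> Wz; have [w0 Dw0 fw0] := cov_surj Wz.
have [_ _ /(_ _ Wz)[U [oU Uz UW [sheets [_ Eu Hs]]]]] := Hcov.
have : (@disk R `&` f @^-1` U) w0 by split => //=; rewrite fw0.
rewrite Eu => -[V sV Vw0]; have [oV [k [fV kf _ ck]]] := Hs V sV.
have VD v : V v -> disk v.
  move=> Vv; suff [] : (@disk R `&` f @^-1` U) v by [].
  by rewrite Eu; exists V.
pose s v := k (pt v).
have sV' v : U (pt v) -> V (s v) /\ f (s v) = pt v.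
  by rewrite -fV => -[u Vu fu]; rewrite /s -fu kf.
have ks v : U (pt v) -> {for v, continuous s}.
  move=> Uv; have ck' : {for (pt v : S2), continuous k}.
    by move: ck; rewrite continuous_open_subspace // => ck'; apply: ck'; rewrite inE.
  by move=> A /ck'; rewrite /= => /nbhs_ptP.
have nU : \forall v \near z1, U (pt v) by move: oU; rewrite openE => /(_ _ Uz).
have /nbhs_cP[r r0 Hr] := nU.
pose g w : C := odflt 0 (f w).
exists s, (fun v => (derive1 g (s v))^-1), r; split => // v /Hr Uv.
have [Vs fs] := sV' v Uv; have Ds := VD _ Vs.
have E : chart (f (s v)) \o f = g by apply/funext => u /=; rewrite /chart fs.
have Hd := holomorphic_at_cdiff (cov_hol Ds); rewrite E in Hd.
have [c0 _] := hyp_pos Ds.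
have d0 : derive1 g (s v) != 0 by move: c0; rewrite /cderiv_mod E cmod_gt0.
have nUv : \forall u \near v, U (pt u) by move: oU; rewrite openE => /(_ _ Uv).
have Hs1 : cdiff s v (derive1 g (s v))^-1.
  apply: cdiff_inverse Hd d0; first exact: ks.
  by apply: filterS nUv => u Uu; have [_ fu] := sV' u Uu; rewrite /g fu.
apply: (And5 Ds fs Hs1 _ _); first by rewrite invr_eq0.
rewrite -Hlam // /pull /cderiv_mod E fs cmodV mulfK //.
by rewrite cmod_eq0.
Qed.

Lemma lambda_disk_ln_jet z : disk z ->
  exists al be, jet (fun w => ln (lambda_disk w)) z al be (lambda_disk z ^+ 2).
Proof.
move=> Dz; have D0 : cmod (z - 0) < 1 by rewrite subr0.
have [al [be J]] := lambda_disk_jet D0.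
exists (rc (-1) * al), (rc (-1) * be); move: (jetZ (-1) J).
rewrite subr0 expr1n mulN1r opprK; apply: jet_near.
apply: filterS (disk_nbhs Dz) => w Dw; rewrite subr0 mulN1r /lambda_disk div1r lnV //.
by rewrite posrE subr_gt0 expr_lt1 ?cmod_ge0.
Qed.

Lemma lambda_disk_cont z : disk z -> {for z, continuous (@lambda_disk R)}.
Proof.
move=> Dz; have [al [be J]] := lambda_disk_ln_jet Dz.
apply: ln_jet_cont J; apply: filterS (disk_nbhs Dz) => w; exact: lambda_disk_gt0.
Qed.

(** Through the local inverse the curvature -4 of the disc passes to the domain. *)
Lemma hyp_jet z1 : W (pt z1) ->
  exists al be, jet (fun w => ln (lam (pt w))) z1 al be (lam (pt z1) ^+ 2).
Proof.
move=> Wz; have [s [s1 [r [r0 Hs]]]] := section_at Wz.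
have zz : cmod (z1 - z1) < r by rewrite subrr cmod0.
have [Ds _ _ s10 E1] := Hs z1 zz.
have [al [be J]] := lambda_disk_ln_jet Ds.
have [al' [be' J']] := jet_pullback r0 (fun v h => let: And5 _ _ H _ _ := Hs v h in H) s10
  (lambda_disk_cont Ds) (lambda_disk_gt0 Ds) J.
exists al', be'; rewrite E1 exprMn; apply: jet_near J'.
apply: filterS (near_cball z1 r0) => v vr; have [_ _ _ _ ->] := Hs v vr; by [].
Qed.

Lemma hyp_cont z1 : W (pt z1) -> {for z1, continuous (fun w => lam (pt w))}.
Proof.
move=> Wz; have [al [be J]] := hyp_jet Wz; apply: ln_jet_cont J.
have [s [s1 [r [r0 Hs]]]] := section_at Wz.
apply: filterS (near_cball z1 r0) => v vr; have [Ds _ _ s10 ->] := Hs v vr.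
by rewrite mulr_gt0 ?lambda_disk_gt0 // cmod_gt0.
Qed.
End HyperbolicMetric.
End Covering.

(** * Ahlfors' lemma and the strong maximum principle *)

Section Comparison.
Variable R : realType.
Local Notation C := (CC R).
Local Notation S2 := (sphere R).
Implicit Types (z w a c : C) (p q : S2) (r K T : R) (lam : S2 -> R) (f : C -> S2) (u v m : C -> R).

(** The test used in every comparison below: where a product of positive
    functions has a local maximum, the Laplacians of their logarithms add up to
    a non-positive number. *)
Lemma max_ln_test u v z al be ga al' be' ga' :
  0 < u z -> 0 < v z -> {for z, continuous u} -> {for z, continuous v} ->
  (\forall w \near z, u w * v w <= u z * v z) ->
  jet (fun w => ln (u w)) z al be ga -> jet (fun w => ln (v w)) z al' be' ga' -> ga + ga' <= 0.
Proof.
move=> u0 v0 cu cv Hm Ju Jv; apply: jet_max (jetD Ju Jv).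
have nu := near_gt_cont cu u0; have nv := near_gt_cont cv v0.
near=> w.
have uw : 0 < u w by near: w. have vw : 0 < v w by near: w.
rewrite -!lnM ?posrE // ler_ln ?posrE ?mulr_gt0 //; near: w; exact: Hm.
Unshelve. all: by end_near. Qed.

Lemma le_sq (x y : R) : 0 <= x -> x <= y -> x ^+ 2 <= y ^+ 2.
Proof. by move=> x0 xy; rewrite !expr2 ler_pM. Qed.

Lemma exp_sq_bound (L x y : R) : 0 <= L -> L * expR (- x) <= y -> L ^+ 2 * (1 - 2 * x) <= y ^+ 2.
Proof.
move=> L0 h; have := le_sq (mulr_ge0 L0 (expR_ge0 _)) h; apply: le_trans.
rewrite exprMn ler_wpM2l ?exprn_ge0 // -expRM_natl; apply: le_trans (expR_ge1Dx _).
by rewrite mulrN; lra.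
Qed.

(** Ahlfors' lemma on a compact part [K] of the disc of radius r: where the quotient of
    m by r / (r^2 - |z|^2) is maximal and exceeds 1, the two curvatures contradict
    [max_ln_test]. The quotient vanishes on the circle |z| = r. *)
Lemma ahlfors_compact (K : set C) r m : 0 < r -> closed K -> (forall z, K z -> cmod z <= r) ->
  (forall z, K z -> {for z, continuous m}) ->
  (forall z, K z -> cmod z < r -> r < m z * (r ^+ 2 - cmod z ^+ 2) ->
     nbhs z K /\ exists al be ga, jet (fun w => ln (m w)) z al be ga /\ m z ^+ 2 <= ga) ->
  forall z, K z -> m z * (r ^+ 2 - cmod z ^+ 2) <= r.
Proof.
move=> r0 clK bK cm HK z Kz; rewrite leNgt; apply/negP => viol.
pose d w := r ^+ 2 - cmod (w - 0) ^+ 2.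
have cd w : {for w, continuous d}.
  by apply: continuousB; [exact: cst_continuous|exact: jet_cont (jet_sqmod 0 w)].
have [c Kc Hc] : exists2 c, K c & forall z, K z -> m z * d z <= m c * d c.
  apply: (@evt_max R K r (fun w => m w * d w)) => //; first by exists z.
  by move=> w Kw; apply: continuousM; [exact: cm|exact: cd].
have rc' : r < m c * d c by apply: lt_le_trans (Hc z Kz); rewrite /d subr0.
have dc0 : 0 <= d c.
  by rewrite /d subr0 subr_ge0 lerXn2r ?nnegrE ?cmod_ge0 ?(ltW r0) ?bK.
have dc : 0 < d c.
  by rewrite lt_def dc0 andbT; apply: contraTneq rc' => ->; rewrite mulr0 -leNgt ltW.
have mc : 0 < m c by have := lt_trans r0 rc'; rewrite pmulr_lgt0.
have cr : cmod c < r.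
  by move: dc; rewrite /d subr0 subr_gt0 ltr_pXn2r ?nnegrE ?cmod_ge0 ?(ltW r0).
have [nK [al [be [ga [J le]]]]] := HK c Kc cr ltac:(by move: rc'; rewrite /d subr0).
have [|al' [be' J']] := @lambda_disk_jet R 0 r c; first by rewrite subr0.
have := max_ln_test mc dc (cm c Kc) (cd c) _ J J'.
move=> /(_ ltac:(by apply: filterS nK => w; exact: Hc)).
rewrite -/(d c) => h.
have {}h : m c ^+ 2 <= (r / d c) ^+ 2 by lra.
move: rc'; rewrite -ltr_pdivrMr // ltNge => /negP; apply.
by rewrite -(ler_pXn2r (n := 2)) ?nnegrE ?divr_ge0 // ltW.
Qed.

(** The comparison metrics of the discs of radius r tend to that of the unit disc. *)
Lemma pull_le_of_radii (x N : R) : 0 <= x -> 0 <= N < 1 ->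
  (forall r, N < r ^+ 2 -> 0 < r < 1 -> x * (r ^+ 2 - N) <= r) -> x * (1 - N) <= 1.
Proof.
move=> x0 /andP[N0 N1] H; apply/ler_addgt0Pr => e e0.
pose t := Num.min ((1 - N) / 4) (e / (2 * (x + 1))).
have x1 : 0 < 2 * (x + 1) by rewrite mulr_gt0 // ltr_wpDl.
have t0 : 0 < t by rewrite lt_min !divr_gt0 // subr_gt0.
have [t1 t2] : t <= (1 - N) / 4 /\ t <= e / (2 * (x + 1)) by rewrite !ge_min !lexx orbT.
have h : (1 - t) ^+ 2 = 1 - 2 * t + t ^+ 2 by ring.
have tt : 0 < t ^+ 2 by rewrite exprn_gt0.
have := H (1 - t); rewrite h => /(_ ltac:(lra) ltac:(apply/andP; split; lra)) => E.
move: t2; rewrite ler_pdivlMr // => t2.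
have : 0 <= x * t ^+ 2 by rewrite mulr_ge0 // ltW.
have -> : x * (1 - N) = x * (1 - 2 * t + t ^+ 2 - N) + 2 * (x * t) - x * t ^+ 2 by ring.
have : x * t * 2 <= e by move: t2; rewrite !mulrDr mulr1 => t2; lra.
lra.
Qed.

Lemma disk_bound r z : cmod z <= r -> r < 1 -> disk z.
Proof. by move=> zr r1; exact: le_lt_trans zr r1. Qed.

Lemma closed_cball r : closed [set z : C | cmod z <= r].
Proof.
have := @closed_annulus R 0 0 r; congr closed; apply/seteqP; split => z /=; rewrite subr0 cmod_ge0 //.
Qed.

Lemma lambda_diskE z : lambda_disk z = (1 - cmod z ^+ 2)^-1.
Proof. by rewrite /lambda_disk div1r. Qed.

Lemma disk_sq z : disk z -> 0 <= cmod z ^+ 2 < 1.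
Proof. by move=> Dz; rewrite exprn_ge0 ?cmod_ge0 //= expr_lt1 ?cmod_ge0. Qed.

Lemma le_lambda_disk (x : R) z : disk z -> (x <= lambda_disk z) = (x * (1 - cmod z ^+ 2) <= 1).
Proof.
move=> /disk_sq/andP[_ h]; rewrite lambda_diskE -[X in _ <= X]div1r ler_pdivlMr //.
by rewrite subr_gt0.
Qed.

Lemma ahlfors (W : set S2) f lam : open W -> (forall z, disk z -> holomorphic_at f z) ->
  (forall z, disk z -> W (f z)) -> conformal_pseudometric W lam -> curvature_le W lam (- 4) ->
  forall z, disk z -> pull lam f z <= lambda_disk z.
Proof.
move=> oW Hf fW Hlam Hk z Dz; rewrite le_lambda_disk //.
apply: pull_le_of_radii; [exact: (pull_ge0 fW Hlam)|exact: disk_sq|].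
move=> r zr /andP[r0 r1].
apply: (@ahlfors_compact [set z : C | cmod z <= r] r (pull lam f) r0) => //.
- exact: closed_cball.
- move=> w wr; exact: (pull_cont Hf fW Hlam (disk_bound wr r1)).
- move=> w wr wr' h; split.
    by apply: filterS (near_lt_cont (@cmod_cont _ 0 w) (m := r) _) => [v|]; rewrite subr0 //; exact: ltW.
  apply: (pull_jet oW Hf fW Hlam Hk (disk_bound wr r1)).
  have : 0 < pull lam f w * (r ^+ 2 - cmod w ^+ 2) by apply: lt_trans h.
  by rewrite pmulr_lgt0 // subr_gt0 ltr_pXn2r ?nnegrE ?cmod_ge0 ?(ltW r0).
- by rewrite /= -(ler_pXn2r (n := 2)) ?nnegrE ?cmod_ge0 ?(ltW r0) // ltW.
Qed.

(** The barrier v = exp(-al |w - c|^2) - exp(-al r^2) vanishes on the outer circle of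
    an annulus s <= |w - c| <= r, and for large al its Laplacian exceeds
    8 lambda_disk^2 v there, so that m exp(dl v) / lambda_disk has no interior maximum
    above 1. Inside the inner circle m < lambda_disk by continuity, and dl is so small
    that the quotient is at most 1 on that circle; as v > 0, the inequality is strict. *)
Lemma strong_max_ball m c r : 0 < r -> 
  (forall z, cmod (z - c) <= r -> disk z /\ {for z, continuous m} /\ 0 <= m z <= lambda_disk z) ->
  (forall z, cmod (z - c) <= r -> 0 < m z ->
     exists al be ga, jet (fun w => ln (m w)) z al be ga /\ m z ^+ 2 <= ga) ->
  m c < lambda_disk c -> forall z, cmod (z - c) < r -> m z < lambda_disk z.
Proof.
move=> r0 Hm Hj mc z zr.
have cc : cmod (c - c) <= r by rewrite subrr cmod0 ltW.
have [Dc [cmc _]] := Hm c cc.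
have L0 w : disk w -> 0 < lambda_disk w by exact: lambda_disk_gt0.
pose ratio w := m w * (lambda_disk w)^-1.
have cl w : disk w -> {for w, continuous (fun w => (lambda_disk w)^-1)}.
  by move=> Dw; apply: continuousV; [rewrite gt_eqF ?L0|exact: lambda_disk_cont].
have crat w : cmod (w - c) <= r -> {for w, continuous ratio}.
  by move=> wr; have [Dw [cw _]] := Hm w wr; apply: continuousM => //; exact: cl.
have rc1 : ratio c < 1 by rewrite /ratio ltr_pdivrMr ?L0 // mul1r.
pose q := (Num.max (ratio c) (1/2) + 1) / 2.
have mx : Num.max (ratio c) (1/2) < 1 by rewrite gt_max rc1 /=; lra.
have [mx1 mx2] : ratio c <= Num.max (ratio c) (1/2) /\ 1/2 <= Num.max (ratio c) (1/2) :> R.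
  by rewrite !le_max !lexx orbT.
have q0 : 0 < q by rewrite /q; lra.
have q1 : q < 1 by rewrite /q; lra.
have qc : ratio c < q by rewrite /q; lra.
have /nbhs_cP[d d0 Hd] := near_lt_cont (crat c cc) qc.
pose s := d / 2; have s0 : 0 < s by rewrite divr_gt0.
have [zs|sz] := ltP (cmod (z - c)) s.
  have h : ratio z < 1 by apply: lt_trans q1; apply: Hd; apply: lt_trans zs _; rewrite /s; lra.
  have [Dz _] := Hm z (ltW zr).
  by move: h; rewrite /ratio ltr_pdivrMr ?L0 // mul1r.
have [Lam HLam] : exists Lam : R, forall w, cmod (w - c) <= r -> lambda_disk w <= Lam.
  have [||||b _ Hb] := @evt_max R [set w | 0 <= cmod (w - c) <= r] (r + cmod c) (@lambda_disk R).
  - by exists c; rewrite /= cmod_ge0.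
  - exact: closed_annulus.
  - by move=> w; exact: annulus_bound.
  - by move=> w /andP[_ wr]; have [Dw _] := Hm w wr; exact: lambda_disk_cont.
  - by exists (lambda_disk b) => w wr; apply: Hb; rewrite /= cmod_ge0.
pose al0 := 1 + (2 + 2 * Lam ^+ 2) / s ^+ 2.
have L2 : 0 <= Lam ^+ 2 by exact: sqr_ge0.
have s2 : 0 < s ^+ 2 by rewrite exprn_gt0.
have al1 : 1 <= al0 by rewrite lerDl divr_ge0 ?(ltW s2) // addr_ge0 // mulr_ge0.
have al00 : 0 < al0 by exact: lt_le_trans al1.
have alS : 2 + 2 * Lam ^+ 2 <= al0 * s ^+ 2.
  have -> : al0 * s ^+ 2 = s ^+ 2 + (2 + 2 * Lam ^+ 2).
    by rewrite /al0; field; exact: lt0r_neq0.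
  by rewrite lerDr ltW.
(* exp dl * q = 1, which settles the inner circle because v <= 1 *)
pose dl := - ln q; have dl0 : 0 < dl by rewrite oppr_gt0 ln_lt0 // q0 q1.
pose E w := expR (- al0 * cmod (w - c) ^+ 2).
pose v w := E w - expR (- al0 * r ^+ 2).
have E0 w : 0 < E w by exact: expR_gt0.
have v1 w : v w <= 1.
  rewrite /v lerBlDr; apply: le_trans (_ : 1 <= _); last by rewrite lerDl expR_ge0.
  by rewrite -expR0 ler_expR mulNr oppr_le0 mulr_ge0 ?(ltW al00) // exprn_ge0 ?cmod_ge0.
pose B w := expR (dl * v w) * (lambda_disk w)^-1.
have cv w : {for w, continuous v}.
  have J := jet_phi (rjet_expR _) (jetZ (- al0) (jet_sqmod c w)).
  by apply: continuousB; [exact: jet_cont J|exact: cst_continuous].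
have vjet w : exists al be, jet v w al be (E w * (al0 ^+ 2 * cmod (w - c) ^+ 2 - al0)).
  have J := jetD (jet_phi (rjet_expR _) (jetZ (- al0) (jet_sqmod c w))) (jet_cst (- expR (- al0 * r ^+ 2)) w).
  do 2 eexists; move: J; rewrite [X in jet _ _ _ _ X -> _](_ : _ = E w * (al0 ^+ 2 * cmod (w - c) ^+ 2 - al0)).
    exact.
  by rewrite -/(E w) cmodM cmod_rc exprMn cmod_2conj real_normK ?num_real //; field.
have cB w : disk w -> {for w, continuous B}.
  move=> Dw; apply: continuousM; last exact: cl.
  have ce : {for w, continuous (fun w => dl * v w)}.
    by apply: continuousM; [exact: cst_continuous|exact: cv].
  exact: (continuous_comp ce (@continuous_expR R _)).
have BE w : disk w -> m w * B w = ratio w * expR (dl * v w).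
  by move=> _; rewrite /B /ratio [expR _ * _]mulrC mulrA.
pose K := [set w : C | s <= cmod (w - c) <= r].
have Kr w : K w -> cmod (w - c) <= r by case/andP.
have [b Kb Hb] : exists2 b, K b & forall w, K w -> m w * B w <= m b * B b.
  apply: (@evt_max R K (r + cmod c) (fun w => m w * B w)).
  - by exists z; rewrite /K /= sz ltW.
  - exact: closed_annulus.
  - by move=> w; exact: annulus_bound.
  - by move=> w /Kr/Hm[Dw [cw _]]; apply: continuousM => //; exact: cB.
have [Db [cmb /andP[mb0 mb]]] := Hm b (Kr b Kb).
have key : m b * B b <= 1.
  rewrite leNgt; apply/negP => viol.
  have ratb : ratio b <= 1 by rewrite /ratio ler_pdivrMr ?L0 // mul1r.
  have /andP[b1 b2] := Kb.
  have b2' : cmod (b - c) < r.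
    rewrite lt_neqAle b2 andbT; apply/eqP => Er; move: viol.
    by rewrite BE // /v /E Er subrr mulr0 expR0 mulr1 ltNge ratb.
  have b1' : s < cmod (b - c).
    rewrite lt_neqAle b1 andbT; apply/eqP => Es; move: viol; rewrite BE // ltNge => /negP; apply.
    have h1 : ratio b < q by apply: Hd; rewrite -Es /s; lra.
    have h2 : expR (dl * v b) <= q^-1.
      by rewrite -[q^-1]lnK ?posrE ?invr_gt0 // lnV ?posrE // ler_expR -/dl ler_piMr ?(ltW dl0).
    have rb0 : 0 <= ratio b by rewrite mulr_ge0 // invr_ge0 ltW ?L0.
    apply: le_trans (ler_pM rb0 (expR_ge0 _) (ltW h1) h2) _.
    by rewrite mulfV ?gt_eqF.
  have Bb : 0 < B b by rewrite mulr_gt0 ?expR_gt0 // invr_gt0 L0.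
  have mb' : 0 < m b by have := lt_trans ltr01 viol; rewrite pmulr_lgt0.
  have [al [be [ga [J le]]]] := Hj b b2 mb'.
  have [al2 [be2 J2]] := vjet b; have [al3 [be3 J3]] := lambda_disk_ln_jet Db.
  have J4 := jetD (jetZ dl J2) (jetZ (-1) J3).
  have {}J4 : jet (fun w => ln (B w)) b (rc dl * al2 + rc (-1) * al3) (rc dl * be2 + rc (-1) * be3)
     (dl * (E b * (al0 ^+ 2 * cmod (b - c) ^+ 2 - al0)) + -1 * lambda_disk b ^+ 2).
    apply: jet_near J4; apply: filterS (disk_nbhs Db) => w Dw.
    by rewrite /B lnM ?posrE ?expR_gt0 ?invr_gt0 ?L0 // expRK lnV ?posrE ?L0 // mulN1r.
  have nK : nbhs b K.
    have n1 := near_gt_cont (@cmod_cont _ c b) b1'; have n2 := near_lt_cont (@cmod_cont _ c b) b2'.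
    by apply: filterS2 n1 n2 => w h1 h2; rewrite /K /= !ltW.
  have := max_ln_test mb' Bb cmb (cB b Db) _ J J4 => /(_ ltac:(by apply: filterS nK => w; exact: Hb)) h.
  have vb : 0 <= v b.
    rewrite /v subr_ge0 ler_expR !mulNr lerN2 ler_wpM2l ?(ltW al00) //.
    by rewrite lerXn2r ?nnegrE ?cmod_ge0 ?(ltW r0).
  have vE : v b <= E b by rewrite lerBlDr lerDl expR_ge0.
  have m2 : lambda_disk b ^+ 2 * (1 - 2 * (dl * v b)) <= m b ^+ 2.
    have h1 : lambda_disk b * expR (- (dl * v b)) <= m b.
      rewrite expRN ler_pdivrMr ?expR_gt0 //.
      move: viol; rewrite BE // /ratio -mulrA [_^-1 * _]mulrC mulrA.
      by rewrite ltr_pdivlMr ?L0 // mul1r => /ltW.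
    by apply: exp_sq_bound h1; exact: ltW (L0 b Db).
  have h3 : lambda_disk b ^+ 2 <= Lam ^+ 2.
    by apply: le_sq; [exact: ltW (L0 b Db)|exact: HLam].
  have h4 : E b * (al0 ^+ 2 * cmod (b - c) ^+ 2 - al0) <= 2 * v b * lambda_disk b ^+ 2.
    rewrite -(ler_pM2l dl0).
    have -> : dl * (2 * v b * lambda_disk b ^+ 2) = lambda_disk b ^+ 2 * (2 * (dl * v b)) by ring.
    move: m2; rewrite mulrBr mulr1 => m2; lra.
  have h5 : 2 * v b * lambda_disk b ^+ 2 <= E b * (2 * Lam ^+ 2).
    have -> : E b * (2 * Lam ^+ 2) = 2 * E b * Lam ^+ 2 by ring.
    apply: ler_pM h3; [by rewrite mulr_ge0|exact: sqr_ge0|by rewrite ler_pM2l].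
  have h6 : al0 ^+ 2 * cmod (b - c) ^+ 2 - al0 <= 2 * Lam ^+ 2.
    by rewrite -(ler_pM2l (E0 b)); exact: le_trans h4 h5.
  have h7 : al0 * (2 + 2 * Lam ^+ 2) <= al0 ^+ 2 * cmod (b - c) ^+ 2.
    rewrite expr2 -mulrA ler_wpM2l ?(ltW al00) //; apply: le_trans alS _.
    by rewrite ler_wpM2l ?(ltW al00) // lerXn2r ?nnegrE ?(ltW s0) ?cmod_ge0.
  have h8 : 1 * (1 + 2 * Lam ^+ 2) <= al0 * (1 + 2 * Lam ^+ 2).
    by rewrite ler_wpM2r // addr_ge0 // mulr_ge0.
  move: h6 h7 h8; rewrite !mulrDr [al0 * (2 * _)]mulrCA.
  move: (al0 ^+ 2 * _) (al0 * (Lam ^+ 2)) (Lam ^+ 2) => x1 x2 x3; clear; move=> *; lra.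
have Kz : K z by rewrite /K /= sz ltW.
have [Dz _] := Hm z (ltW zr).
have := le_trans (Hb z Kz) key; rewrite BE // => h.
have vz : 0 < v z.
  rewrite /v subr_gt0 ltr_expR !mulNr ltrN2 ltr_pM2l //.
  by rewrite ltr_pXn2r ?nnegrE ?cmod_ge0 ?(ltW r0).
have e1 : 1 < expR (dl * v z) by rewrite expR_gt1 mulr_gt0.
have : ratio z < 1.
  have [z0|z0] := ltP 0 (ratio z); last exact: le_lt_trans z0 ltr01.
  by apply: lt_le_trans h; rewrite ltr_pMr.
by rewrite /ratio ltr_pdivrMr ?L0 // mul1r.
Qed.

(** Any two points of the disc are joined by a chain of such balls. *)
Lemma strong_max m :
  (forall z, disk z -> {for z, continuous m} /\ 0 <= m z <= lambda_disk z) ->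
  (forall z, disk z -> 0 < m z ->
     exists al be ga, jet (fun w => ln (m w)) z al be ga /\ m z ^+ 2 <= ga) ->
  forall c, disk c -> m c < lambda_disk c -> forall z, disk z -> m z < lambda_disk z.
Proof.
move=> Hm Hj.
have ball c z : disk c -> cmod (z - c) < 1 - cmod c -> m c < lambda_disk c -> m z < lambda_disk z.
  move=> Dc zc mc; pose r := (cmod (z - c) + (1 - cmod c)) / 2.
  have r1 : r < 1 - cmod c by rewrite /r; lra.
  have zr : cmod (z - c) < r by rewrite /r; lra.
  have r0 : 0 < r by apply: le_lt_trans zr; exact: cmod_ge0.
  have inD w : cmod (w - c) <= r -> disk w.
    by move=> wr; have := cmodD (w - c) c; rewrite subrK /disk /=; lra.
  apply: (@strong_max_ball m c r r0) => // w wr; have Dw := inD w wr.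
    by have [] := Hm w Dw.
  exact: Hj.
have scale (t : R) c : 0 <= t <= 1 -> cmod (rc t * c) <= cmod c by exact: segment_in 0 c t.
(* move from t c to t' c in steps shorter than 1 - |c| *)
have step c (n : nat) (t t' : R) : disk c -> 0 <= t <= 1 -> 0 <= t' <= 1 ->
    `|t - t'| <= n%:R * ((1 - cmod c) / 2) -> m (rc t * c) < lambda_disk (rc t * c) ->
    m (rc t' * c) < lambda_disk (rc t' * c).
  move=> Dc; have d0 : 0 < 1 - cmod c by rewrite subr_gt0.
  elim: n t => [|n IH] t t01 t'01 h mt.
    have -> : t' = t; last by [].
    by apply/esym/eqP; rewrite -subr_eq0 -normr_eq0 eq_le normr_ge0 andbT; move: h; rewrite mul0r.
  pose t1 := t + (t' - t) / n.+1%:R.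
  have n0 : 0 < n.+1%:R :> R by rewrite ltr0n.
  have n1 : 1 <= n.+1%:R :> R by rewrite ler1n.
  have t1t : `|t1 - t| <= (1 - cmod c) / 2.
    rewrite /t1 addrAC subrr add0r normrM normfV (gtr0_norm n0) ler_pdivrMr //.
    by rewrite distrC mulrC.
  have e1 : t1 - t' = (t - t') * (n%:R / n.+1%:R).
    rewrite /t1 -[n.+1%:R]natr1; field; by rewrite natr1 gt_eqF.
  have t1t' : `|t1 - t'| <= n%:R * ((1 - cmod c) / 2).
    have f0 : 0 <= n%:R / n.+1%:R :> R by rewrite divr_ge0 ?ler0n.
    have E2 : `|t1 - t'| = `|t - t'| * n%:R / n.+1%:R by rewrite e1 normrM (ger0_norm f0) mulrA.
    rewrite E2 ler_pdivrMr // mulrC.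
    have -> : n%:R * ((1 - cmod c) / 2) * n.+1%:R = n%:R * (n.+1%:R * ((1 - cmod c) / 2)) by ring.
    by rewrite ler_wpM2l ?ler0n.
  have t101 : 0 <= t1 <= 1.
    have -> : t1 = t * (n%:R / n.+1%:R) + t' / n.+1%:R.
      rewrite /t1 -[n.+1%:R]natr1; field; by rewrite natr1 gt_eqF.
    move: t01 t'01 => /andP[a1 a2] /andP[b1 b2].
    have f0 : 0 <= n%:R / n.+1%:R :> R by rewrite divr_ge0 ?ler0n.
    have g0 : 0 <= n.+1%:R^-1 :> R by rewrite invr_ge0 ler0n.
    have fg : n%:R / n.+1%:R + n.+1%:R^-1 = 1 :> R.
      by rewrite -[X in _ + X]mul1r -mulrDl natr1 mulfV // gt_eqF.
    apply/andP; split; first by rewrite addr_ge0 // mulr_ge0.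
    rewrite -[X in _ <= X]fg; apply: lerD; first by rewrite ler_piMl.
    by rewrite ler_piMl.
  apply: (IH t1) => //.
  have Dt : disk (rc t * c) by apply: le_lt_trans (scale t c t01) Dc.
  apply: (ball (rc t * c)) => //.
  rewrite -mulrBl (_ : rc t1 - rc t = rc (t1 - t)); last by apply: CP; rewrite !reimE' ?subrr.
  rewrite [X in X < _]cmodM cmod_rc; have c0 := cmod_ge0 c.
  have h1 : `|t1 - t| * cmod c <= (1 - cmod c) / 2.
    apply: le_trans t1t; rewrite ler_piMr //; exact: ltW.
  by have := scale t c t01; lra.
have tosame c (t t' : R) : disk c -> 0 <= t <= 1 -> 0 <= t' <= 1 ->
    m (rc t * c) < lambda_disk (rc t * c) -> m (rc t' * c) < lambda_disk (rc t' * c).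
  move=> Dc t01 t'01; have d0 : 0 < (1 - cmod c) / 2 by rewrite divr_gt0 // subr_gt0.
  apply: (step c (Num.bound (`|t - t'| / ((1 - cmod c) / 2)))) => //.
  by rewrite -ler_pdivrMr // ltW // archi_boundP // divr_ge0 // ltW.
move=> c Dc mc z Dz.
have r1 : rc (1 : R) = 1 by []. have r0 : rc (0 : R) = 0 by [].
have h0 : m 0 < lambda_disk 0.
  have := tosame c 1 0 Dc; rewrite r1 r0 mul1r mul0r; apply => //; by rewrite ?lexx ?ler01.
have := tosame z 0 1 Dz; rewrite r1 r0 mul1r mul0r; apply => //; by rewrite ?lexx ?ler01.
Qed.
End Comparison.

(** * The hyperbolic metric from above, and Hopf's lemma at the puncture *)

Section Cusp.
Variable R : realType.
Local Notation C := (CC R).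
Local Notation S2 := (sphere R).
Implicit Types (z w a c : C) (p q : S2) (r K T : R).

Lemma rjet_inv (x : R) : 0 < x -> rjet (fun y => y^-1) x (- (x ^+ 2)^-1) ((x ^+ 3)^-1).
Proof.
move=> x0; have xn := lt0r_neq0 x0.
have -> : (x ^+ 3)^-1 = (2 / x ^+ 3) / 2 by field.
apply: (@rjet_deriv _ (fun y => y^-1) (fun y => - (y ^+ 2)^-1)).
- near=> y; have y0 : 0 < y by near: y; exact: lt_nbhsr.
  apply: is_derive_eq; first by apply: (is_deriveV (f := id)); exact: lt0r_neq0.
  by rewrite /GRing.scale /= mulr1.
- apply: is_derive_eq; first by apply: is_deriveN; apply: (is_deriveV (f := fun y => y ^+ 2)); exact: expf_neq0.
  by rewrite /GRing.scale /=; field.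
Unshelve. all: by end_near. Qed.

Lemma ell_ctr p z K : z != ctr p -> ell p z = K ->
  cmod (z - ctr p) = if p is Some _ then expR (- K) else expR K.
Proof.
move=> zc; have c0 : 0 < cmod (z - ctr p) by rewrite dist_ctr_gt0.
by rewrite /ell; case: (p) c0 => [a|] c0 <-; rewrite ?opprK lnK ?posrE.
Qed.

(** The band K1 <= ell <= K2 is a closed annulus about the centre. *)
Definition band p K1 K2 : set C := [set z | z != ctr p /\ K1 <= ell p z <= K2].

Lemma band_annulus p K1 K2 : exists s r, 0 < s /\ band p K1 K2 = [set z | s <= cmod (z - ctr p) <= r].
Proof.
case: p => [a|].
- exists (expR (- K2)), (expR (- K1)); split; first exact: expR_gt0.
  apply/seteqP; split => z /=.
  + move=> [za]; have c0 : 0 < cmod (z - a) by rewrite cmod_gt0 subr_eq0.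
    rewrite /ell /= => /andP[h1 h2].
    by rewrite -[cmod _]lnK ?posrE // !ler_expR lerNl h2 lerNr h1.
  + move=> /andP[h1 h2]; have c0 : 0 < cmod (z - a) by apply: lt_le_trans h1; exact: expR_gt0.
    split; first by rewrite -subr_eq0 -cmod_gt0.
    move: h1 h2; rewrite /ell /= -{1 2}[cmod _]lnK ?posrE // !ler_expR => h1 h2.
    by rewrite lerNr h2 lerNl h1.
- exists (expR K1), (expR K2); split; first exact: expR_gt0.
  apply/seteqP; split => z /=.
  + move=> [za]; have c0 : 0 < cmod (z - 0) by rewrite subr0 cmod_gt0.
    by rewrite /ell /= => /andP[h1 h2]; rewrite -[cmod _]lnK ?posrE // !ler_expR h1.
  + move=> /andP[h1 h2]; have c0 : 0 < cmod (z - 0) by apply: lt_le_trans h1; exact: expR_gt0.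
    split; first by rewrite -subr_eq0 -cmod_gt0.
    by move: h1 h2; rewrite /ell /= -{1 2}[cmod _]lnK ?posrE // !ler_expR => -> ->.
Qed.

Lemma band_evt p K1 K2 (u : C -> R) : band p K1 K2 !=set0 ->
  (forall z, band p K1 K2 z -> {for z, continuous u}) ->
  exists2 c, band p K1 K2 c & forall z, band p K1 K2 z -> u z <= u c.
Proof.
have [s [r [s0 E]]] := band_annulus p K1 K2; rewrite E => K0 cu.
apply: (@evt_max R _ (r + cmod (ctr p)) u) => //; first exact: closed_annulus.
by move=> z; exact: annulus_bound.
Qed.

Lemma circle_nonempty p K : band p K K !=set0.
Proof.
pose x := if p is Some _ then expR (- K) else expR K.
have x0 : 0 < x by rewrite /x; case: (p) => *; exact: expR_gt0.
exists (ctr p + rc x).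
have E : cmod (ctr p + rc x - ctr p) = x by rewrite addrAC subrr add0r cmod_rc gtr0_norm.
have nz : ctr p + rc x != ctr p by rewrite -dist_ctr_gt0 E.
split => //; suff -> : ell p (ctr p + rc x) = K by rewrite lexx.
by rewrite /ell E /x; case: (p) => *; rewrite expRK ?opprK.
Qed.

Lemma band_nbhs p K1 K2 z : z != ctr p -> K1 < ell p z < K2 -> nbhs z (band p K1 K2).
Proof.
move=> zc /andP[h1 h2].
have n1 := near_gt_cont (ell_cont zc) h1; have n2 := near_lt_cont (ell_cont zc) h2.
by apply: filterS3 (near_neq zc) n1 n2 => w a1 a2 a3; split => //; rewrite !ltW.
Qed.

Section Metrics.
Variables (W : set S2) (p : S2) (K0 : R) (f : C -> S2) (lam lamW : S2 -> R).
Hypothesis oW : open W.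
Hypothesis Wp : ~ W p.
Hypothesis HK0 : cusp p K0 `<=` W.
Hypothesis Hcov : holomorphic_universal_covering W f.
Hypothesis Hhyp : forall z, disk z -> pull lamW f z = lambda_disk z.

Lemma in_cusp K z : K0 <= K -> z != ctr p -> K <= ell p z -> W (pt z).
Proof. by move=> KK zc zK; apply: HK0; exists z; split => //; exact: le_trans zK. Qed.

Lemma lamW_cont z : z != ctr p -> K0 <= ell p z -> {for z, continuous (fun w => lamW (pt w))}.
Proof. by move=> zc zK; apply: (hyp_cont Hcov Hhyp); exact: in_cusp (lexx K0) zc zK. Qed.

Lemma lamW_gt0 z : z != ctr p -> K0 <= ell p z -> 0 < lamW (pt z).
Proof. by move=> zc zK; apply: (hyp_gt0 Hcov Hhyp); exact: in_cusp (lexx K0) zc zK. Qed.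

Lemma near_cusp z : z != ctr p -> K0 < ell p z -> \forall w \near z, w != ctr p /\ K0 < ell p w.
Proof. by move=> zc zK; apply: filterI; [exact: near_neq|exact: near_gt_cont (ell_cont zc) zK]. Qed.

Lemma annulus_algebra (L m s T : R) : 0 < m -> 0 < s < T ->
  L ^+ 2 + ((s * (1 - s / T))^-1 * (- T^-1 / m ^+ 2 / 2) +
     - (s * (1 - s / T)) ^- 2 / 2 * ((1 - 2 * s / T) ^+ 2 / m ^+ 2) / 2) <= 0 ->
  L ^+ 2 * (m * (2 * (s * (1 - s / T)))) ^+ 2 <= 1 - 2 * s / T + 2 * (s / T) ^+ 2.
Proof.
move=> m0 /andP[s0 sT] h.
set g := (X in L ^+ 2 + X) in h; have {}h : L ^+ 2 <= - g by lra.
apply: le_trans (ler_wpM2r (sqr_ge0 _) h) _; rewrite /g le_eqVlt; apply/orP; left; apply/eqP.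
have ms : m != 0 by rewrite gt_eqF.
have T1 : T != 0 by rewrite gt_eqF // (lt_trans s0).
have s1 : s != 0 by rewrite gt_eqF.
have sT1 : T - s != 0 by rewrite subr_eq0 gt_eqF.
by field; rewrite ms T1 s1 sT1.
Qed.

(** Comparison with a metric on the annulus 0 < ell - K0 < T that blows up at both
    ends. With s = ell - K0, the polynomial s (1 - s/T) stands in for
    T sin(pi s / T) / pi, which would give the hyperbolic metric of the annulus. *)
Lemma lamW_upper_T T z : 0 < T -> z != ctr p -> K0 <= ell p z <= K0 + T ->
  lamW (pt z) * (cmod (z - ctr p) * (2 * ((ell p z - K0) * (1 - (ell p z - K0) / T)))) <= 1.
Proof.
move=> T0 zc zK; rewrite leNgt; apply/negP => viol.
pose y (s : R) := (s - K0) * (1 - (s - K0) / T).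
pose v w := cmod (w - ctr p) * (2 * y (ell p w)).
have yjet s : rjet y s (1 - 2 * (s - K0) / T) (- T^-1).
  move=> e e0; exists 1 => // t _; rewrite [X in `|X|](_ : _ = 0).
    by rewrite normr0 mulr_ge0 ?sqr_ge0 ?ltW.
  rewrite /y; field; exact: lt0r_neq0.
have vcont w : w != ctr p -> {for w, continuous v}.
  move=> wc; apply: continuousM; first exact: cmod_cont.
  apply: continuousM; first exact: cst_continuous.
  have [al [be J] _] := ell_jet wc.
  exact: jet_cont (jet_phi (yjet (ell p w)) J).
have [c [cc cK] Hc] : exists2 c, band p K0 (K0 + T) c &
    forall w, band p K0 (K0 + T) w -> lamW (pt w) * v w <= lamW (pt c) * v c.
  apply: (@band_evt p K0 (K0 + T) (fun w => lamW (pt w) * v w)); first by exists z.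
  move=> w [wc /andP[wK _]]; apply: continuousM; [exact: lamW_cont|exact: vcont].
have {}viol : 1 < lamW (pt c) * v c by apply: lt_le_trans (Hc z _).
have /andP[cK1 cK2] := cK.
have lc := lamW_gt0 cc cK1.
have vc : 0 < v c by have := lt_trans ltr01 viol; rewrite pmulr_rgt0.
have mc : 0 < cmod (c - ctr p) by rewrite dist_ctr_gt0.
have yc : 0 < y (ell p c) by move: vc; rewrite /v (pmulr_rgt0 _ mc) pmulr_rgt0.
have cK1' : K0 < ell p c.
  by rewrite lt_neqAle cK1 andbT; apply: contraTneq yc => <-; rewrite /y subrr mul0r ltxx.
have cK2' : ell p c < K0 + T.
  rewrite lt_neqAle cK2 andbT; apply: contraTneq yc => ->.
  by rewrite /y addrAC subrr add0r divff ?gt_eqF // subrr mulr0 ltxx.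
have [al1 [be1 J1]] := hyp_jet Hcov Hhyp (in_cusp (lexx K0) cc cK1).
have [al2 [be2 J2] _] := jet_lnmod cc.
have [al3 [be3 J3] al3E] := ell_jet cc.
have J4 := jet_phi (rjet_ln yc) (jet_phi (yjet (ell p c)) J3).
have J5 := jetD (jet_cst (ln 2) c) (jetD J2 J4).
have Ev : \forall w \near c, ln 2 + (ln (cmod (w - ctr p)) + ln (y (ell p w))) = ln (v w).
  have n1 := near_gt_cont (@cmod_cont _ (ctr p) c) mc.
  have n2 := near_gt_cont (jet_cont (jet_phi (yjet (ell p c)) J3)) yc.
  apply: filterS2 n1 n2 => w w0 y0.
  have y2 : 0 < 2 * y (ell p w) by rewrite mulr_gt0.
  have -> : ln (v w) = ln (cmod (w - ctr p)) + ln (2 * y (ell p w)) := lnM w0 y2.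
  have -> : ln (2 * y (ell p w)) = ln 2 + ln (y (ell p w)) := lnM (ltr0n R 2) y0.
  by rewrite addrCA.
have {Ev}J5 := jet_near Ev J5.
have := max_ln_test lc vc (lamW_cont cc cK1) (vcont c cc) _ J1 J5.
move=> /(_ ltac:(by apply: filterS (band_nbhs (K1 := K0) (K2 := K0 + T) cc _) => [w|]; [exact: Hc|rewrite cK1'])).
have E k : cmod (rc k * al3) ^+ 2 = k ^+ 2 / cmod (c - ctr p) ^+ 2.
  by rewrite (_ : cmod (rc k * al3) = `|k| * cmod al3) ?exprMn ?real_normK ?num_real ?al3E // -cmod_rc -cmodM.
rewrite !mulr0 !add0r E al3E => h.
have m2 : 0 < cmod (c - ctr p) ^+ 2 by rewrite exprn_gt0.
set s := ell p c - K0 in yc h.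
have sT : 0 < s < T by rewrite /s subr_gt0 cK1' ltrBlDl.
have yE : y (ell p c) = s * (1 - s / T) by [].
have key : lamW (pt c) ^+ 2 * v c ^+ 2 <= 1 - 2 * s / T + 2 * (s / T) ^+ 2.
  rewrite /v; move: h; rewrite yE; move: yc; rewrite yE.
  move=> yc h; exact: annulus_algebra mc sT h.
have le1 : 1 - 2 * s / T + 2 * (s / T) ^+ 2 <= 1.
  case/andP: sT => s0 sT; have st : 0 < s / T < 1 by rewrite divr_gt0 //= ltr_pdivrMr // mul1r.
  have -> : 2 * s / T = 2 * (s / T) by ring.
  move: st; move: (s / T) => x /andP[x0 x1].
  have : x ^+ 2 <= x by rewrite expr2 ler_piMr // ltW.
  lra.
have : 1 < lamW (pt c) ^+ 2 * v c ^+ 2 by rewrite -exprMn exprn_egt1.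
by rewrite ltNge (le_trans key le1).
Unshelve. all: by end_near. Qed.

(** As T tends to infinity the annuli exhaust a punctured disc. *)
Lemma lamW_upper z : z != ctr p -> K0 <= ell p z ->
  lamW (pt z) * (cmod (z - ctr p) * (2 * (ell p z - K0))) <= 1.
Proof.
move=> zc zK; pose s := ell p z - K0; have s0 : 0 <= s by rewrite subr_ge0.
pose A := lamW (pt z) * (cmod (z - ctr p) * (2 * s)).
have A0 : 0 <= A by rewrite !mulr_ge0 ?cmod_ge0 // ltW // lamW_gt0.
rewrite -/s -/A; apply/ler_addgt0Pr => e e0.
pose T := A * s / e + s + 1.
have Ase : 0 <= A * s / e := divr_ge0 (mulr_ge0 A0 s0) (ltW e0).
have T0 : 0 < T by rewrite /T; lra.
have := @lamW_upper_T T z T0 zc.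
have sT : s <= T by rewrite /T; lra.
have -> : K0 <= ell p z <= K0 + T by rewrite zK -lerBlDl.
move=> /(_ isT); rewrite -/s.
have -> : lamW (pt z) * (cmod (z - ctr p) * (2 * (s * (1 - s / T)))) = A - A * s / T.
  by rewrite /A; field; exact: lt0r_neq0.
have : A * s / T <= e.
  have es : 0 <= e * s := mulr_ge0 (ltW e0) s0.
  have ET : e * T = A * s + (e * s + e) by rewrite /T; field; exact: lt0r_neq0.
  by rewrite ler_pdivrMr // ET lerDl; exact: addr_ge0 es (ltW e0).
lra.
Qed.

Hypothesis Hlam : conformal_pseudometric W lam.
Hypothesis Hk : curvature_le W lam (- 4).
Hypothesis Hlt : forall q, W q -> lam q < lamW q.

Lemma lam_cont z : W (pt z) -> {for z, continuous (fun w => lam (pt w))}.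
Proof. by move=> Wz; have [[_ H _] _] := Hlam; exact: H. Qed.

Lemma lam_jet z : W (pt z) -> 0 < lam (pt z) ->
  exists al be ga, jet (fun w => ln (lam (pt w))) z al be ga /\ lam (pt z) ^+ 2 <= ga.
Proof.
move=> Wz lz; have [[_ cl C2] _] := Hlam.
apply: (curvature_jet (mu := density_z lam) _ C2 (fun w h => h.2)).
- apply: filterI; first by move: oW; rewrite openE => /(_ _ Wz).
  exact: near_gt_cont (cl _ Wz) lz.
- exact: (Hk Wz lz).
Qed.

(** The barrier v = dl / (ell - K0) has Laplacian 2 v / ((ell - K0) |z - ctr p|)^2,
    which is at least 8 lamW^2 v by [lamW_upper]. As exp(-2 v) >= 1 - 2 v, this is what
    forbids an interior maximum of lam exp(v) / lamW with value above 1. On the circle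
    ell = K0 + 1 the factor dl makes the quotient at most 1, and far out v tends to 0. *)
Lemma hopf_cusp : exists2 dl, 0 < dl & forall z, z != ctr p -> K0 + 1 <= ell p z ->
  lam (pt z) * expR (dl / (ell p z - K0)) <= lamW (pt z).
Proof.
have K01 : K0 < K0 + 1 by rewrite ltrDl.
pose ratio z := lam (pt z) * (lamW (pt z))^-1.
have inW z : z != ctr p -> K0 <= ell p z -> W (pt z) by exact: in_cusp (lexx K0).
have crat z : z != ctr p -> K0 <= ell p z -> {for z, continuous ratio}.
  move=> zc zK; apply: continuousM; first exact/lam_cont/inW.
  by apply: continuousV; [rewrite gt_eqF // lamW_gt0|exact: lamW_cont].
have [c [cc /andP[cK _]] Hc] : exists2 c, band p (K0 + 1) (K0 + 1) c &
    forall w, band p (K0 + 1) (K0 + 1) w -> ratio w <= ratio c.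
  apply: band_evt; first exact: circle_nonempty.
  by move=> z [zc /andP[zK _]]; apply: crat => //; apply: le_trans zK; exact: ltW.
have cK0 : K0 <= ell p c by apply: le_trans cK; exact: ltW.
have rc1 : ratio c < 1 by rewrite /ratio ltr_pdivrMr ?lamW_gt0 // mul1r; exact/Hlt/inW.
pose q := Num.max (ratio c) (1 / 2).
have q1 : q < 1 by rewrite gt_max rc1 /=; lra.
have q0 : 0 < q by rewrite lt_max; apply/orP; right; lra.
have rq : ratio c <= q by rewrite le_max lexx.
pose dl := - ln q; have dl0 : 0 < dl by rewrite oppr_gt0 ln_lt0 // q0 q1.
exists dl => // z zc zK.
have zK0 : K0 < ell p z by exact: lt_le_trans zK.
pose v w := dl * (ell p w - K0)^-1.
have lK (w : C) : K0 + 1 <= ell p w -> 1 <= ell p w - K0 by rewrite lerBrDl.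
pose B w := expR (v w) * (lamW (pt w))^-1.
suff key : lam (pt z) * B z <= 1.
  move: key; rewrite /B mulrA ler_pdivrMr ?lamW_gt0 ?mul1r //; exact: ltW.
rewrite leNgt; apply/negP => viol.
have vjet w : w != ctr p -> K0 < ell p w -> exists al be,
   jet v w al be (v w / (2 * (ell p w - K0) ^+ 2 * cmod (w - ctr p) ^+ 2)).
  move=> wc wK; have [al [be J] alE] := ell_jet wc.
  have sp : 0 < ell p w + - K0 by rewrite subr_gt0.
  have J2 := jetZ dl (jet_phi (rjet_inv sp) (jetD J (jet_cst (- K0) w))).
  do 2 eexists; move: J2; rewrite [X in jet _ _ _ _ X -> _](_ : _ = v w / (2 * (ell p w - K0) ^+ 2 * cmod (w - ctr p) ^+ 2)).
    exact.
  rewrite !addr0 mulr0 add0r alE /v.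
  have m0 : cmod (w - ctr p) != 0 by rewrite gt_eqF // dist_ctr_gt0.
  move: (ell p w - K0) sp (cmod (w - ctr p)) m0 => s s0 m m0.
  by field; rewrite m0 gt_eqF.
have cB w : w != ctr p -> K0 < ell p w -> {for w, continuous B}.
  move=> wc wK; have [al [be J]] := vjet w wc wK; apply: continuousM.
    exact: (continuous_comp (jet_cont J) (@continuous_expR R _)).
  by apply: continuousV; [rewrite gt_eqF // lamW_gt0 // ltW|exact: lamW_cont wc (ltW wK)].
(* far out the barrier is so small that the ratio is below its value at z *)
pose x0 := lam (pt z) * B z.
have lx0 : 0 < ln x0 by rewrite ln_gt0.
pose K2 := Num.max (ell p z) (K0 + 1 + dl / ln x0) + 1.
have [K2a K2b] : ell p z < K2 /\ K0 + 1 + dl / ln x0 < K2.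
  by rewrite /K2 !ltr_pwDr // le_max lexx ?orbT.
have [b [bc bK] Hb] : exists2 b, band p (K0 + 1) K2 b &
    forall w, band p (K0 + 1) K2 w -> lam (pt w) * B w <= lam (pt b) * B b.
  apply: (@band_evt p (K0 + 1) K2 (fun w => lam (pt w) * B w)).
    by exists z; split => //; rewrite zK ltW.
  move=> w [wc /andP[wK _]]; have wK0 : K0 < ell p w by exact: lt_le_trans wK.
  by apply: continuousM; [exact/lam_cont/inW/ltW|exact: cB].
have zb : x0 <= lam (pt b) * B b by apply: Hb; split => //; rewrite zK ltW.
have vb1 : 1 < lam (pt b) * B b by exact: lt_le_trans viol zb.
have /andP[bK1 bK2] := bK; have bK0 : K0 < ell p b by exact: lt_le_trans bK1.
have Wb := inW b bc (ltW bK0).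
have Lb : 0 < lamW (pt b) by apply: lamW_gt0 bc (ltW bK0).
have Bb : 0 < B b by rewrite mulr_gt0 ?expR_gt0 // invr_gt0.
have lb : 0 < lam (pt b) by have := lt_trans ltr01 vb1; rewrite pmulr_lgt0.
have BE w : lam (pt w) * B w = ratio w * expR (v w) by rewrite /B /ratio [expR _ * _]mulrC mulrA.
have sb := lK b bK1.
have rb : 0 <= ratio b < 1.
  by rewrite mulr_ge0 ?invr_ge0 ?(ltW lb) ?(ltW Lb) //= /ratio ltr_pdivrMr // mul1r Hlt.
have bK1' : K0 + 1 < ell p b.
  rewrite lt_neqAle bK1 andbT; apply/eqP => E; move: vb1; rewrite BE ltNge => /negP; apply.
  have h1 : ratio b <= q by apply: le_trans rq; apply: Hc; split => //; rewrite -E lexx.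
  have h2 : expR (v b) = q^-1.
    by rewrite /v -E addrAC subrr add0r invr1 mulr1 /dl expRN lnK ?posrE.
  by rewrite h2 ler_pdivrMr // mul1r.
have bK2' : ell p b < K2.
  rewrite lt_neqAle bK2 andbT; apply/eqP => E; move: zb; rewrite BE leNgt => /negP; apply.
  have vb : v b < ln x0.
    rewrite /v ltr_pdivrMr; last by rewrite subr_gt0.
    rewrite mulrC -ltr_pdivrMr // E; move: K2b; lra.
  have : expR (v b) < x0 by rewrite -[x0]lnK ?posrE ?ltr_expR // (lt_trans ltr01).
  apply: le_lt_trans; rewrite ler_piMl ?expR_ge0 //; by case/andP: rb => _ /ltW.
have [al [be [ga [J le]]]] := lam_jet Wb lb.
have [al2 [be2 J2]] := vjet b bc bK0; have [al3 [be3 J3]] := hyp_jet Hcov Hhyp Wb.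
have J4 := jetD J2 (jetZ (-1) J3).
have {}J4 := jet_near (v := fun w => ln (B w)) _ J4.
have {}J4 := J4 ltac:(apply: filterS (near_cusp bc bK0) => w [wc wK];
  have Lw : 0 < lamW (pt w) by [exact: lamW_gt0 wc (ltW wK)];
  by rewrite /B lnM ?posrE ?expR_gt0 ?invr_gt0 // expRK lnV ?posrE // mulN1r).
have nK : nbhs b (band p (K0 + 1) K2) by apply: band_nbhs => //; rewrite bK1'.
have := max_ln_test lb Bb (lam_cont Wb) (cB b bc bK0) _ J J4.
move=> /(_ ltac:(by apply: filterS nK => w; exact: Hb)) h.
have m2 : lamW (pt b) ^+ 2 * (1 - 2 * v b) < lam (pt b) ^+ 2.
  have h1 : lamW (pt b) * expR (- v b) < lam (pt b).
    rewrite expRN ltr_pdivrMr ?expR_gt0 //.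
    by move: vb1; rewrite /B mulrA ltr_pdivlMr // mul1r.
  have h0 : 0 <= lamW (pt b) * expR (- v b) by rewrite mulr_ge0 ?expR_ge0 // ltW.
  apply: le_lt_trans (exp_sq_bound (ltW Lb) (lexx _)) _.
  by rewrite ltr_pXn2r ?nnegrE // ltW.
have vb0 : 0 < v b by rewrite mulr_gt0 // invr_gt0 subr_gt0.
have up := lamW_upper bc (ltW bK0).
have mb : 0 < cmod (b - ctr p) by rewrite dist_ctr_gt0.
have N0 : 0 < 2 * (ell p b - K0) ^+ 2 * cmod (b - ctr p) ^+ 2.
  by rewrite !mulr_gt0 ?exprn_gt0 // subr_gt0.
have up2 : lamW (pt b) ^+ 2 * (2 * (2 * (ell p b - K0) ^+ 2 * cmod (b - ctr p) ^+ 2)) <= 1.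
  have h0 : 0 <= lamW (pt b) * (cmod (b - ctr p) * (2 * (ell p b - K0))).
    by rewrite !mulr_ge0 ?(ltW Lb) ?(ltW mb) // subr_ge0 ltW.
  have := le_sq h0 up; rewrite expr1n; apply: le_trans.
  by rewrite le_eqVlt; apply/orP; left; apply/eqP; ring.
have up3 : lamW (pt b) ^+ 2 * (2 * v b) <= v b / (2 * (ell p b - K0) ^+ 2 * cmod (b - ctr p) ^+ 2).
  rewrite ler_pdivlMr //.
  have -> : lamW (pt b) ^+ 2 * (2 * v b) * (2 * (ell p b - K0) ^+ 2 * cmod (b - ctr p) ^+ 2) =
     v b * (lamW (pt b) ^+ 2 * (2 * (2 * (ell p b - K0) ^+ 2 * cmod (b - ctr p) ^+ 2))) by ring.
  by rewrite ler_piMr // ltW.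
move: m2 h le up3; rewrite mulrBr mulr1 mulN1r.
move: (lamW (pt b) ^+ 2 * (2 * v b)) (lamW (pt b) ^+ 2) (lam (pt b) ^+ 2) {J} ga (v b / _).
by clear; move=> *; lra.
Qed.
End Metrics.
End Cusp.

(** * The hyperbolic metric from below *)

Section CuspLower.
Variable R : realType.
Local Notation C := (CC R).
Local Notation S2 := (sphere R).
Implicit Types (z w a : C) (p q : S2) (r K T : R).
Variables (W : set S2) (p : S2) (K0 : R) (f : C -> S2) (lamW : S2 -> R).
Hypothesis Wp : ~ W p.
Hypothesis HK0 : cusp p K0 `<=` W.
Hypothesis Hcov : holomorphic_universal_covering W f.
Hypothesis Hhyp : forall z, disk z -> pull lamW f z = lambda_disk z.

(** The metric of a punctured disc about [p], with [c] fixing its radius. *)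
Definition cusp_metric (p : S2) (c : R) (z : C) : R := (2 * (cmod (z - ctr p) * (ell p z + c)))^-1.

Lemma cusp_metric_gt0 c z : z != ctr p -> 0 < ell p z + c -> 0 < cusp_metric p c z.
Proof. by move=> zc h; rewrite /cusp_metric invr_gt0 mulr_gt0 // mulr_gt0 // dist_ctr_gt0. Qed.

Lemma cusp_metric_cont c z : z != ctr p -> 0 < ell p z + c -> {for z, continuous (cusp_metric p c)}.
Proof.
move=> zc h; apply: continuousV; first by rewrite -invr_eq0 gt_eqF // cusp_metric_gt0.
apply: continuousM; first exact: cst_continuous.
apply: continuousM; first exact: cmod_cont.
by apply: continuousD; [exact: ell_cont|exact: cst_continuous].
Qed.

Lemma cusp_metric_jet c z : z != ctr p -> 0 < ell p z + c ->
  exists al be, jet (fun w => ln (cusp_metric p c w)) z al be (cusp_metric p c z ^+ 2).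
Proof.
move=> zc h; have [al2 [be2 J2] _] := jet_lnmod zc.
have [al3 [be3 J3] al3E] := ell_jet zc.
have J4 := jet_phi (rjet_ln h) (jetD J3 (jet_cst c z)).
have J5 := jetZ (-1) (jetD (jet_cst (ln 2) z) (jetD J2 J4)).
have Ev : \forall w \near z, -1 * (ln 2 + (ln (cmod (w - ctr p)) + ln (ell p w + c))) = ln (cusp_metric p c w).
  have n1 := near_neq zc.
  have n2 := near_gt_cont (jet_cont (jetD J3 (jet_cst c z))) h.
  apply: filterS2 n1 n2 => w; rewrite -dist_ctr_gt0 => w0 y0.
  have y2 : 0 < cmod (w - ctr p) * (ell p w + c) by rewrite mulr_gt0.
  rewrite /cusp_metric lnV ?posrE ?mulr_gt0 // mulN1r; congr (- _).
  have -> : ln (2 * (cmod (w - ctr p) * (ell p w + c))) = ln 2 + ln (cmod (w - ctr p) * (ell p w + c)) := lnM (ltr0n R 2) y2.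
  by congr (_ + _); rewrite (lnM w0 y0).
have {Ev}J5 := jet_near Ev J5.
do 2 eexists; move: J5; rewrite [X in jet _ _ _ _ X -> _](_ : _ = cusp_metric p c z ^+ 2); first exact.
have m0 : cmod (z - ctr p) != 0 by rewrite gt_eqF // dist_ctr_gt0.
rewrite !addr0 !add0r mulr0 add0r al3E /cusp_metric.
by field; rewrite m0 gt_eqF.
Qed.

Definition sphere_cusp_metric (c : R) (q : S2) : R := if q is Some z then cusp_metric p c z else 0.

(** Over the cusp the covering takes finite values, so the chart is the standard one. *)
Lemma cusp_pull c w : 0 < K0 + c -> disk w -> cusp p K0 (f w) ->
  {for w, continuous (pull (sphere_cusp_metric c) f)} /\
  exists al be, jet (fun v => ln (pull (sphere_cusp_metric c) f v)) w al be (pull (sphere_cusp_metric c) f w ^+ 2).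
Proof.
move=> Kc Dw [z [fw zc zK]].
have [b [g [g1 [r [r0 gz Hg]]]]] := local_chart (cov_hol Hcov) Dw.
have ww : cmod (w - w) < r by rewrite subrr cmod0.
have [_ cgw embw Ew] := Hg w ww.
have bT : b = true by case: (b) gz embw => // /(_ erefl) ->; rewrite fw /emb /sinv /= eqxx.
subst b; move: embw; rewrite fw => -[gwz].
have EE v : cmod (v - w) < r -> pull (sphere_cusp_metric c) f v = cusp_metric p c (g v) * cmod (g1 v).
  by move=> vr; have [_ _ _ Ev] := Hg v vr; rewrite /pull Ev.
have h : 0 < ell p z + c by apply: lt_le_trans Kc _; rewrite lerD2r.
have g10 : g1 w != 0.
  have [] := hyp_pos Hhyp Dw => c0 l0.
  have := mulr_gt0 l0 c0; rewrite Ew => x0.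
  by rewrite -cmod_eq0; apply: contraTneq x0 => ->; rewrite mulr0 ltxx.
have [cc [a' [b' [h1 h2]]]] := @holomorphic_hjets R g g1 w r r0 (fun w h => let: And4 _ H _ _ := Hg w h in H).
have cg := cdiff_cont (hjet_cdiff h1); have cg1 := cdiff_cont (hjet_cdiff h2).
have cm : {for g w, continuous (cusp_metric p c)} by rewrite gwz; exact: cusp_metric_cont.
split.
  have H : {for w, continuous (fun v => cusp_metric p c (g v) * cmod (g1 v - 0))}.
    apply: continuousM; first exact: (continuous_comp cg cm).
    exact: (continuous_comp cg1 (@cmod_cont _ 0 _)).
  apply/cont_RP => e e0; move/cont_RP: H => /(_ e e0).
  by apply: filterS2 (near_cball w r0) => v vr; rewrite !subr0 !EE.
have [al [be J]] := cusp_metric_jet zc h; rewrite -gwz in J.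
have pz : 0 < cusp_metric p c (g w) by rewrite gwz cusp_metric_gt0.
have [al' [be' J']] := jet_pullback r0 (fun w h => let: And4 _ H _ _ := Hg w h in H) g10 cm pz J.
exists al', be'; rewrite EE // exprMn; apply: jet_near J'.
by apply: filterS (near_cball w r0) => v vr; rewrite EE.
Qed.

Lemma cusp_preimage_closed r : r < 1 -> closed [set w | cmod w <= r /\ cusp p K0 (f w)].
Proof.
move=> r1; apply: closed_CP => w nK.
have [wr|wr] := ltP r (cmod w).
  have h := near_gt_cont (@cmod_cont _ 0 w); rewrite subr0 in h.
  apply: filterS (h _ wr) => v; rewrite subr0 => vr [vr' _].
  by move: vr'; rewrite leNgt vr.
have Dw := disk_bound wr r1.
have nc : ~ cusp p K0 (f w) by move=> h; apply: nK.
have fp : f w <> p by move=> E; apply: Wp; rewrite -E; exact: cov_in Hcov _ Dw.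
have [cf _] := cov_hol Hcov Dw.
have n1 : nbhs w [set v | ~ cusp p K0 (f v)] := cf _ (ncusp_nbhs fp nc).
by apply: filterS n1 => v nv [_ /nv].
Qed.

Lemma cusp_interior w : disk w -> forall z, f w = pt z -> z != ctr p -> K0 < ell p z ->
  \forall v \near w, cusp p K0 (f v).
Proof.
move=> Dw z fw zc zK; have [cf _] := cov_hol Hcov Dw; apply: cf; rewrite fw.
apply/nbhs_ptP; apply: filterS (near_cusp zc zK) => v [vc vK].
by exists v; split => //; exact: ltW.
Qed.

(** Ahlfors' lemma for the punctured disc metric, restricted to the part of the disc
    that lies over the cusp. On its boundary ell = K0 the metric is at most lamW by the
    choice of c, so a maximum of the quotient above 1 is not attained there. *)
Lemma lamW_lower : exists2 c, 1 <= K0 + c & forall z, z != ctr p -> K0 <= ell p z ->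
  cusp_metric p c z <= lamW (pt z).
Proof.
have [z0 [z0c z0K] Hz0] : exists2 c, band p K0 K0 c &
    forall w, band p K0 K0 w -> (lamW (pt w))^-1 <= (lamW (pt c))^-1.
  apply: (@band_evt _ p K0 K0 (fun w => (lamW (pt w))^-1)); first exact: circle_nonempty.
  move=> w [wc /andP[wK _]]; apply: continuousV; last exact: (lamW_cont HK0 Hcov Hhyp).
  by rewrite gt_eqF // (lamW_gt0 HK0 Hcov Hhyp).
pose rho := cmod (z0 - ctr p); pose M := (lamW (pt z0))^-1.
have rho0 : 0 < rho by rewrite dist_ctr_gt0.
(* large enough for the bound on the circle ell = K0 and for ell + c >= 1 *)
pose c := Num.max 1 (M / (2 * rho)) - K0.
have Kc : K0 + c = Num.max 1 (M / (2 * rho)) by rewrite /c addrC subrK.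
have Kc1 : 1 <= K0 + c by rewrite Kc le_max lexx.
have Kc0 : 0 < K0 + c by apply: lt_le_trans Kc1.
have KcM : M <= 2 * (rho * (K0 + c)).
  by rewrite mulrA mulrC -ler_pdivrMr ?mulr_gt0 // Kc le_max lexx orbT.
have circ z : z != ctr p -> ell p z = K0 -> cusp_metric p c z <= lamW (pt z).
  move=> zc zK; have L0 : 0 < lamW (pt z) by apply: (lamW_gt0 HK0 Hcov Hhyp) => //; rewrite zK.
  have E : cmod (z - ctr p) = rho.
    have e0 : ell p z0 = K0 by apply/eqP; rewrite eq_le andbC.
    by rewrite /rho (ell_ctr zc zK) (ell_ctr z0c e0).
  rewrite /cusp_metric E zK -[lamW _]invrK lef_pV2 ?posrE ?invr_gt0 ?mulr_gt0 //.
  by apply: le_trans KcM; apply: Hz0; split => //; rewrite zK lexx.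
exists c => // z zc zK.
have Wz : W (pt z) := in_cusp HK0 (lexx K0) zc zK.
have [w Dw fw] := cov_surj Hcov Wz.
have [d0 _] := hyp_pos Hhyp Dw.
have inK v u : f v = pt u -> cusp p K0 (f v) -> u != ctr p /\ K0 <= ell p u.
  by move=> -> [u' [[->]]].
have sg0 u : u != ctr p -> K0 <= ell p u -> 0 < cusp_metric p c u.
  by move=> uc uK; apply: cusp_metric_gt0 => //; apply: lt_le_trans Kc0 _; rewrite lerD2r.
suff : pull (sphere_cusp_metric c) f w <= lambda_disk w.
  by rewrite -Hhyp // /pull fw ler_pM2r.
rewrite le_lambda_disk //; apply: pull_le_of_radii; last 2 [exact: disk_sq].
  by rewrite /pull fw mulr_ge0 ?(ltW d0) // ltW // sg0.
move=> r wr /andP[r0 r1].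
apply: (@ahlfors_compact _ [set w | cmod w <= r /\ cusp p K0 (f w)] r _ r0).
- exact: cusp_preimage_closed.
- by move=> v [].
- by move=> v [vr cv]; have [] := cusp_pull Kc0 (disk_bound vr r1) cv.
- move=> v [vr cv] vr' viol; have Dv := disk_bound vr r1.
  have [_ [al [be J]]] := cusp_pull Kc0 Dv cv; split; last by exists al, be; eexists; split; [exact: J|].
  have [u [fv uc uK]] := cv.
  have uK' : K0 < ell p u.
    rewrite lt_neqAle uK andbT; apply/eqP => E; move: viol; rewrite ltNge => /negP; apply.
    have N1 := disk_sq Dv; case/andP: (N1) => N0 {}N1.
    have h : pull (sphere_cusp_metric c) f v <= lambda_disk v.
      rewrite -Hhyp // /pull fv ler_wpM2r ?cmod_ge0 //; exact: circ.
    have rN : 0 <= r ^+ 2 - cmod v ^+ 2 by rewrite subr_ge0; apply: le_sq; rewrite ?cmod_ge0.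
    apply: le_trans (ler_wpM2r rN h) _.
    rewrite lambda_diskE mulrC ler_pdivrMr ?subr_gt0 //.
    rewrite -subr_ge0 (_ : _ - _ = (1 - r) * (r + cmod v ^+ 2)); last by ring.
    by rewrite mulr_ge0 ?subr_ge0 ?addr_ge0 // ltW.
  have n1 := near_lt_cont (@cmod_cont _ 0 v) (m := r); rewrite subr0 in n1.
  apply: filterS2 (n1 vr') (cusp_interior Dv fv uc uK') => v'; rewrite subr0 => h1 h2.
  by split => //; exact: ltW.
- split; last by exists z.
  by rewrite -(ler_pXn2r (n := 2)) ?nnegrE ?cmod_ge0 ?(ltW r0) // ltW.
Qed.
End CuspLower.

(** * Lower bounds for integrals of functions not known to be measurable *)

Section Lengths.
Variable R : realType.
Implicit Types (a b x t : R) (f h : R -> \bar R) (D : \bar R).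
Local Notation mu := (@lebesgue_measure R).
Local Open Scope ereal_scope.
Import HBNNSimple.

Lemma integral_mono (A B : set R) f g : A `<=` B -> (forall t, A t -> 0 <= f t) ->
  (forall t, B t -> 0 <= g t) -> (forall t, A t -> f t <= g t) ->
  \int[mu]_(t in A) f t <= \int[mu]_(t in B) g t.
Proof.
move=> AB f0 g0 fg; rewrite !ge0_integralE //; apply: ereal_sup_le.
move=> _ [k Hk <-]; exists k => // t.
apply: le_trans (Hk t) _; rewrite /patch; case: ifPn; rewrite ?inE => At.
  by rewrite ifT ?inE; [exact: fg|exact: AB].
by case: ifPn; rewrite ?inE => // Bt; exact: g0.
Qed.

(** A lower bound [D] for the integral of [f] over ]a, b[ that is witnessed by a
    measurable minorant. Such bounds add up over adjacent intervals, while the integral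
    of [f] itself need not when [f] fails to be measurable. *)
Definition integral_minorized f a b D := exists h : R -> \bar R,
  [/\ measurable_fun [set: R] h, forall t, 0 <= h t, forall t, ~ (a < t < b)%R -> h t = 0,
      forall t, (a < t < b)%R -> h t <= f t & D <= \int[mu]_t h t].

Lemma minorized_refl f a : integral_minorized f a a 0.
Proof.
exists (cst 0); split => //.
- by move=> t /andP[h1 h2]; move: (lt_trans h1 h2); rewrite ltxx.
- by rewrite integral0.
Qed.

Lemma minorized_cat f a x b D1 D2 : (a <= x <= b)%R -> (forall t, (a < t < b)%R -> 0 <= f t) -> integral_minorized f a x D1 ->
  integral_minorized f x b D2 -> integral_minorized f a b (D1 + D2).
Proof.
move=> /andP[ax xb] f0 [h1 [m1 p1 z1 l1 i1]] [h2 [m2 p2 z2 l2 i2]].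
exists (fun t => h1 t + h2 t); split.
- exact: emeasurable_funD.
- by move=> t; exact: adde_ge0.
- move=> t nt; rewrite z1 ?z2 ?adde0 //.
  + by move=> /andP[h3 h4]; apply: nt; rewrite h4 (le_lt_trans ax h3).
  + by move=> /andP[h3 h4]; apply: nt; rewrite h3 (lt_le_trans h4 xb).
- move=> t /andP[ta tb]; have [tx|tx] := ltP t x.
    rewrite z2 ?adde0; first by apply: l1; rewrite ta tx.
    by move=> /andP[h3 _]; move: (lt_trans tx h3); rewrite ltxx.
  rewrite z1 ?add0e; last by move=> /andP[_ h3]; move: (lt_le_trans h3 tx); rewrite ltxx.
  have [xt|xt] := ltP x t; first by apply: l2; rewrite xt tb.
  rewrite z2 ?f0 ?ta ?tb // => /andP[h3 _]; by move: (le_lt_trans xt h3); rewrite ltxx.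
- by rewrite ge0_integralD //; exact: leeD.
Qed.

(** The minorant is |F'|, to which the fundamental theorem of calculus applies. *)
Lemma minorized_C1 f (F dF : R -> R) a b : (a < b)%R ->
  (forall t, (a <= t <= b)%R -> is_derive t 1%R F (dF t) /\ {for t, continuous dF}) ->
  (forall t, (a < t < b)%R -> `|dF t|%:E <= f t) ->
  integral_minorized f a b (F a - F b)%:E.
Proof.
move=> ab HF Hf.
have cw (k : R -> R) : (forall t, (a <= t <= b)%R -> {for t, continuous k}) -> {within `[a, b], continuous k}.
  move=> ck; apply: continuous_in_subspaceT => t; rewrite inE /= in_itv /=; exact: ck.
have cF t : (a <= t <= b)%R -> {for t, continuous F}.
  by move=> /HF[[dF' _] _]; apply: differentiable_continuous; apply/derivable1_diffP.
have cd : {within `[a, b], continuous dF} by apply: cw => t /HF[].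
have ca : {within `[a, b], continuous (fun t => `|dF t|%R)}.
  by apply: cw => t /HF[_ c]; exact: (continuous_comp c (@norm_continuous _ _ _)).
have ca' : {within `]a, b[, continuous (fun t => `|dF t|%R)}.
  by apply: continuous_subspaceW ca; exact: subset_itvW.
have mo : measurable_fun (`]a, b[ : set R) (fun t => `|dF t|%:E).
  apply/measurable_EFinP; exact: subspace_continuous_measurable_fun.
exists ((fun t => `|dF t|%:E) \_ `]a, b[); split.
- by apply/measurable_restrict => //; rewrite setTI.
- by move=> t; rewrite /patch; case: ifP => // _; rewrite lee_fin.
- by move=> t nt; rewrite /patch ifN // notin_setE /= in_itv.
- by move=> t tt; rewrite /patch ifT ?inE /= ?in_itv //; exact: Hf.
rewrite -integral_mkcond -(@integral_itv_bndoo _ _ _ _ true false) //.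
have FTC : \int[mu]_(t in `[a, b]) (- dF t)%:E = (- F b)%:E - (- F a)%:E.
  apply: (@continuous_FTC2 _ (fun t => - dF t)%R (fun t => - F t)%R) => //.
  - by apply: cw => t /HF[_ c]; exact: continuousN.
  - split.
    + move=> t /=; rewrite in_itv /= => /andP[t1 t2]; apply: derivableN.
      by have [[]] := HF t ltac:(by rewrite !ltW).
    + by apply: cvg_at_right_filter; apply: cvgN; apply: cF; rewrite lexx ltW.
    + by apply: cvg_at_left_filter; apply: cvgN; apply: cF; rewrite lexx ltW.
  - move=> t; rewrite in_itv /= => /andP[t1 t2].
    have [d _] := HF t ltac:(by rewrite !ltW).
    by rewrite derive1E; apply: derive_val; exact: is_deriveN.
have -> : (F a - F b)%:E = (- F b)%:E - (- F a)%:E by rewrite -EFinB opprK addrC.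
rewrite -FTC; apply: le_integral => //.
- by apply: continuous_compact_integrable; [exact: segment_compact|apply: cw => t /HF[_ c]; exact: continuousN].
- by apply: continuous_compact_integrable; [exact: segment_compact|].
- by move=> t _; rewrite lee_fin -normrN ler_norm.
Qed.

Lemma minorized_le f a b D : (0 <= a)%R -> (b <= 1)%R ->
  (forall t, (0 <= t <= 1)%R -> 0 <= f t) ->
  integral_minorized f a b D -> D <= \int[mu]_(t in `[0%R, 1%R]) f t.
Proof.
move=> a0 b1 f0 [h [mh h0 hz hf hi]]; apply: le_trans hi _.
have f0' t : 0 <= (f \_ `[0%R, 1%R]) t.
  by rewrite /patch; case: ifPn => //; rewrite inE /= in_itv /=; exact: f0.
rewrite [leRHS]integral_mkcond; apply: integral_mono => // t _.
have [tab|/hz ->//] := pselect (a < t < b)%R.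
rewrite /patch ifT; first exact: hf.
by case/andP: tab => h1 h2; rewrite inE /= in_itv /= (ltW (le_lt_trans a0 h1)) (ltW (lt_le_trans h2 b1)).
Qed.
End Lengths.

(** * Lengths of curves that leave the cusp *)

Section CuspLengths.
Variable R : realType.
Local Notation C := (CC R).
Local Notation S2 := (sphere R).
Implicit Types (z w a : C) (p q : S2) (K T t : R) (g cv : R -> S2).
Variables (W : set S2) (p : S2) (K0 c : R) (f : C -> S2) (lamW : S2 -> R).
Hypothesis Wp : ~ W p.
Hypothesis HK0 : cusp p K0 `<=` W.
Hypothesis Hcov : holomorphic_universal_covering W f.
Hypothesis Hhyp : forall z, disk z -> pull lamW f z = lambda_disk z.
Hypothesis Kc : 0 < K0 + c.
Hypothesis Hlow : forall z, z != ctr p -> K0 <= ell p z -> cusp_metric p c z <= lamW (pt z).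

Definition ell_sign (p : S2) : R := if p is Some _ then -1 else 1.

Lemma ell_sq z : ell p z = ell_sign p / 2 * ln (cmod (z - ctr p) ^+ 2).
Proof.
have -> : ln (cmod (z - ctr p) ^+ 2) = 2 * ln (cmod (z - ctr p)).
  have [h|h] := ltP 0 (cmod (z - ctr p)); first by rewrite lnXn // mulr_natl.
  have -> : cmod (z - ctr p) = 0 by apply/eqP; rewrite eq_le h cmod_ge0.
  by rewrite expr0n /= ln0 // mulr0.
by rewrite /ell /ell_sign; case: p => [a|]; field.
Qed.

(** The distance to a fixed circle in the punctured disc metric, up to a constant: the
    gradient of this function has length [cusp_metric]. *)
Definition height (q : S2) : R := ln (ell p (odflt 0 q) + c) / 2.

Definition rex g t : R := re (odflt 0 (g t)).
Definition imx g t : R := im (odflt 0 (g t)).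
Definition dheight g t : R :=
  ell_sign p / 2 * (((rex g t - re (ctr p)) * derive1 (rex g) t + (imx g t - im (ctr p)) * derive1 (imx g) t)
    / cmod (odflt 0 (g t) - ctr p) ^+ 2) / (ell p (odflt 0 (g t)) + c).

Lemma cmod_sub z w : cmod (z - w) ^+ 2 = (re z - re w) ^+ 2 + (im z - im w) ^+ 2.
Proof. by rewrite cmod_sq !reimE. Qed.

Lemma height_C1 g t : C1_curve_at g t -> cusp p K0 (g t) ->
  [/\ is_derive t 1 (fun s => height (g s)) (dheight g t), {for t, continuous (dheight g)} &
      `|dheight g t| <= cusp_metric p c (odflt 0 (g t)) * speed g t].
Proof.
move=> [cg dg cX' cY'] [z [gt zc zK]].
have rE : re_at g t = rex g by apply/funext => s; rewrite /re_at gt.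
have iE : im_at g t = imx g by apply/funext => s; rewrite /im_at gt.
rewrite rE in dg cX'; rewrite iE in dg cY'.
have [dX dY] := nbhs_singleton dg.
have hX := derivable_is_derive dX; have hY := derivable_is_derive dY.
have cX : {for t, continuous (rex g)} by apply: differentiable_continuous; apply/derivable1_diffP.
have cY : {for t, continuous (imx g)} by apply: differentiable_continuous; apply/derivable1_diffP.
pose N s := (rex g s - re (ctr p)) ^+ 2 + (imx g s - im (ctr p)) ^+ 2.
have NE s : N s = cmod (odflt 0 (g s) - ctr p) ^+ 2 by rewrite cmod_sub.
have gz : odflt 0 (g t) = z by rewrite gt.
have m0 : 0 < cmod (z - ctr p) by rewrite dist_ctr_gt0.
have N0 : 0 < N t by rewrite NE gz exprn_gt0.
have e0 : 0 < ell p z + c by apply: lt_le_trans Kc _; rewrite lerD2r.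
pose dot s := (rex g s - re (ctr p)) * derive1 (rex g) s + (imx g s - im (ctr p)) * derive1 (imx g) s.
have hN : is_derive t 1 N (2 * dot t).
  apply: is_derive_eq; rewrite /GRing.scale /= /dot; ring.
have cN : {for t, continuous N}.
  apply: differentiable_continuous; apply/derivable1_diffP; exact: (@ex_derive _ _ _ _ _ _ _ hN).
have heightE : (fun s => height (g s)) = fun s => 2^-1 * ln (ell_sign p / 2 * ln (N s) + c).
  by apply/funext => s; rewrite /height ell_sq -NE mulrC.
have ellE : ell_sign p / 2 * ln (N t) + c = ell p z + c by rewrite NE gz -ell_sq.
have cE : {for t, continuous (fun s => ell p (odflt 0 (g s)) + c)}.
  have -> : (fun s => ell p (odflt 0 (g s)) + c) = fun s => ell_sign p / 2 * ln (N s) + c.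
    by apply/funext => s; rewrite ell_sq -NE.
  apply: continuousD; last exact: cst_continuous.
  apply: continuousM; first exact: cst_continuous.
  exact: (continuous_comp cN (continuous_ln N0)).
split.
- rewrite heightE.
  have h1 := is_derive_lnmu N0 hN.
  have h2 : is_derive t 1 (fun s => ell_sign p / 2 * ln (N s) + c) (ell_sign p / 2 * (2 * dot t / N t)).
    by apply: is_derive_eq; rewrite /GRing.scale /= ; ring.
  have e0' : 0 < ell_sign p / 2 * ln (N t) + c by rewrite ellE.
  have h3 := @is_derive_lnmu _ (fun s => ell_sign p / 2 * ln (N s) + c) t _ e0' h2.
  apply: is_derive_eq; rewrite /GRing.scale /= ellE /dheight -NE gz -/(dot t).
  by field; rewrite !gt_eqF.
- have cst (k : R) : {for t, continuous (fun _ : R => k)} by exact: cst_continuous.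
  have cXa : {for t, continuous (fun s => rex g s - re (ctr p))} := continuousB cX (cst _).
  have cYa : {for t, continuous (fun s => imx g s - im (ctr p))} := continuousB cY (cst _).
  have cdot : {for t, continuous dot} := continuousD (continuousM cXa cX') (continuousM cYa cY').
  have E : dheight g = fun s => ell_sign p / 2 * (dot s * (N s)^-1) * (ell p (odflt 0 (g s)) + c)^-1.
    by apply/funext => s; rewrite /dheight -NE.
  have n1 : N t != 0 by rewrite gt_eqF.
  have n2 : ell p (odflt 0 (g t)) + c != 0 by rewrite gz gt_eqF.
  have c1 : {for t, continuous (fun s => dot s * (N s)^-1)} := continuousM cdot (continuousV n1 cN).
  have c2 : {for t, continuous (fun s => ell_sign p / 2 * (dot s * (N s)^-1))} :=
    continuousM (cst _) c1.
  have c3 : {for t, continuous (fun s => (ell p (odflt 0 (g s)) + c)^-1)}.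
    by apply: continuousV; [exact: n2|exact: cE].
  rewrite E; have c4 := continuousM c2 c3; exact: c4.
- rewrite /dheight gz /cusp_metric /speed rE iE.
  have sg : `|ell_sign p / 2| = 2^-1 by rewrite /ell_sign; case: p => [_|]; rewrite normrM ?normrN normr1 mul1r gtr0_norm.
  set v := mkC _ _.
  have CS : `|dot t| <= cmod (z - ctr p) * cmod v.
    have -> : dot t = re (cconj (z - ctr p) * v).
      by rewrite /dot /v !reimE' /rex /imx gz; ring.
    by apply: le_trans (re_le_cmod _) _; rewrite cmodM cmod_conj.
  rewrite -/(dot t); set e := ell p z + c in e0 *; set m := cmod (z - ctr p) in m0 CS *.
  have -> : `|ell_sign p / 2 * (dot t / m ^+ 2) / e| = 2^-1 * (`|dot t| / m ^+ 2) / e.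
    rewrite [LHS]normrM [X in X * _]normrM sg [`|e^-1|]gtr0_norm ?invr_gt0 //; congr (_ * _ / _).
    by rewrite normrM [`|(m ^+ 2)^-1|]gtr0_norm // invr_gt0 exprn_gt0.
  have -> : 2^-1 * (`|dot t| / m ^+ 2) / e = `|dot t| * (2 * (m ^+ 2 * e))^-1 by field; rewrite !gt_eqF.
  rewrite ler_pdivrMr; last by rewrite !mulr_gt0 ?exprn_gt0.
  apply: le_trans CS _; rewrite le_eqVlt; apply/orP; left; apply/eqP.
  by field; rewrite !gt_eqF.
Qed.

Definition length_density cv t : \bar R := (lamW (cv t) * speed cv t)%:E.

Lemma speed_near cv g t : (\forall s \near t, cv s = g s) -> C1_curve_at g t -> speed cv t = speed g t.
Proof.
move=> E [_ dg _ _]; have Et := nbhs_singleton E; have [dX dY] := nbhs_singleton dg.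
rewrite /speed; congr (cmod (mkC _ _)); apply: is_derive_derive1.
- apply: is_derive_near (derivable_is_derive dX).
  by apply: filterS E => s Es; rewrite /re_at Et Es.
- apply: is_derive_near (derivable_is_derive dY).
  by apply: filterS E => s Es; rewrite /im_at Et Es.
Qed.

Lemma cusp_piece cv g (a b : R) : a < b -> (forall t, a <= t <= b -> cv t = g t /\ C1_curve_at g t) ->
  (forall t, a <= t <= b -> cusp p K0 (cv t)) ->
  integral_minorized (length_density cv) a b (height (cv a) - height (cv b))%:E.
Proof.
move=> ab Hg Hc.
have aa : a <= a <= b by rewrite lexx ltW. have bb : a <= b <= b by rewrite lexx ltW.
rewrite (Hg a aa).1 (Hg b bb).1.
apply: (@minorized_C1 _ _ (fun s => height (g s)) (dheight g)) => //.
- move=> t tab; have [Et Ct] := Hg t tab; have := Hc t tab; rewrite Et => ct.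
  by have [] := height_C1 Ct ct.
- move=> t tab; have tab' : a <= t <= b by case/andP: tab => h1 h2; rewrite !ltW.
  have [Et Ct] := Hg t tab'; have := Hc t tab'; rewrite Et => ct.
  have [_ _ h] := height_C1 Ct ct.
  rewrite /length_density lee_fin (speed_near _ Ct); last first.
    have n1 : \forall s \near t, a < s < b by apply: near_in_itvoo; rewrite in_itv.
    by apply: filterS n1 => s /andP[h1 h2]; apply: (Hg s _).1; rewrite !ltW.
  apply: le_trans h _; rewrite Et; apply: ler_wpM2r; first exact: cmod_ge0.
  by have [z [-> zc zK]] := ct; exact: Hlow.
Qed.

(** The first exit time is the infimum of the times spent outside; points outside the
    cusp, and points in its interior, stay so for a while. *)
Lemma cusp_exit g (a x K1 : R) t0 : (forall t, a <= t <= x -> {for t, continuous g} /\ g t <> p) ->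
  cusp p K1 (g a) -> a <= t0 <= x -> ~ cusp p K1 (g t0) ->
  exists T, [/\ a <= T <= x, forall t, a <= t <= T -> cusp p K1 (g t) & ell p (odflt 0 (g T)) = K1].
Proof.
move=> Hg ca t0x n0.
pose E := [set t | a <= t <= x /\ ~ cusp p K1 (g t)].
have lbE : lbound E a by move=> t [/andP[]].
have infE : has_inf E by split; [exists t0|exists a].
pose T := inf E.
have aT : a <= T by apply: lb_le_inf => //; exists t0.
have ET t : E t -> T <= t by move=> Et; apply: ge_inf => //; exists a.
have Tx : T <= x by apply: le_trans (ET t0 _) _ => //; case/andP: t0x.
have TT : a <= T <= x by rewrite aT.
have before t : a <= t < T -> cusp p K1 (g t).
  move=> /andP[at_ tT]; apply: contrapT => nt.
  have : E t by split => //; rewrite at_ (le_trans (ltW tT)).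
  by move/ET; rewrite leNgt tT.
have [cT nT] := Hg T TT.
have cuspT : cusp p K1 (g T).
  apply: contrapT => nc.
  have n1 : \forall s \near T, ~ cusp p K1 (g s) := cT _ (ncusp_nbhs nT nc).
  have aT' : a < T by rewrite lt_neqAle aT andbT; apply/eqP => e; apply: nc; rewrite -e.
  have n2 : \forall s \near T, a < s by exact: lt_nbhsr.
  have n3 : \forall s \near T, a < s /\ ~ cusp p K1 (g s) by exact: filterI.
  have /nbhs_ballP[e /= e0 He] := n3.
  have [h1 h2] : a < T - e / 2 /\ ~ cusp p K1 (g (T - e / 2)).
    apply: He; rewrite /ball /= opprB addrC subrK gtr0_norm ?divr_gt0 //.
    by rewrite ltr_pdivrMr // ltr_pMr // ltr1n.
  by apply: h2; apply: before; rewrite (ltW h1) /= ltrBlDr ltrDl divr_gt0.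
have [z [gTz zc zK]] := cuspT.
exists T; split => //.
  by move=> t /andP[t1 t2]; move: t2; rewrite le_eqVlt => /predU1P[->//|t2]; apply: before; rewrite t1.
rewrite gTz /=; apply/eqP; rewrite eq_le zK andbT leNgt; apply/negP => zK'.
have nc : nbhs (g T) (cusp p K1).
  rewrite gTz; apply/nbhs_ptP; apply: filterS (near_cusp zc zK') => v [vc vK].
  by exists v; split => //; exact: ltW.
have n1 : \forall s \near T, cusp p K1 (g s) := cT _ nc.
have /nbhs_ballP[e /= e0 He] := n1.
have [t Et tT] := inf_adherent e0 infE.
have [_ nt] := Et; apply: nt; apply: He.
rewrite /ball /= ler0_norm ?subr_le0 ?ET // opprB ltrBlDl //.
Qed.

(** The pieces of the path are treated one after the other until the path first leaves
    the cusp, where the height is that of the circle ell = K1. *)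
Lemma cusp_path_minorized K1 cv s (a : R) : K0 <= K1 -> path <%R a s ->
  (forall i, (i < size s)%N -> smooth_on cv (nth 0 (a :: s) i) (nth 0 s i)) ->
  (forall t, a <= t <= last a s -> W (cv t)) ->
  cusp p K1 (cv a) -> ~ cusp p K1 (cv (last a s)) ->
  exists T, a <= T <= last a s /\
    integral_minorized (length_density cv) a T (height (cv a) - ln (K1 + c) / 2)%:E.
Proof.
move=> K01; elim: s a => [|x s IH] a /=; first by [].
move=> /andP[ax px] Hs HW ca nl.
have xl : x <= last x s by move: px; clear; elim: s x => //= y s IH x /andP[xy /IH]; apply: le_trans; exact: ltW.
have [g Hg] := Hs 0%N isT; rewrite /= in Hg.
have K1K0 q : cusp p K1 q -> cusp p K0 q by move=> [z [-> zc zK]]; exists z; split => //; exact: le_trans zK.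
have f0 t : a <= t <= last x s -> (0 <= length_density cv t)%E.
  move=> tl; rewrite /length_density lee_fin mulr_ge0 ?cmod_ge0 // ltW //.
  by apply: (hyp_gt0 Hcov Hhyp); exact: HW.
have [allc|nall] := pselect (forall t, a <= t <= x -> cusp p K1 (cv t)).
  have P1 := cusp_piece ax Hg (fun t h => K1K0 _ (allc t h)).
  have HWx t : x <= t <= last x s -> W (cv t).
    by move=> /andP[h1 h2]; apply: HW; rewrite h2 (le_trans (ltW ax)).
  have cx : cusp p K1 (cv x) by apply: allc; rewrite lexx ltW.
  have [T [/andP[xT Tl] P2]] := IH x px (fun i h => Hs i.+1 h) HWx cx nl.
  exists T; rewrite Tl (le_trans (ltW ax)) //; split => //.
  have -> : (height (cv a) - ln (K1 + c) / 2)%:E =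
    ((height (cv a) - height (cv x))%:E + (height (cv x) - ln (K1 + c) / 2)%:E)%E.
    by rewrite -EFinD addrA subrK.
  apply: minorized_cat P1 P2; first by rewrite (ltW ax).
  by move=> t /andP[h1 h2]; apply: f0; rewrite (ltW h1) (le_trans (ltW h2)).
have [t0 [t0x n0]] : exists t, a <= t <= x /\ ~ cusp p K1 (cv t).
  apply: contrapT => h; apply: nall => t tx; apply: contrapT => nt; apply: h; by exists t.
have aa : a <= a <= x by rewrite lexx ltW.
have [T [/andP[aT Tx] cT ET]] : exists T, [/\ a <= T <= x, forall t, a <= t <= T -> cusp p K1 (g t) & ell p (odflt 0 (g T)) = K1].
  have ca' : cusp p K1 (g a) by rewrite -(Hg a aa).1.
  have n0' : ~ cusp p K1 (g t0) by rewrite -(Hg t0 t0x).1.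
  apply: (@cusp_exit g a x K1 t0 _ ca' t0x n0').
  move=> t tx; have [Et [cg _ _ _]] := Hg t tx; split => //.
  rewrite -Et => e; apply: Wp; rewrite -e; apply: HW.
  by case/andP: tx => h1 h2; rewrite h1 (le_trans h2).
have gT : cv T = g T by apply: (Hg T _).1; rewrite aT.
exists T; rewrite aT (le_trans Tx) //; split => //.
have -> : ln (K1 + c) / 2 = height (cv T) by rewrite /height gT ET.
move: aT; rewrite le_eqVlt => /predU1P[<-|aT]; first by rewrite subrr; exact: minorized_refl.
apply: cusp_piece aT _ _ => t /andP[h1 h2].
  by apply: Hg; rewrite h1 (le_trans h2).
rewrite (Hg t _).1; first by apply: K1K0; apply: cT; rewrite h1.
by rewrite h1 (le_trans h2).
Qed.

Lemma length_lower K1 z q cv : K0 <= K1 -> z != ctr p -> K1 <= ell p z -> ~ cusp p K1 q ->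
  curve_joining W (pt z) q cv ->
  (((ln (ell p z + c) - ln (K1 + c)) / 2)%:E <= metric_length lamW cv)%E.
Proof.
move=> K01 zc zK nq [[s [[ps /eqP ls] Hs]] HW c0 c1].
have HW' t : 0 <= t <= last 0 s -> W (cv t) by rewrite ls; exact: HW.
have ca : cusp p K1 (cv 0) by rewrite c0; exists z.
have nl : ~ cusp p K1 (cv (last 0 s)) by rewrite ls c1.
have [T [/andP[T0 T1] Hm]] := cusp_path_minorized K01 ps Hs HW' ca nl.
have -> : (ln (ell p z + c) - ln (K1 + c)) / 2 = height (cv 0) - ln (K1 + c) / 2.
  by rewrite c0 /height /= mulrBl.
apply: minorized_le Hm => //; first by rewrite -ls.
move=> t t01; rewrite /length_density lee_fin mulr_ge0 ?cmod_ge0 // ltW //.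
by apply: (hyp_gt0 Hcov Hhyp); exact: HW.
Qed.
End CuspLengths.

(** * Curves of finite length *)

Section Distance.
Variable R : realType.
Local Notation C := (CC R).
Local Notation S2 := (sphere R).
Implicit Types (z w a b : C) (p q : S2) (t s : R) (cv : R -> S2).

Lemma chart_emb (bb : bool) z w : (bb = false -> z = 0) -> chart (emb bb z) (emb bb w) = w.
Proof.
case: bb => [//|/(_ erefl) ->]; rewrite /emb /sinv /= eqxx /chart /infty /=.
by have [->|w0] //= := eqVneq w 0; rewrite invr_eq0 (negPf w0) /= invrK.
Qed.

Definition segment a b t : C := a + rc t * (b - a).

Lemma segmentB a b s t : segment a b s - segment a b t = rc (s - t) * (b - a).
Proof. by rewrite /segment; apply: CP; rewrite !reimE'; ring. Qed.

Lemma segment_mod a b t r : cmod a <= r -> cmod b <= r -> 0 <= t <= 1 -> cmod (segment a b t) <= r.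
Proof.
move=> ar br /andP[t0 t1].
have -> : segment a b t = rc (1 - t) * a + rc t * b by rewrite /segment; apply: CP; rewrite !reimE'; ring.
apply: le_trans (cmodD _ _) _; rewrite !cmodM !cmod_rc !ger0_norm ?subr_ge0 //.
have -> : r = (1 - t) * r + t * r by ring.
by apply: lerD; rewrite ler_wpM2l // subr_ge0.
Qed.

Lemma segment_dist_cont a b s t :
  {for s, continuous (fun s => cmod (segment a b s - segment a b t))}.
Proof.
have -> : (fun s => cmod (segment a b s - segment a b t)) = fun s => `|s - t| * cmod (b - a).
  by apply/funext => s'; rewrite segmentB cmodM cmod_rc.
apply: continuousM; last exact: cst_continuous.
apply: (@continuous_comp _ _ _ (fun s => s - t) (fun x => `|x|)); last exact: norm_continuous.
by apply: continuousB; [exact: cvg_id|exact: cst_continuous].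
Qed.

Lemma segment_near a b s t (r : R) : cmod (segment a b s - segment a b t) < r ->
  \forall s' \near s, cmod (segment a b s' - segment a b t) < r.
Proof.
rewrite -subr_gt0 => h; have := (cont_RP _ _).1 (@segment_dist_cont a b s t) _ h.
by apply: filterS => s' /ltr_normlP[_]; rewrite ltrD2r.
Qed.

Lemma segment_deriv (g : C -> C) a b s k : cdiff g (segment a b s) k ->
  is_derive s 1 (fun s => re (g (segment a b s))) (re (k * (b - a))) /\
  is_derive s 1 (fun s => im (g (segment a b s))) (im (k * (b - a))).
Proof.
move=> hg.
have E t : segment a b (s + t) = segment a b s + rc t * (b - a).
  by rewrite /segment; apply: CP; rewrite !reimE'; ring.
have imE w : re (mkC 0 (-1) * w) = im w by rewrite !reimE'; ring.
split; apply: is_derive_shift0.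
- have := cdiff_line (b - a) hg 1; rewrite mul1r.
  by apply: is_derive_near; near=> t; rewrite mul1r E.
- have := cdiff_line (b - a) hg (mkC 0 (-1)); rewrite imE.
  by apply: is_derive_near; near=> t; rewrite imE E.
Unshelve. all: by end_near. Qed.

Variables (W : set S2) (f : C -> S2) (lamW : S2 -> R).
Hypothesis Hcov : holomorphic_universal_covering W f.
Hypothesis Hhyp : forall z, disk z -> pull lamW f z = lambda_disk z.

(** In a fixed chart the curve is a holomorphic function of a segment. *)
Lemma segment_curve a b t : disk (segment a b t) ->
  C1_curve_at (fun s => f (segment a b s)) t /\
  lamW (f (segment a b t)) * speed (fun s => f (segment a b s)) t = lambda_disk (segment a b t) * cmod (b - a).
Proof.
move=> Dt; set cv := fun s => f (segment a b s).
have [bb [g [g1 [r [r0 gz Hg]]]]] := local_chart (cov_hol Hcov) Dt.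
set w := segment a b t in Dt gz Hg *.
have ww : cmod (w - w) < r by rewrite subrr cmod0.
have [_ _ embw Ew] := Hg w ww.
have [cc [a' [b' [_ h2]]]] := @holomorphic_hjets R g g1 w r r0 (fun w h => let: And4 _ H _ _ := Hg w h in H).
have cg1 := cdiff_cont (hjet_cdiff h2).
have chartE s : cmod (segment a b s - w) < r -> chart (cv t) (cv s) = g (segment a b s).
  move=> sr; have [_ _ embs _] := Hg _ sr.
  by rewrite /cv -/w -embw -embs chart_emb.
have near_r s : cmod (segment a b s - w) < r -> \forall s' \near s, cmod (segment a b s' - w) < r.
  exact: segment_near.
have D s : cmod (segment a b s - w) < r ->
    is_derive s 1 (re_at cv t) (re (g1 (segment a b s) * (b - a))) /\
    is_derive s 1 (im_at cv t) (im (g1 (segment a b s) * (b - a))).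
  move=> sr; have [_ cgs _ _] := Hg _ sr; have [dr di] := segment_deriv cgs.
  have ns := near_r s sr.
  split; [apply: is_derive_near dr|apply: is_derive_near di]; apply: filterS ns => s' /chartE E.
  - by rewrite /re_at E.
  - by rewrite /im_at E.
have nt := near_r t ww.
have cseg : {for t, continuous (segment a b)}.
  by apply/cont_CP => e e0; apply: segment_near; rewrite subrr cmod0.
have cG : {for t, continuous (fun s => g1 (segment a b s))} by exact: (continuous_comp cseg cg1).
have cm0 : 0 < cmod (b - a) + 1 by rewrite ltr_wpDl ?cmod_ge0.
have cGe e : 0 < e -> \forall s \near t, cmod (g1 (segment a b s) * (b - a) - g1 w * (b - a)) < e.
  move=> e0; have := (cont_CP _ _).1 cG (e / (cmod (b - a) + 1)) (divr_gt0 e0 cm0).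
  apply: filterS => s; rewrite -/w -mulrBl [cmod (_ * (b - a))]cmodM ltr_pdivlMr //.
  by apply: le_lt_trans; rewrite ler_wpM2l ?cmod_ge0 // lerDl.
split.
- split.
  + have [cf _] := cov_hol Hcov Dt; exact: (continuous_comp cseg cf).
  + by apply: filterS nt => s /D[[d1 _] [d2 _]].
  + apply/cont_RP => e e0; apply: filterS2 nt (cGe e e0) => s sr h.
    rewrite (is_derive_derive1 (D s sr).1) (is_derive_derive1 (D t ww).1).
    by apply: le_lt_trans h; rewrite -reN -reD; exact: re_le_cmod.
  + apply/cont_RP => e e0; apply: filterS2 nt (cGe e e0) => s sr h.
    rewrite (is_derive_derive1 (D s sr).2) (is_derive_derive1 (D t ww).2).
    by apply: le_lt_trans h; rewrite -imN -imD; exact: im_le_cmod.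
- rewrite /speed (is_derive_derive1 (D t ww).1) (is_derive_derive1 (D t ww).2) mkCE.
  rewrite [cmod (_ * (b - a))]cmodM mulrA -/w -Hhyp // /pull Ew dens_chart //.
  by rewrite embw.
Qed.

(** The image of a segment of the disc will do. Such a curve is needed because the real
    part of an infinite infimum is 0, and [metric_dist] takes the real part. *)
Lemma finite_length (u v : S2) : W u -> W v ->
  exists2 cv, curve_joining W u v cv & (metric_length lamW cv < +oo)%E.
Proof.
move=> /(cov_surj Hcov)[a Da <-] /(cov_surj Hcov)[b Db <-].
pose r := Num.max (cmod a) (cmod b).
have r1 : r < 1 by rewrite gt_max; apply/andP.
have r0 : 0 <= r by rewrite le_max cmod_ge0.
have segr t : 0 <= t <= 1 -> cmod (segment a b t) <= r.
  by apply: segment_mod; rewrite le_max lexx ?orbT.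
have Ds t : 0 <= t <= 1 -> disk (segment a b t) by move=> /segr h; exact: disk_bound h r1.
exists (fun s => f (segment a b s)).
  split.
  - exists [:: 1]; split; first by split; rewrite /= ?ltr01.
    move=> [|//] _ /=; exists (fun s => f (segment a b s)) => t t01; split => //.
    by have [] := segment_curve (Ds t t01).
  - by move=> t /Ds; exact: (cov_in Hcov).
  - by congr f; rewrite /segment; apply: CP; rewrite !reimE'; ring.
  - by congr f; rewrite /segment; apply: CP; rewrite !reimE'; ring.
pose M := (1 - r ^+ 2)^-1 * cmod (b - a).
have rr : 0 < 1 - r ^+ 2 by rewrite subr_gt0 expr_lt1.
have M0 : 0 <= M by rewrite mulr_ge0 ?cmod_ge0 // invr_ge0 ltW.
apply: (@le_lt_trans _ _ (\int[@lebesgue_measure R]_(t in `[0%R, 1%R]) (cst M%:E) t)%E); last first.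
  have -> : (\int[@lebesgue_measure R]_(t in `[0%R, 1%R]) (cst M%:E) t = M%:E * (@lebesgue_measure R) `[0%R, 1%R])%E.
    exact: integral_cst.
  have -> : (@lebesgue_measure R) `[0%R, 1%R] = 1%E.
    by rewrite lebesgue_measure_itv /= lte_fin ltr01 /= sube0.
  by rewrite mule1 ltry.
apply: integral_mono => //.
- move=> t; rewrite /= in_itv /= => t01; rewrite (segment_curve (Ds t t01)).2 lee_fin.
  by rewrite mulr_ge0 ?cmod_ge0 // ltW // lambda_disk_gt0 //; exact: Ds.
- move=> t; rewrite /= in_itv /= => t01; rewrite (segment_curve (Ds t t01)).2 lee_fin.
  rewrite /M ler_wpM2r ?cmod_ge0 // lambda_diskE lef_pV2 ?posrE //; last first.
    by rewrite subr_gt0; case/andP: (disk_sq (Ds t t01)).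
  by rewrite lerB // le_sq ?cmod_ge0 // segr.
Qed.

Lemma dist_lower (u v : S2) (L : R) : W u -> W v ->
  (forall cv, curve_joining W u v cv -> (L%:E <= metric_length lamW cv)%E) -> L <= metric_dist W lamW u v.
Proof.
move=> Wu Wv HL; have [cv jcv fcv] := finite_length Wu Wv.
rewrite /metric_dist; set I := ereal_inf _.
have LI : (L%:E <= I)%E by apply: le_ereal_inf_tmp => _ [cv' jcv' <-]; exact: HL.
have If : (I < +oo)%E by apply: le_lt_trans fcv; apply: ereal_inf_lbound; exists cv.
by case: I LI If => [x||] //=; rewrite lee_fin.
Qed.
End Distance.

(** * Rigidity *)

Section Main.
Variable R : realType.
Local Notation C := (CC R).
Local Notation S2 := (sphere R).
Implicit Types (z w : C) (p q : S2) (K : R).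

Lemma outside_cusp p q K0 : exists2 K, K0 <= K & ~ cusp p K q.
Proof.
case: q => [w|]; last by exists K0 => // -[z []].
exists (Num.max K0 (ell p w + 1)); first by rewrite le_max lexx.
move=> [z [[<-] _]]; rewrite ge_max => /andP[_]; rewrite leNgt ltrDl ltr01 //.
Qed.

(** The bound exp(-dl / (l - K0)) on the quotient rho leaves a deficit 1 - rho of order
    at least 1 / (l + c), while ed, which stands for exp(-2 d), is at most of that order. *)
Lemma deficit_algebra (K0 c dl l K1 rho ed eps : R) : 1 <= K0 + c -> 0 < dl -> K0 + 1 <= l -> K1 + c > 0 ->
  rho * expR (dl / (l - K0)) <= 1 -> ed * (l + c) <= K1 + c -> 0 < eps ->
  `|rho - 1| <= eps * ed -> dl / (1 + dl) <= eps * (K1 + c).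
Proof.
move=> Kc dl0 lK K1c Hr Hd e0 Hn.
have s1 : 1 <= l - K0 by rewrite lerBrDl.
have s0 : 0 < l - K0 by apply: lt_le_trans s1.
have lc : 0 < l + c by lra.
have sd : 0 < l - K0 + dl by rewrite addr_gt0.
have h1 : rho <= (l - K0) / (l - K0 + dl).
  have [r0|r0] := ltP 0 rho; last by apply: le_trans r0 _; exact: divr_ge0 (ltW s0) (ltW sd).
  rewrite (ler_pdivlMr _ _ sd) -[l - K0 in X in _ <= X]mul1r.
  apply: le_trans (ler_wpM2r (ltW s0) Hr); rewrite -mulrA (ler_pM2l r0).
  have := ler_wpM2r (ltW s0) (expR_ge1Dx (dl / (l - K0))).
  by rewrite mulrDl mul1r divfK ?gt_eqF.
have h2 : dl / (l - K0 + dl) <= eps * ed.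
  apply: le_trans Hn; rewrite distrC; apply: le_trans (ler_norm _).
  rewrite lerBrDr; apply: le_trans (lerD (lexx _) h1) _.
  by rewrite -mulrDl addrC divff // gt_eqF // addr_gt0.
have h3 : dl / ((1 + dl) * (l + c)) <= dl / (l - K0 + dl).
  have d1 : 0 < 1 + dl by rewrite addr_gt0.
  have d2 : 0 < (1 + dl) * (l + c) by rewrite mulr_gt0.
  rewrite (ler_pM2l dl0) (lef_pV2 d2 sd) mulrDl mul1r.
  have : dl * 1 <= dl * (l + c) by rewrite ler_pM2l //; lra.
  by move: (dl * (l + c)) => x; lra.
have h4 := le_trans h3 h2.
have : dl / (1 + dl) <= eps * ed * (l + c).
  move: h4; rewrite invfM mulrA -[X in _ -> _ <= X]mulr1 => h4.
  have := ler_wpM2r (ltW lc) h4.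
  by rewrite mulfVK ?gt_eqF // mulr1.
by move=> h; apply: le_trans h _; rewrite -mulrA ler_pM2l.
Qed.

Lemma near_puncture p (W : set S2) (z : nat -> S2) K : ~ W p -> (forall n, W (z n)) -> z @ \oo --> p ->
  \forall n \near \oo, cusp p K (z n).
Proof.
move=> Wp Wz zp; have n1 : \forall n \near \oo, z n = p \/ cusp p K (z n) := zp _ (cusp_nbhs p K).
by apply: filterS n1 => n [E|//]; case: Wp; rewrite -E.
Qed.

(** Unless lam = lamW, the strong maximum principle makes lam < lamW everywhere, and then
    Hopf's lemma bounds the deficit of the quotient at z n from below by a multiple of
    exp(-2 d), against the assumption. *)
Lemma rigidity (W : set S2) p (lam lamW : S2 -> R) (z : nat -> S2) q :
  open W -> isolated_boundary_point W p -> hyperbolic_metric W lamW ->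
  conformal_pseudometric W lam -> curvature_le W lam (- 4) ->
  (forall n, W (z n)) -> z @ \oo --> p -> W q ->
  (forall eps, 0 < eps -> \forall n \near \oo,
     `|lam (z n) / lamW (z n) - 1| <= eps * expR (- 2 * metric_dist W lamW (z n) q)) ->
  forall w : S2, W w -> lam w = lamW w.
Proof.
move=> oW iso [f [Hcov Hhyp0]] Hlam Hk Wz zp Wq Has w Ww.
have Hhyp (v : C) : disk v -> pull lamW f v = lambda_disk v by exact: Hhyp0.
have [Wp [K0 HK0]] := isolated_cusp oW iso.
have ahl := ahlfors oW (cov_hol Hcov) (cov_in Hcov) Hlam Hk.
apply: contrapT => ne.
have le v : disk v -> lam (f v) <= lamW (f v).
  move=> Dv; have [d0 _] := hyp_pos Hhyp Dv; have := ahl v Dv.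
  by rewrite -Hhyp // /pull ler_pM2r.
have [v0 Dv0 fv0] := cov_surj Hcov Ww.
have lt0 : pull lam f v0 < lambda_disk v0.
  have [d0 _] := hyp_pos Hhyp Dv0; rewrite -Hhyp // /pull ltr_pM2r //.
  rewrite lt_neqAle le // andbT fv0; exact/eqP.
have Hm v : disk v -> {for v, continuous (pull lam f)} /\ 0 <= pull lam f v <= lambda_disk v.
  move=> Dv; split; first exact: (pull_cont (cov_hol Hcov) (cov_in Hcov) Hlam Dv).
  by rewrite ahl // (pull_ge0 (cov_in Hcov) Hlam Dv).
have Hs := strong_max Hm
  (fun v Dv => pull_jet oW (cov_hol Hcov) (cov_in Hcov) Hlam Hk Dv) Dv0 lt0.
have Hlt u : W u -> lam u < lamW u.
  move=> /(cov_surj Hcov)[v Dv <-]; have [d0 _] := hyp_pos Hhyp Dv; have := Hs v Dv.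
  by rewrite -Hhyp // /pull ltr_pM2r.
have [dl dl0 Hopf] := hopf_cusp oW HK0 Hcov Hhyp Hlam Hk Hlt.
have [c Kc1 Hlow] := lamW_lower Wp HK0 Hcov Hhyp.
have Kc : 0 < K0 + c by apply: lt_le_trans Kc1.
have [K1 K01 nq] := outside_cusp p q K0.
have K1c : 0 < K1 + c by apply: lt_le_trans Kc _; rewrite lerD2r.
pose eps := dl / (1 + dl) / (K1 + c) / 2.
have x0 : 0 < dl / (1 + dl) by rewrite divr_gt0 // addr_gt0.
have eps0 : 0 < eps := divr_gt0 (divr_gt0 x0 K1c) (ltr0n R 2).
have n1 := Has eps eps0; have n2 := near_puncture (Num.max (K0 + 1) K1) Wp Wz zp.
have [n [h1 [u [zu uc uK]]]] : exists n, `|lam (z n) / lamW (z n) - 1| <= eps * expR (- 2 * metric_dist W lamW (z n) q)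
    /\ cusp p (Num.max (K0 + 1) K1) (z n).
  have n3 : \forall n \near \oo, `|lam (z n) / lamW (z n) - 1| <= eps * expR (- 2 * metric_dist W lamW (z n) q)
    /\ cusp p (Num.max (K0 + 1) K1) (z n) by exact: filterI.
  by have [n] := filter_ex n3; exists n.
move: uK; rewrite ge_max => /andP[uK uK1].
rewrite zu in h1.
have uK0 : K0 <= ell p u by apply: le_trans uK; rewrite lerDl.
have Lu := lamW_gt0 HK0 Hcov Hhyp uc uK0.
have Wu : W (pt u) := in_cusp HK0 (lexx K0) uc uK0.
have lc : 0 < ell p u + c by apply: lt_le_trans K1c _; rewrite lerD2r.
have Hr : lam (pt u) / lamW (pt u) * expR (dl / (ell p u - K0)) <= 1.
  by rewrite mulrAC ler_pdivrMr // mul1r; exact: Hopf.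
have Hd : expR (- 2 * metric_dist W lamW (pt u) q) * (ell p u + c) <= K1 + c.
  have h := dist_lower Hcov Hhyp Wu Wq
    (fun cv jcv => length_lower Wp Hcov Hhyp Kc Hlow K01 uc uK1 nq jcv).
  rewrite -[X in _ * X]lnK ?posrE // -expRD -[X in _ <= X]lnK ?posrE // ler_expR.
  by move: h; rewrite mulNr; lra.
have := deficit_algebra Kc1 dl0 uK K1c Hr Hd eps0 h1.
have -> : eps * (K1 + c) = dl / (1 + dl) / 2.
  by rewrite /eps; field; rewrite !gt_eqF // addr_gt0.
by move: (dl / (1 + dl)) x0 => x x0; clear -x0; lra.
Qed.
End Main.

Theorem theorem2p3 (R : realType) (Omega : set (sphere R)) (p : sphere R)
    (lambda lambda_Omega : sphere R -> R) (z : nat -> sphere R) :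
  hyperbolic_domain Omega ->
  isolated_boundary_point Omega p ->
  hyperbolic_metric Omega lambda_Omega ->
  conformal_pseudometric Omega lambda ->
  curvature_le Omega lambda (- 4) ->
  (forall n, Omega (z n)) ->
  z @ \oo --> p ->
  let asymptotic (q : sphere R) :=
    (fun n => lambda (z n) / lambda_Omega (z n)) =
      (fun=> 1) +o_\oo
      (fun n => expR (- 2 * metric_dist Omega lambda_Omega (z n) q)) in
  (exists2 q, Omega q & asymptotic q) ->
  (forall q, Omega q -> asymptotic q) /\
  (forall w, Omega w -> lambda w = lambda_Omega w).
Proof.
move=> [_ oW _ _] iso hyp Hlam Hk Wz zp asymptotic [q0 Wq0 as0].
have eq w : Omega w -> lambda w = lambda_Omega w.
  apply: (rigidity oW iso hyp Hlam Hk Wz zp Wq0) => eps eps0.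
  have := (eqaddoP _ _ _ _).1 as0 eps eps0.
  by apply: filterS => n; rewrite /= [X in _ <= _ * X]gtr0_norm ?expR_gt0.
split => // q Wq; apply/eqaddoP => eps eps0.
have [f [Hcov Hhyp]] := hyp.
apply: nearW => n /=; rewrite !fctE eq // divff; last first.
  by rewrite gt_eqF //; apply: (hyp_gt0 Hcov Hhyp).
by rewrite subrr normr0 mulr_ge0 // ltW.
Qed.
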